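(* Let $\alpha>0$, $\sigma>0$, $C>0$ and $0\le\beta<2$ be fixed, and set $\sigma_{\rm opt}=\frac{\pi\sqrt{2(2-\beta)}}{\sqrt{\alpha}}$ and $\eta=\frac{\sigma_{\rm opt}}{\sigma}$. If $g$ is analytic in a neighborhood of $S_\beta$, then there exist coefficients $\{a_j^{(g)}\}_{j=1}^{N_1}$, $\{\widetilde a_j^{(g)}\}_{j=1}^{N_1}$ and polynomials $P^{(g)}_{N_2}$, $\widetilde P^{(g)}_{N_2}$ of degree $N_2=\mathcal{O}(\sqrt{N_1})=\mathcal{O}(\sqrt{N})$, where $N=N_1+N_2$, such that the rational functions $$r_N^{(g)}(z)=\sum_{j=1}^{N_1}\frac{a_j^{(g)}}{z-p_j}+P^{(g)}_{N_2}(z),\qquad \widetilde r_N^{(g)}(z)=\sum_{j=1}^{N_1}\frac{\widetilde a_j^{(g)}}{z-p_j}+\widetilde P^{(g)}_{N_2}(z),$$ with poles $p_j=-C\exp(-\sigma(\sqrt{N_1}-\sqrt{j}))$, $1\le j\le N_1$, satisfy, as $N\to\infty$, $$\|r_N^{(g)}(z)-g(z)z^\alpha\|_{C(S_\beta)}=\begin{cases}\mathcal{O}\left(e^{-\sigma\alpha\sqrt{N}}\right),&\sigma\le\sigma_{\rm opt},\\ \mathcal{O}\left(e^{-\pi\eta\sqrt{2(2-\beta)N\alpha}}\right),&\sigma>\sigma_{\rm opt},\end{cases}$$ $$\|\widetilde r_N^{(g)}(z)-g(z)z^\alpha\log z\|_{C(S_\beta)}=\begin{cases}\mathcal{O}\left(\sqrt{N}e^{-\sigma\alpha\sqrt{N}}\right),&\sigma\le\sigma_{\rm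 opt},\\ \mathcal{O}\left(e^{-\pi\eta\sqrt{2(2-\beta)N\alpha}}\right),&\sigma>\sigma_{\rm opt},\end{cases}$$ and, when $\alpha$ is a positive integer, $$\|\widetilde r_N^{(g)}(z)-g(z)z^\alpha\log z\|_{C(S_\beta)}=\begin{cases}\mathcal{O}\left(e^{-\sigma\alpha\sqrt{N}}\right),&\sigma\le\sigma_{\rm opt},\\ \mathcal{O}\left(e^{-\pi\eta\sqrt{2(2-\beta)N\alpha}}\right),&\sigma>\sigma_{\rm opt}.\end{cases}$$
   Context: For $\beta\in[0,2)$, $S_\beta=\{z: z=xe^{\pm\frac{\theta\pi}{2}i},\ x\in[0,1],\ \theta\in[0,\beta]\}$, and $\|\cdot\|_{C(S_\beta)}$ is the maximum norm over $S_\beta$. The functions $z^\alpha$ and $\log z$ are the principal branches, and $z^\alpha$, $z^\alpha\log z$ are given the value $0$ at $z=0$. All coefficients, polynomials and poles depend on $N_1$; $N_2=N_2(N_1)$. *)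

(* Defs.v *)
(* Stdlib reals with Coquelicot's complex numbers. *)
From Stdlib Require Export Reals.
From Coquelicot Require Export Coquelicot.
Open Scope R_scope.

Definition Cexp (z : C) : C := (exp (Re z) * cos (Im z), exp (Re z) * sin (Im z)).

(* Principal argument, in (-PI, PI]; junk at 0, where it is never used. *)
Definition Carg (z : C) : R :=
  if Rle_dec 0 (Im z) then acos (Re z / Cmod z) else - acos (Re z / Cmod z).

Definition Clog (z : C) : C := (ln (Cmod z), Carg z).

Definition zpow (alpha : R) (z : C) : C :=
  if Ceq_dec z 0 then RtoC 0 else Cexp (RtoC alpha * Clog z).

Definition zpow_log (alpha : R) (z : C) : C :=
  if Ceq_dec z 0 then RtoC 0 else Cmult (zpow alpha z) (Clog z).

Definition sector (beta : R) (z : C) : Prop :=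
  exists x theta : R,
    0 <= x <= 1 /\ 0 <= theta <= beta /\
    (z = Cmult x (Cexp (0, theta * PI / 2)) \/
     z = Cmult x (Cexp (0, - (theta * PI / 2)))).

(* Sum of a convergent power series on a disc around [z0]. *)
Definition analytic_at (g : C -> C) (z0 : C) : Prop :=
  exists (c : nat -> C) (r : R),
    0 < r /\
    forall z : C, Cmod (Cminus z z0) < r ->
      is_pseries (K := C_AbsRing) (V := C_NormedModule) c (Cminus z z0) (g z).

Definition analytic_in_nbhd (S : C -> Prop) (g : C -> C) : Prop :=
  exists U : C -> Prop,
    open (T := C_UniformSpace) U /\
    (forall z, S z -> U z) /\
    (forall z, U z -> analytic_at g z).

(* Valued in [Rbar], so that the norm of an unbounded function is [p_infty]
   instead of being truncated to a real number. *)
Definition sup_norm (S : C -> Prop) (f : C -> C) : Rbar :=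
  Lub_Rbar (fun y => exists z, S z /\ y = Cmod (f z)).

Definition bigO (u : nat -> Rbar) (v : nat -> R) : Prop :=
  exists K : R, eventually (fun n => Rbar_le (Rbar_abs (u n)) (K * Rabs (v n))).

(* The pole p_j, for 1 <= j <= N1. *)
Definition pole (A sigma : R) (N1 j : nat) : R :=
  - A * exp (- sigma * (sqrt (INR N1) - sqrt (INR j))).

Definition ratfun (p : nat -> R) (N1 : nat) (a : nat -> C)
    (N2 : nat) (c : nat -> C) (z : C) : C :=
  Cplus (sum_n_m (fun j => Cdiv (a j) (Cminus z (p j))) 1 N1)
        (sum_n (fun k => Cmult (c k) (Cpow z k)) N2).

Definition sigma_opt (alpha beta : R) : R :=
  PI * sqrt (2 * (2 - beta)) / sqrt alpha.

(* Main.v *)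
Require Import Defs.
From Stdlib Require Import Lra Lia Psatz ClassicalEpsilon.

(** Put [y = A exp (sigma (s - sqrt N1))].  Then the prescribed poles are [- y] at [s = sqrt j], and
    the poles of the function [f (s) = y^alpha / (1 + z / y)] nearest to the real axis are at
    [Re s = x], [Im s = (arg z +- PI) / sigma], where [|z| = A exp (sigma (x - sqrt N1))].  The
    terms [f (sqrt j) / (2 sqrt j)] with [j <= N1] are simple fractions in [z] with the prescribed
    poles, and they form the rectangle rule, in the variable [s^2], for the integral of [f].

    Two contour arguments turn this into an approximation of [z^alpha].  First, [f] is multiplied by
    [exp (2 PI i alpha)] under the shift by [2 PI i / sigma], and a strip of that height contains one
    pole, with residue proportional to [z^alpha]; so up to the edges of the strip [z^alpha] is a
    multiple of [1 - exp (2 PI i alpha)] times the integral of [f] along a line ([period_identity]).  Second, the kernels [1 / (exp (-+ 2 PI i s^2) - 1)],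
    small in the upper and lower half plane, have their poles at the nodes [sqrt j], so the
    difference between sum and integral is a contour integral around them
    ([quadrature_identity]).  Moving the contour to [Im s = +- 2 PI / sigma] crosses these two poles, if
    they lie to the right of the left edge.  The following terms remain.
    - On the left edge, [y^alpha] has size [exp (- sigma alpha sqrt N1)].  The edge is one of two
      fixed lines near [Re s = 1], whichever is away from the poles.
    - At the crossed poles and on the horizontal lines, the kernel is at most
      [exp (- 4 PI x h)], up to a constant, with [h] the least height [(PI - beta PI / 2) / sigma] of
      a pole.  Against [|y|^alpha] this gives an exponential that is linear in [x] in the exponent,
      so that its maximum is at an end: it is [exp (- sigma alpha sqrt N1)] when
      [sigma alpha <= 4 PI h], which says [sigma <= sigma_opt], and [exp (- 4 PI h sqrt N1)] otherwise.
    - On the right edge, where [|y| >= 2], a geometric series in [z / y] gives a polynomial in [z].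
    - The terms with [j > N1] are [1 / (1 + z / y_j)] with [y_j >= A], hence also polynomials in [z]
      up to a geometrically small error.

    For [z^alpha log z] the integrand gets the weight [log y].  It is of order [sqrt N1] at the left
    end and bounded at the right end, which explains the factor [sqrt N] for [sigma <= sigma_opt] and
    its absence for [sigma > sigma_opt].  If [alpha] is an integer, the weighted integral cancels
    from the period identity, which then expresses [z^alpha log z] by the integral without weight,
    and the factor disappears altogether ([log_integer_approximable]).

    The remaining ingredient is that a function [g] analytic near the sector is approximated by
    polynomials of degree [n] with an error [O (rho^n)], [rho < 1] ([geometric_approximation]).
    Since the sector is star-shaped, [g (z)] is given by Cauchy's formula for [q |-> g (z q)] on a
    thin rectangle around [[0, 1]], with the kernel [du / (u - 1)], where
    [u = (1 - exp (- L q)) / (1 - exp (- L))] fixes [0] and [1] and satisfies [|u| > R > 1] on the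
    rectangle.  Expanding the kernel in powers of [1 / u] gives a geometric remainder, and the
    coefficients are polynomials in [z] because their only singularity is [q = 0].  Multiplying by
    such an approximation of [g] keeps the poles.  As degrees proportional to [sqrt N1] suffice,
    [sqrt N - sqrt N1] is bounded.

    All contour integrals run over rectangles, for which Goursat's argument proves Cauchy's
    theorem. *)

(** * Complex differentiability *)

(** The scalar field carries the topology of its absolute value here, so that products and
    compositions fall under the general rules for derivatives. *)
Definition Cdiff (f : C -> C) (z : C) : Prop :=
  @ex_derive C_AbsRing (AbsRing_NormedModule C_AbsRing) f z.

Lemma is_derive_C_iff (f : C -> C) (z l : C) :
  @is_derive C_AbsRing (AbsRing_NormedModule C_AbsRing) f z l <->
  (forall eps : R, 0 < eps -> exists delta : R, 0 < delta /\
     forall w : C, Cmod (w - z) < delta ->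
       Cmod (f w - f z - l * (w - z)) <= eps * Cmod (w - z)).
Proof.
split.
- intros [_ H] eps Heps.
  specialize (H z (fun P HP => HP) (mkposreal eps Heps)).
  destruct H as [d Hd]. exists d. split. apply cond_pos.
  intros w Hw. specialize (Hd w Hw).
  change (Cmod ((f w - f z) - (w - z) * l)%C <= eps * Cmod (w - z)%C) in Hd.
  now rewrite (Cmult_comm l).
- intros H. split.
  + apply is_linear_scal_l.
  + intros x Hx.
    assert (x = z) as ->.
    { symmetry; apply (is_filter_lim_locally_unique (K := C_AbsRing) (V := AbsRing_NormedModule C_AbsRing)).
      exact Hx. }
    intros eps. destruct (H eps (cond_pos eps)) as [d [Hd H1]].
    exists (mkposreal d Hd). intros w Hw.
    change (Cmod ((f w - f z) - (w - z) * l)%C <= eps * Cmod (w - z)%C).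
    rewrite (Cmult_comm _ l). now apply H1.
Qed.

Lemma Cdiff_iff (f : C -> C) (z : C) :
  Cdiff f z <->
  exists l : C, forall eps : R, 0 < eps -> exists delta : R, 0 < delta /\
     forall w : C, Cmod (w - z) < delta ->
       Cmod (f w - f z - l * (w - z)) <= eps * Cmod (w - z).
Proof.
split; intros [l H]; exists l; now apply is_derive_C_iff.
Qed.

Lemma Cdiff_const (c z : C) : Cdiff (fun _ => c) z.
Proof. exists (@zero C_AbsRing). apply (is_derive_const (K := C_AbsRing) (V := AbsRing_NormedModule C_AbsRing)). Qed.

Lemma Cdiff_id (z : C) : Cdiff (fun w => w) z.
Proof. exists (RtoC 1). apply (is_derive_id (K := C_AbsRing)). Qed.

Lemma Cdiff_plus (f g : C -> C) (z : C) :
  Cdiff f z -> Cdiff g z -> Cdiff (fun w => f w + g w)%C z.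
Proof.
intros [l Hl] [m Hm]. exists (l + m)%C.
apply (is_derive_plus (K := C_AbsRing) (V := AbsRing_NormedModule C_AbsRing) f g z l m Hl Hm).
Qed.

Lemma Cdiff_mult (f g : C -> C) (z : C) :
  Cdiff f z -> Cdiff g z -> Cdiff (fun w => f w * g w)%C z.
Proof.
intros [l Hl] [m Hm]. eexists.
apply (is_derive_mult (K := C_AbsRing) f g z l m Hl Hm).
intros; apply Cmult_comm.
Qed.

Lemma Cdiff_comp (f g : C -> C) (z : C) :
  Cdiff f (g z) -> Cdiff g z -> Cdiff (fun w => f (g w)) z.
Proof.
intros [l Hl] [m Hm]. eexists.
apply (is_derive_comp (K := C_AbsRing) (V := AbsRing_NormedModule C_AbsRing) f g z l m Hl Hm).
Qed.

Lemma Cdiff_ext (f g : C -> C) (z : C) :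
  (forall w, f w = g w) -> Cdiff f z -> Cdiff g z.
Proof.
intros H [l Hl]. exists l.
now apply (is_derive_ext (K := C_AbsRing) (V := AbsRing_NormedModule C_AbsRing) f g).
Qed.

Lemma Cdiff_minus (f g : C -> C) (z : C) :
  Cdiff f z -> Cdiff g z -> Cdiff (fun w => f w - g w)%C z.
Proof.
intros Hf Hg. apply Cdiff_plus; [exact Hf|].
apply (Cdiff_ext (fun w => RtoC (Ropp 1) * g w)%C).
- intros w. rewrite RtoC_opp. ring.
- apply Cdiff_mult; [apply Cdiff_const | exact Hg].
Qed.

Lemma Cdiff_continuous (f : C -> C) (z : C) :
  Cdiff f z ->
  forall eps : R, 0 < eps -> exists delta : R, 0 < delta /\
    forall w : C, Cmod (w - z) < delta -> Cmod (f w - f z) < eps.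
Proof.
intros H eps Heps. apply Cdiff_iff in H. destruct H as [l H].
destruct (H 1 Rlt_0_1) as [d [Hd H1]].
set (k := 2 + Cmod l).
assert (Hk : 0 < k) by (unfold k; generalize (Cmod_ge_0 l); lra).
exists (Rmin d (eps / k)). split.
{ apply Rmin_glb_lt; [exact Hd | now apply Rdiv_lt_0_compat]. }
intros w Hw.
assert (Hw1 := Rlt_le_trans _ _ _ Hw (Rmin_l _ _)).
assert (Hw2 := Rlt_le_trans _ _ _ Hw (Rmin_r _ _)).
specialize (H1 w Hw1).
replace (f w - f z)%C with ((f w - f z - l * (w - z)) + l * (w - z))%C by ring.
eapply Rle_lt_trans; [apply Cmod_triangle|]. rewrite Cmod_mult.
assert (0 <= Cmod (w - z)) by apply Cmod_ge_0.
apply Rle_lt_trans with ((1 + Cmod l) * Cmod (w - z)); [lra|].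
apply (Rmult_lt_compat_l k) in Hw2; [|exact Hk].
replace (k * (eps / k)) with eps in Hw2 by (field; lra).
unfold k in Hw2. lra.
Qed.

Lemma Cmod_minus_rev (u v : C) : Cmod u - Cmod v <= Cmod (u - v).
Proof.
assert (H := Cmod_triangle (u - v) v).
replace (u - v + v)%C with u in H by ring. lra.
Qed.

Lemma Cmod_minus_sym (u v : C) : Cmod (u - v) = Cmod (v - u).
Proof. rewrite <- Cmod_opp. f_equal. ring. Qed.

Lemma Cdiff_inv_at (z : C) : z <> 0 -> Cdiff (fun w => / w)%C z.
Proof.
intros Hz. apply Cdiff_iff. exists (- / (z * z))%C. intros eps Heps.
assert (Hm : 0 < Cmod z) by now apply Cmod_gt_0.
set (m := Cmod z) in *.
assert (He : 0 < eps * (m * m * m) / 2) by (apply Rdiv_lt_0_compat; [|lra]; repeat apply Rmult_lt_0_compat; lra).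
exists (Rmin (m / 2) (eps * (m * m * m) / 2)). split.
{ apply Rmin_glb_lt; lra. }
intros w Hw.
assert (Hw1 := Rlt_le_trans _ _ _ Hw (Rmin_l _ _)).
assert (Hw2 := Rlt_le_trans _ _ _ Hw (Rmin_r _ _)).
assert (Hwm : m / 2 < Cmod w).
{ assert (H := Cmod_minus_rev z w). rewrite Cmod_minus_sym in H. fold m in H. lra. }
assert (Hw0 : w <> 0) by (apply Cmod_gt_0; lra).
replace (/ w - / z - - / (z * z) * (w - z))%C with ((w - z) * (w - z) / (w * (z * z)))%C by (field; split; assumption).
rewrite Cmod_div; [|repeat apply Cmult_neq_0; assumption].
rewrite !Cmod_mult. fold m.
assert (Hp : 0 < Cmod w * (m * m)) by (repeat apply Rmult_lt_0_compat; lra).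
apply (Rmult_le_reg_r (Cmod w * (m * m))); [exact Hp|].
replace (Cmod (w - z) * Cmod (w - z) / (Cmod w * (m * m)) * (Cmod w * (m * m)))
  with (Cmod (w - z) * Cmod (w - z)) by (field; split; lra).
replace (eps * Cmod (w - z) * (Cmod w * (m * m))) with ((eps * Cmod w * (m * m)) * Cmod (w - z)) by ring.
apply Rmult_le_compat_r; [apply Cmod_ge_0|].
apply Rle_trans with (1 := Rlt_le _ _ Hw2).
replace (eps * (m * m * m) / 2) with (eps * (m / 2) * (m * m)) by field.
apply Rmult_le_compat_r; [nra|]. apply Rmult_le_compat_l; lra.
Qed.

Lemma Cdiff_inv (f : C -> C) (z : C) :
  Cdiff f z -> f z <> 0 -> Cdiff (fun w => / f w)%C z.
Proof.
intros Hf Hz. apply (Cdiff_comp (fun w => / w)%C f); [|exact Hf].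
now apply Cdiff_inv_at.
Qed.

Lemma Cdiff_div (f g : C -> C) (z : C) :
  Cdiff f z -> Cdiff g z -> g z <> 0 -> Cdiff (fun w => f w / g w)%C z.
Proof.
intros Hf Hg Hz. apply Cdiff_mult; [exact Hf|]. now apply Cdiff_inv.
Qed.

Lemma Cdiff_pow (f : C -> C) (z : C) (n : nat) :
  Cdiff f z -> Cdiff (fun w => Cpow (f w) n) z.
Proof.
intros Hf. induction n as [|n IH].
- exact (Cdiff_const (RtoC 1) z).
- exact (Cdiff_mult f (fun w => Cpow (f w) n) z Hf IH).
Qed.

(** * The complex exponential *)

Lemma Cexp_plus (z w : C) : Cexp (z + w) = (Cexp z * Cexp w)%C.
Proof.
destruct z as [a b], w as [c d]. unfold Cexp, Cmult; simpl.
rewrite exp_plus, cos_plus, sin_plus. f_equal; ring.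
Qed.

Lemma Cexp_RtoC (x : R) : Cexp (RtoC x) = RtoC (exp x).
Proof. unfold Cexp, RtoC; simpl. rewrite cos_0, sin_0. f_equal; ring. Qed.

Lemma Cexp_0 : Cexp 0 = 1.
Proof. rewrite Cexp_RtoC, exp_0. reflexivity. Qed.

Lemma Cmod_Cexp (z : C) : Cmod (Cexp z) = exp (Re z).
Proof.
unfold Cmod, Cexp; simpl.
replace (_ + _) with ((exp (Re z))²).
- apply sqrt_Rsqr. left; apply exp_pos.
- assert (H := sin2_cos2 (Im z)). unfold Rsqr in *.
  transitivity (exp (Re z) * exp (Re z) * (sin (Im z) * sin (Im z) + cos (Im z) * cos (Im z))).
  + rewrite H. ring.
  + ring.
Qed.

Lemma Cexp_neq_0 (z : C) : Cexp z <> 0.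
Proof. apply Cmod_gt_0. rewrite Cmod_Cexp. apply exp_pos. Qed.

Lemma Cexp_opp (z : C) : Cexp (- z) = (/ Cexp z)%C.
Proof.
assert (H := Cexp_neq_0 z).
transitivity (Cexp (- z) * Cexp z / Cexp z)%C.
- now field.
- rewrite <- Cexp_plus. replace (- z + z)%C with (RtoC 0) by ring.
  rewrite Cexp_0. now field.
Qed.

Lemma derivable_pt_lim_0_bound (f : R -> R) (l eps : R) :
  derivable_pt_lim f 0 l -> 0 < eps ->
  exists delta : R, 0 < delta /\
    forall h, Rabs h < delta -> Rabs (f h - f 0 - l * h) <= eps * Rabs h.
Proof.
intros H Heps. destruct (H eps Heps) as [d Hd].
exists d. split; [apply cond_pos|]. intros h Hh.
destruct (Req_dec h 0) as [->|Hn].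
- replace (f 0 - f 0 - l * 0) with 0 by ring. rewrite Rabs_R0. lra.
- specialize (Hd h Hn Hh). rewrite Rplus_0_l in Hd.
  replace (f h - f 0 - l * h) with (((f h - f 0) / h - l) * h) by now field.
  rewrite Rabs_mult. apply Rmult_le_compat_r; [apply Rabs_pos | lra].
Qed.

Lemma Rabs_Re_le (z : C) : Rabs (Re z) <= Cmod z.
Proof. apply re_le_Cmod. Qed.

Lemma Rabs_Im_le (z : C) : Rabs (Im z) <= Cmod z.
Proof. eapply Rle_trans; [apply Rmax_r | apply (Rmax_Cmod z)]. Qed.

Lemma Cmod_le_Re_Im (z : C) : Cmod z <= Rabs (Re z) + Rabs (Im z).
Proof.
destruct z as [a b]. simpl.
replace ((a, b) : C) with (RtoC a + Ci * RtoC b)%C by (unfold RtoC, Ci, Cmult, Cplus; simpl; f_equal; ring).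
eapply Rle_trans; [apply Cmod_triangle|].
rewrite Cmod_mult, Cmod_Ci, !Cmod_R. lra.
Qed.

Lemma Cdiff_Cexp_0 (eps : R) : 0 < eps ->
  exists delta : R, 0 < delta /\
    forall h : C, Cmod h < delta -> Cmod (Cexp h - 1 - h) <= eps * Cmod h.
Proof.
intros Heps. set (e := Rmin 1 (eps / 12)).
assert (He : 0 < e) by (apply Rmin_glb_lt; lra).
assert (He1 : e <= 1) by apply Rmin_l.
assert (He2 : e <= eps / 12) by apply Rmin_r.
clearbody e.
destruct (derivable_pt_lim_0_bound _ _ _ derivable_pt_lim_exp_0 He) as [d1 [Hd1 H1]].
destruct (derivable_pt_lim_0_bound _ _ _ derivable_pt_lim_cos_0 He) as [d2 [Hd2 H2]].
destruct (derivable_pt_lim_0_bound _ _ _ derivable_pt_lim_sin_0 He) as [d3 [Hd3 H3]].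
exists (Rmin e (Rmin d1 (Rmin d2 d3))). split.
{ repeat apply Rmin_glb_lt; assumption. }
intros [a b] Hh.
assert (Ha : Rabs a <= Cmod (a, b)) by apply (Rabs_Re_le (a, b)).
assert (Hb : Rabs b <= Cmod (a, b)) by apply (Rabs_Im_le (a, b)).
set (m := Cmod (a, b)) in *.
assert (Hm0 := Rlt_le_trans _ _ _ Hh (Rmin_l _ _)).
assert (Hm := Rlt_le_trans _ _ _ Hh (Rmin_r _ _)).
assert (Hm1 := Rlt_le_trans _ _ _ Hm (Rmin_l _ _)).
assert (Hm' := Rlt_le_trans _ _ _ Hm (Rmin_r _ _)).
assert (Hm2 := Rlt_le_trans _ _ _ Hm' (Rmin_l _ _)).
assert (Hm3 := Rlt_le_trans _ _ _ Hm' (Rmin_r _ _)).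
specialize (H1 a ltac:(lra)). specialize (H2 b ltac:(lra)). specialize (H3 b ltac:(lra)).
rewrite exp_0 in H1. rewrite cos_0 in H2. rewrite sin_0 in H3.
assert (Hm4 : 0 <= m) by apply Cmod_ge_0.
assert (Ea : Rabs (exp a - 1) <= 2 * m).
{ replace (exp a - 1) with ((exp a - 1 - 1 * a) + a) by ring.
  eapply Rle_trans; [apply Rabs_triang|]. nra. }
assert (Eb : exp a <= 3).
{ assert (H := Rle_abs (exp a - 1)). nra. }
assert (Ec : Rabs (sin b) <= 2 * m).
{ replace (sin b) with ((sin b - 0 - 1 * b) + b) by ring.
  eapply Rle_trans; [apply Rabs_triang|]. nra. }
eapply Rle_trans; [apply Cmod_le_Re_Im|]. unfold Cexp; simpl.
replace (exp a * cos b + -(1) + - a) with ((exp a - 1 - 1 * a) + exp a * (cos b - 1 - 0 * b)) by ring.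
replace (exp a * sin b + - 0 + - b) with ((exp a - 1) * sin b + (sin b - 0 - 1 * b)) by ring.
assert (Hp := exp_pos a).
assert (T1 := Rabs_triang (exp a - 1 - 1 * a) (exp a * (cos b - 1 - 0 * b))).
assert (T2 := Rabs_triang ((exp a - 1) * sin b) (sin b - 0 - 1 * b)).
rewrite Rabs_mult in T1, T2. rewrite (Rabs_pos_eq (exp a)) in T1 by lra.
assert (exp a * Rabs (cos b - 1 - 0 * b) <= 3 * (e * m)).
{ apply Rmult_le_compat; [lra | apply Rabs_pos | lra | nra]. }
assert (Rabs (exp a - 1) * Rabs (sin b) <= (2 * m) * (2 * m)).
{ apply Rmult_le_compat; try apply Rabs_pos; assumption. }
assert (e * Rabs a <= e * m) by nra. assert (e * Rabs b <= e * m) by nra.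
assert (m * m <= e * m) by nra.
assert (12 * (e * m) <= eps * m) by nra.
assert (0 <= e * m) by nra. lra.
Qed.

Notation is_Cderive := (@is_derive C_AbsRing (AbsRing_NormedModule C_AbsRing)).

Lemma is_Cderive_Cexp (z : C) : is_Cderive Cexp z (Cexp z).
Proof.
apply is_derive_C_iff. intros eps Heps.
assert (Hp := exp_pos (Re z)).
destruct (Cdiff_Cexp_0 (eps / exp (Re z))) as [d [Hd H]].
{ now apply Rdiv_lt_0_compat. }
exists d. split; [exact Hd|]. intros w Hw. specialize (H _ Hw).
replace (Cexp w) with (Cexp z * Cexp (w - z))%C.
2:{ rewrite <- Cexp_plus. f_equal. ring. }
replace (Cexp z * Cexp (w - z) - Cexp z - Cexp z * (w - z))%C with (Cexp z * (Cexp (w - z) - 1 - (w - z)))%C by ring.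
rewrite Cmod_mult, Cmod_Cexp.
apply (Rmult_le_compat_l (exp (Re z))) in H; [|lra].
replace (exp (Re z) * (eps / exp (Re z) * Cmod (w - z))) with (eps * Cmod (w - z)) in H by (field; lra).
exact H.
Qed.

Lemma Cdiff_Cexp_at (z : C) : Cdiff Cexp z.
Proof. exists (Cexp z). apply is_Cderive_Cexp. Qed.

Lemma Cdiff_Cexp (f : C -> C) (z : C) : Cdiff f z -> Cdiff (fun w => Cexp (f w)) z.
Proof. intros Hf. apply (Cdiff_comp Cexp f); [apply Cdiff_Cexp_at | exact Hf]. Qed.

Lemma is_Cderive_Cexp_lin (k m z : C) :
  is_Cderive (fun w => Cexp (k * w) - m)%C z (k * Cexp (k * z))%C.
Proof.
apply (is_derive_ext (K := C_AbsRing) (V := AbsRing_NormedModule C_AbsRing)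
  (fun w => (Cexp (k * w) + (- m))%C)); [reflexivity|].
replace (k * Cexp (k * z))%C with (k * Cexp (k * z) + 0)%C by ring.
apply (is_derive_plus (K := C_AbsRing) (V := AbsRing_NormedModule C_AbsRing)
  (fun w => Cexp (k * w)%C) (fun _ => (- m)%C)).
- apply (is_derive_comp (K := C_AbsRing) (V := AbsRing_NormedModule C_AbsRing) Cexp (fun w => (k * w)%C)).
  + apply is_Cderive_Cexp.
  + apply is_derive_C_iff. intros eps Heps. exists 1. split; [lra|]. intros w _.
    replace (k * w - k * z - k * (w - z))%C with (RtoC 0) by ring.
    rewrite Cmod_0. apply Rmult_le_pos; [lra|apply Cmod_ge_0].
- apply (is_derive_const (K := C_AbsRing) (V := AbsRing_NormedModule C_AbsRing)).
Qed.

Lemma cos_eq_1 (x : R) : Rabs x < 2 * PI -> cos x = 1 -> x = 0.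
Proof.
intros Hx Hc.
assert (H : sin (x / 2) = 0).
{ replace x with (2 * (x / 2)) in Hc by field. rewrite cos_2a_sin in Hc. nra. }
apply Rabs_def2 in Hx.
destruct (Rtotal_order x 0) as [L|[E|L]]; [|exact E|].
- assert (0 < sin (- (x / 2))) by (apply sin_gt_0; lra). rewrite sin_neg in *. lra.
- assert (0 < sin (x / 2)) by (apply sin_gt_0; lra). lra.
Qed.

Lemma Cexp_eq_1 (s : C) : Rabs (Im s) < 2 * PI -> Cexp s = 1 -> s = 0.
Proof.
intros Hs H. assert (E := f_equal Cmod H). rewrite Cmod_Cexp, Cmod_1, <- exp_0 in E.
apply exp_inv in E. destruct s as [x y]. simpl in *. subst x.
unfold Cexp in H; simpl in H. injection H as H _. rewrite exp_0, Rmult_1_l in H.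
now rewrite (cos_eq_1 y Hs H).
Qed.

(** * Integrals of complex functions of a real variable *)

Notation Ccontinuous := (@continuous R_UniformSpace C_R_CompleteNormedModule).

Definition CInt (f : R -> C) (a b : R) : C := @RInt C_R_CompleteNormedModule f a b.

Lemma Ccontinuous_eps (f : R -> C) (x : R) :
  (forall eps, 0 < eps -> exists delta, 0 < delta /\
     forall y, Rabs (y - x) < delta -> Cmod (f y - f x) < eps) ->
  Ccontinuous f x.
Proof.
intros H P [eps HP]. destruct (H eps (cond_pos eps)) as [d [Hd H1]].
exists (mkposreal d Hd). intros y Hy. apply HP.
apply C_NormedModule_mixin_compat1.
apply (H1 y Hy).
Qed.

Lemma Cdiff_Ccontinuous (f : C -> C) (p d : C) (x : R) :
  Cdiff f (p + RtoC x * d) -> Ccontinuous (fun t => f (p + RtoC t * d)%C) x.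
Proof.
intros H. apply Ccontinuous_eps. intros eps Heps.
destruct (Cdiff_continuous _ _ H eps Heps) as [e [He H1]].
assert (Hk : 0 < 1 + Cmod d) by (generalize (Cmod_ge_0 d); lra).
exists (e / (1 + Cmod d)). split; [now apply Rdiv_lt_0_compat|].
intros y Hy. apply H1.
replace (p + RtoC y * d - (p + RtoC x * d))%C with (RtoC (y - x) * d)%C by (rewrite RtoC_minus; ring).
rewrite Cmod_mult, Cmod_R.
apply Rle_lt_trans with (Rabs (y - x) * (1 + Cmod d)).
{ apply Rmult_le_compat_l; [apply Rabs_pos | lra]. }
apply (Rmult_lt_compat_r (1 + Cmod d)) in Hy; [|exact Hk].
replace (e / (1 + Cmod d) * (1 + Cmod d)) with e in Hy by (field; lra). exact Hy.
Qed.

Lemma ex_CInt (f : R -> C) (a b : R) : a <= b ->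
  (forall x, a <= x <= b -> Ccontinuous f x) -> @ex_RInt C_R_CompleteNormedModule f a b.
Proof.
intros Hab H. apply ex_RInt_continuous. intros x.
rewrite Rmin_left, Rmax_right by exact Hab. apply H.
Qed.

Notation ex_CIntegral := (@ex_RInt C_R_CompleteNormedModule).

Lemma CInt_ext (f g : R -> C) (a b : R) : a <= b ->
  (forall x, a <= x <= b -> f x = g x) -> CInt f a b = CInt g a b.
Proof.
intros Hab H. apply (RInt_ext (V := C_R_CompleteNormedModule)). intros x.
rewrite Rmin_left, Rmax_right by exact Hab. intros Hx. apply H. lra.
Qed.

Lemma CInt_const (c : C) (a b : R) : CInt (fun _ => c) a b = (RtoC (b - a) * c)%C.
Proof.
unfold CInt. rewrite RInt_const. destruct c as [c1 c2].
unfold RtoC, Cmult; simpl.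
change (((b - a) * c1, (b - a) * c2) = ((b - a) * c1 - 0 * c2, (b - a) * c2 + 0 * c1)).
f_equal; ring.
Qed.

Lemma CInt_plus (f g : R -> C) (a b : R) :
  ex_CIntegral f a b -> ex_CIntegral g a b ->
  CInt (fun x => f x + g x)%C a b = (CInt f a b + CInt g a b)%C.
Proof. intros Hf Hg. apply (RInt_plus (V := C_R_CompleteNormedModule) f g a b Hf Hg). Qed.

Lemma is_CInt_scal (c : C) (f : R -> C) (a b : R) (l : C) :
  @is_RInt C_R_CompleteNormedModule f a b l ->
  @is_RInt C_R_CompleteNormedModule (fun x => c * f x)%C a b (c * l)%C.
Proof.
intros H.
assert (H1 := is_RInt_fct_extend_fst (U := R_NormedModule) (V := R_NormedModule) f a b l H).
assert (H2 := is_RInt_fct_extend_snd (U := R_NormedModule) (V := R_NormedModule) f a b l H).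
apply (is_RInt_fct_extend_pair (U := R_NormedModule) (V := R_NormedModule) (fun x => c * f x)%C a b (fst c * fst l - snd c * snd l) (fst c * snd l + snd c * fst l)).
- apply (is_RInt_minus (V := R_NormedModule) (fun t => fst c * fst (f t)) (fun t => snd c * snd (f t))).
  + now apply (is_RInt_scal (V := R_NormedModule) (fun t => fst (f t))).
  + now apply (is_RInt_scal (V := R_NormedModule) (fun t => snd (f t))).
- apply (is_RInt_plus (V := R_NormedModule) (fun t => fst c * snd (f t)) (fun t => snd c * fst (f t))).
  + now apply (is_RInt_scal (V := R_NormedModule) (fun t => snd (f t))).
  + now apply (is_RInt_scal (V := R_NormedModule) (fun t => fst (f t))).
Qed.

Lemma ex_CInt_scal (c : C) (f : R -> C) (a b : R) :
  ex_CIntegral f a b -> ex_CIntegral (fun x => c * f x)%C a b.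
Proof. intros [l Hl]. exists (c * l)%C. now apply is_CInt_scal. Qed.

Lemma CInt_scal (c : C) (f : R -> C) (a b : R) : ex_CIntegral f a b ->
  CInt (fun x => c * f x)%C a b = (c * CInt f a b)%C.
Proof.
intros H. apply (is_RInt_unique (V := C_R_CompleteNormedModule)). apply is_CInt_scal.
now apply (RInt_correct (V := C_R_CompleteNormedModule)).
Qed.

Lemma ex_CInt_plus (f g : R -> C) (a b : R) :
  ex_CIntegral f a b -> ex_CIntegral g a b -> ex_CIntegral (fun x => f x + g x)%C a b.
Proof. intros Hf Hg. apply (ex_RInt_plus (V := C_R_NormedModule) f g a b Hf Hg). Qed.

Lemma CInt_minus (f g : R -> C) (a b : R) :
  ex_CIntegral f a b -> ex_CIntegral g a b ->
  CInt (fun x => f x - g x)%C a b = (CInt f a b - CInt g a b)%C.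
Proof. intros Hf Hg. apply (RInt_minus (V := C_R_CompleteNormedModule) f g a b Hf Hg). Qed.

Lemma ex_CInt_minus (f g : R -> C) (a b : R) :
  ex_CIntegral f a b -> ex_CIntegral g a b -> ex_CIntegral (fun x => f x - g x)%C a b.
Proof. intros Hf Hg. apply (ex_RInt_minus (V := C_R_NormedModule) f g a b Hf Hg). Qed.

Lemma CInt_Chasles (f : R -> C) (a b c : R) :
  ex_CIntegral f a b -> ex_CIntegral f b c ->
  (CInt f a b + CInt f b c)%C = CInt f a c.
Proof. apply (RInt_Chasles (V := C_R_CompleteNormedModule)). Qed.

Lemma CInt_le (f : R -> C) (a b M : R) : a <= b -> ex_CIntegral f a b ->
  (forall x, a <= x <= b -> Cmod (f x) <= M) -> Cmod (CInt f a b) <= (b - a) * M.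
Proof.
intros Hab Hf H. rewrite Cmod_norm.
apply (norm_RInt_le_const (V := C_R_NormedModule) f a b (CInt f a b) M Hab).
- intros x Hx. specialize (H x Hx). rewrite Cmod_norm in H. exact H.
- apply (RInt_correct (V := C_R_CompleteNormedModule)). exact Hf.
Qed.

Lemma CInt_le_RInt (f : R -> C) (g : R -> R) (a b : R) : a <= b ->
  ex_CIntegral f a b -> ex_RInt g a b ->
  (forall x, a <= x <= b -> Cmod (f x) <= g x) -> Cmod (CInt f a b) <= RInt g a b.
Proof.
intros Hab Hf Hg H. rewrite Cmod_norm.
apply (norm_RInt_le (V := C_R_NormedModule) f g a b (CInt f a b) (RInt g a b) Hab).
- intros x Hx. specialize (H x Hx). rewrite Cmod_norm in H. exact H.
- apply (RInt_correct (V := C_R_CompleteNormedModule)). exact Hf.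
- now apply (RInt_correct (V := R_CompleteNormedModule)).
Qed.

(** * Cauchy's theorem and the residue formula for rectangles *)

Definition pt (x y : R) : C := (x, y).

Definition hseg (f : C -> C) (a b y : R) : C := CInt (fun x => f (pt x y)) a b.
Definition vseg (f : C -> C) (x c d : R) : C := (Ci * CInt (fun y => f (pt x y)) c d)%C.

Definition rect (f : C -> C) (a b c d : R) : C :=
  (hseg f a b c + vseg f b c d - hseg f a b d - vseg f a c d)%C.

Lemma pt_h (x y : R) : pt x y = (Ci * RtoC y + RtoC x * 1)%C.
Proof. unfold pt, Ci, RtoC, Cmult, Cplus; simpl. f_equal; ring. Qed.

Lemma pt_v (x y : R) : pt x y = (RtoC x + RtoC y * Ci)%C.
Proof. unfold pt, Ci, RtoC, Cmult, Cplus; simpl. f_equal; ring. Qed.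

Lemma Ccontinuous_horizontal (f : C -> C) (x y : R) :
  Cdiff f (pt x y) -> Ccontinuous (fun t => f (pt t y)) x.
Proof.
intros H. rewrite pt_h in H.
apply (continuous_ext (fun t => f (Ci * RtoC y + RtoC t * 1)%C)).
- intros t. now rewrite pt_h.
- now apply Cdiff_Ccontinuous.
Qed.

Lemma Ccontinuous_vertical (f : C -> C) (x y : R) :
  Cdiff f (pt x y) -> Ccontinuous (fun t => f (pt x t)) y.
Proof.
intros H. rewrite pt_v in H.
apply (continuous_ext (fun t => f (RtoC x + RtoC t * Ci)%C)).
- intros t. now rewrite pt_v.
- now apply Cdiff_Ccontinuous.
Qed.

Lemma ex_hseg (f : C -> C) (a b y : R) : a <= b ->
  (forall x, a <= x <= b -> Cdiff f (pt x y)) -> ex_CIntegral (fun x => f (pt x y)) a b.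
Proof. intros Hab H. apply ex_CInt; [exact Hab|]. intros x Hx. now apply Ccontinuous_horizontal, H. Qed.

Lemma ex_vseg (f : C -> C) (x c d : R) : c <= d ->
  (forall y, c <= y <= d -> Cdiff f (pt x y)) -> ex_CIntegral (fun y => f (pt x y)) c d.
Proof. intros Hab H. apply ex_CInt; [exact Hab|]. intros y Hy. now apply Ccontinuous_vertical, H. Qed.

Definition diff_on_rect (f : C -> C) (a b c d : R) : Prop :=
  forall x y, a <= x <= b -> c <= y <= d -> Cdiff f (pt x y).

Lemma hseg_Chasles (f : C -> C) (a m b y : R) : a <= m <= b ->
  (forall x, a <= x <= b -> Cdiff f (pt x y)) ->
  (hseg f a m y + hseg f m b y)%C = hseg f a b y.
Proof.
intros H Hf. apply CInt_Chasles; apply ex_hseg; try lra; intros; apply Hf; lra.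
Qed.

Lemma vseg_Chasles (f : C -> C) (x c m d : R) : c <= m <= d ->
  (forall y, c <= y <= d -> Cdiff f (pt x y)) ->
  (vseg f x c m + vseg f x m d)%C = vseg f x c d.
Proof.
intros H Hf. unfold vseg.
rewrite <- (CInt_Chasles (fun y => f (pt x y)) c m d).
- ring.
- apply ex_vseg; try lra; intros; apply Hf; lra.
- apply ex_vseg; try lra; intros; apply Hf; lra.
Qed.

Lemma rect_split_h (f : C -> C) (a m b c d : R) : a <= m <= b -> c <= d ->
  (forall x, a <= x <= b -> Cdiff f (pt x c)) ->
  (forall x, a <= x <= b -> Cdiff f (pt x d)) ->
  rect f a b c d = (rect f a m c d + rect f m b c d)%C.
Proof.
intros Hm Hcd H1 H2. unfold rect.
rewrite <- (hseg_Chasles f a m b c), <- (hseg_Chasles f a m b d) by assumption.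
ring.
Qed.

Lemma rect_split_v (f : C -> C) (a b c m d : R) : c <= m <= d -> a <= b ->
  (forall y, c <= y <= d -> Cdiff f (pt a y)) ->
  (forall y, c <= y <= d -> Cdiff f (pt b y)) ->
  rect f a b c d = (rect f a b c m + rect f a b m d)%C.
Proof.
intros Hm Hcd H1 H2. unfold rect.
rewrite <- (vseg_Chasles f a c m d), <- (vseg_Chasles f b c m d) by assumption.
ring.
Qed.

Definition diff_on_bd (f : C -> C) (a b c d : R) : Prop :=
  forall x y, a <= x <= b -> c <= y <= d -> x = a \/ x = b \/ y = c \/ y = d -> Cdiff f (pt x y).

Lemma diff_on_rect_bd (f : C -> C) (a b c d : R) : diff_on_rect f a b c d -> diff_on_bd f a b c d.
Proof. intros H x y Hx Hy _. now apply H. Qed.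

Lemma hseg_minus (f g : C -> C) (a b y : R) : a <= b ->
  (forall x, a <= x <= b -> Cdiff f (pt x y)) -> (forall x, a <= x <= b -> Cdiff g (pt x y)) ->
  hseg (fun s => f s - g s)%C a b y = (hseg f a b y - hseg g a b y)%C.
Proof.
intros Hab Hf Hg.
apply (CInt_minus (fun x => f (pt x y)) (fun x => g (pt x y))); now apply ex_hseg.
Qed.

Lemma vseg_minus (f g : C -> C) (x c d : R) : c <= d ->
  (forall y, c <= y <= d -> Cdiff f (pt x y)) -> (forall y, c <= y <= d -> Cdiff g (pt x y)) ->
  vseg (fun s => f s - g s)%C x c d = (vseg f x c d - vseg g x c d)%C.
Proof.
intros Hab Hf Hg. unfold vseg.
rewrite (CInt_minus (fun y => f (pt x y)) (fun y => g (pt x y))); [ring|now apply ex_vseg|now apply ex_vseg].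
Qed.

Lemma hseg_scal (k : C) (f : C -> C) (a b y : R) : a <= b ->
  (forall x, a <= x <= b -> Cdiff f (pt x y)) ->
  hseg (fun s => k * f s)%C a b y = (k * hseg f a b y)%C.
Proof. intros Hab Hf. apply (CInt_scal k (fun x => f (pt x y))). now apply ex_hseg. Qed.

Lemma vseg_scal (k : C) (f : C -> C) (x c d : R) : c <= d ->
  (forall y, c <= y <= d -> Cdiff f (pt x y)) ->
  vseg (fun s => k * f s)%C x c d = (k * vseg f x c d)%C.
Proof.
intros Hab Hf. unfold vseg.
rewrite (CInt_scal k (fun y => f (pt x y))); [ring|now apply ex_vseg].
Qed.

Lemma hseg_diff (f : C -> C) (a b y1 y2 : R) : a <= b ->
  (forall x, a <= x <= b -> Cdiff f (pt x y1)) -> (forall x, a <= x <= b -> Cdiff f (pt x y2)) ->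
  (hseg f a b y1 - hseg f a b y2)%C = CInt (fun x => f (pt x y1) - f (pt x y2))%C a b.
Proof.
intros Hab Hf Hg. symmetry.
apply (CInt_minus (fun x => f (pt x y1)) (fun x => f (pt x y2))); now apply ex_hseg.
Qed.

Lemma vseg_diff (f : C -> C) (x1 x2 c d : R) : c <= d ->
  (forall y, c <= y <= d -> Cdiff f (pt x1 y)) -> (forall y, c <= y <= d -> Cdiff f (pt x2 y)) ->
  (vseg f x1 c d - vseg f x2 c d)%C = CInt (fun y => Ci * (f (pt x1 y) - f (pt x2 y)))%C c d.
Proof.
intros Hab Hf Hg. symmetry. unfold vseg.
rewrite (CInt_scal Ci (fun y => f (pt x1 y) - f (pt x2 y))%C).
- rewrite (CInt_minus (fun y => f (pt x1 y)) (fun y => f (pt x2 y))); [ring|now apply ex_vseg|now apply ex_vseg].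
- apply (ex_CInt_minus (fun y => f (pt x1 y)) (fun y => f (pt x2 y))); now apply ex_vseg.
Qed.

Lemma rect_minus (f g : C -> C) (a b c d : R) : a <= b -> c <= d ->
  diff_on_bd f a b c d -> diff_on_bd g a b c d ->
  rect (fun s => f s - g s)%C a b c d = (rect f a b c d - rect g a b c d)%C.
Proof.
intros Hab Hcd Hf Hg. unfold rect.
rewrite (hseg_minus f g a b c), (hseg_minus f g a b d), (vseg_minus f g a c d), (vseg_minus f g b c d);
  first [lra | intros; first [apply Hf | apply Hg]; first [lra | tauto] | ring].
Qed.

Lemma rect_scal (k : C) (f : C -> C) (a b c d : R) : a <= b -> c <= d ->
  diff_on_bd f a b c d ->
  rect (fun s => k * f s)%C a b c d = (k * rect f a b c d)%C.
Proof.
intros Hab Hcd Hf. unfold rect.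
rewrite (hseg_scal k f a b c), (hseg_scal k f a b d), (vseg_scal k f a c d), (vseg_scal k f b c d);
  first [lra | intros; apply Hf; first [lra | tauto] | ring].
Qed.

Lemma rect_le (f : C -> C) (a b c d M : R) : a <= b -> c <= d ->
  diff_on_bd f a b c d ->
  (forall x y, a <= x <= b -> c <= y <= d -> x = a \/ x = b \/ y = c \/ y = d ->
     Cmod (f (pt x y)) <= M) ->
  Cmod (rect f a b c d) <= 2 * (b - a + (d - c)) * M.
Proof.
intros Hab Hcd Hf HM.
assert (H1 : Cmod (hseg f a b c) <= (b - a) * M).
{ apply CInt_le; [exact Hab|apply ex_hseg; [exact Hab|]|]; intros; [apply Hf|apply HM]; try lra; tauto. }
assert (H2 : Cmod (hseg f a b d) <= (b - a) * M).
{ apply CInt_le; [exact Hab|apply ex_hseg; [exact Hab|]|]; intros; [apply Hf|apply HM]; try lra; tauto. }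
assert (H3 : Cmod (vseg f b c d) <= (d - c) * M).
{ unfold vseg. rewrite Cmod_mult, Cmod_Ci, Rmult_1_l.
  apply CInt_le; [exact Hcd|apply ex_vseg; [exact Hcd|]|]; intros; [apply Hf|apply HM]; try lra; tauto. }
assert (H4 : Cmod (vseg f a c d) <= (d - c) * M).
{ unfold vseg. rewrite Cmod_mult, Cmod_Ci, Rmult_1_l.
  apply CInt_le; [exact Hcd|apply ex_vseg; [exact Hcd|]|]; intros; [apply Hf|apply HM]; try lra; tauto. }
unfold rect, Cminus.
eapply Rle_trans; [apply Cmod_triangle|]. rewrite Cmod_opp.
apply Rle_trans with ((b - a) * M + (d - c) * M + (b - a) * M + (d - c) * M); [|lra].
apply Rplus_le_compat; [|exact H4].
eapply Rle_trans; [apply Cmod_triangle|]. rewrite Cmod_opp.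
apply Rplus_le_compat; [|exact H2].
eapply Rle_trans; [apply Cmod_triangle|]. lra.
Qed.

(** Opposite sides differ by a constant, and the two contributions cancel. *)
Lemma rect_affine (k l : C) (a b c d : R) : a <= b -> c <= d ->
  rect (fun s => k + l * s)%C a b c d = 0.
Proof.
intros Hab Hcd.
assert (Hd : forall s, Cdiff (fun s => k + l * s)%C s).
{ intros s. apply Cdiff_plus; [apply Cdiff_const|]. apply Cdiff_mult; [apply Cdiff_const|apply Cdiff_id]. }
assert (Hh : (hseg (fun s => k + l * s) a b c - hseg (fun s => k + l * s) a b d
   = RtoC (b - a) * (l * (Ci * RtoC (c - d))))%C).
{ rewrite (hseg_diff (fun s => k + l * s)%C); try lra; try (intros; apply Hd).
  rewrite <- CInt_const. apply CInt_ext; [lra|]. intros x _. rewrite !pt_h, RtoC_minus. ring. }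
assert (Hv : (vseg (fun s => k + l * s) b c d - vseg (fun s => k + l * s) a c d
   = RtoC (d - c) * (Ci * (l * RtoC (b - a))))%C).
{ rewrite (vseg_diff (fun s => k + l * s)%C); try lra; try (intros; apply Hd).
  rewrite <- CInt_const. apply CInt_ext; [lra|]. intros x _. rewrite !pt_v, RtoC_minus. ring. }
unfold rect.
match goal with |- (?h1 + ?v1 - ?h2 - ?v2)%C = _ =>
  replace (h1 + v1 - h2 - v2)%C with ((h1 - h2) + (v1 - v2))%C by ring end.
rewrite Hh, Hv, !RtoC_minus. ring.
Qed.

Lemma diff_on_rect_sub (f : C -> C) (a b c d a' b' c' d' : R) :
  diff_on_rect f a b c d -> a <= a' -> b' <= b -> c <= c' -> d' <= d ->
  diff_on_rect f a' b' c' d'.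
Proof. intros H Ha Hb Hc Hd x y Hx Hy. apply H; lra. Qed.

Lemma rect_quarters (f : C -> C) (a c w h : R) : 0 <= w -> 0 <= h ->
  diff_on_rect f a (a + 2 * w) c (c + 2 * h) ->
  rect f a (a + 2 * w) c (c + 2 * h) =
  (rect f a (a + w) c (c + h) + rect f (a + w) (a + w + w) c (c + h) +
   rect f a (a + w) (c + h) (c + h + h) + rect f (a + w) (a + w + w) (c + h) (c + h + h))%C.
Proof.
intros Hw Hh Hf.
replace (a + 2 * w) with (a + w + w) in * by ring.
replace (c + 2 * h) with (c + h + h) in * by ring.
rewrite (rect_split_v f a (a + w + w) c (c + h) (c + h + h)); try lra; try (intros; apply Hf; lra).
rewrite (rect_split_h f a (a + w) (a + w + w) c (c + h)); try lra; try (intros; apply Hf; lra).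
rewrite (rect_split_h f a (a + w) (a + w + w) (c + h) (c + h + h)); try lra; try (intros; apply Hf; lra).
ring.
Qed.

(** By the triangle inequality one of the four quarters carries at least a quarter of the contour
    integral, so the last one qualifies when the other three do not. *)
Definition quarter (f : C -> C) (w h : R) (p : R * R) : R * R :=
  let (a, c) := p in
  let big a' c' :=
    Rle_dec (Cmod (rect f a (a + 2 * w) c (c + 2 * h))) (4 * Cmod (rect f a' (a' + w) c' (c' + h))) in
  if big a c then (a, c) else
  if big (a + w) c then (a + w, c) else
  if big a (c + h) then (a, c + h) else (a + w, c + h).

Lemma quarter_spec (f : C -> C) (w h a c a' c' : R) : 0 <= w -> 0 <= h ->
  diff_on_rect f a (a + 2 * w) c (c + 2 * h) ->
  quarter f w h (a, c) = (a', c') ->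
  a <= a' <= a + w /\ c <= c' <= c + h /\
  Cmod (rect f a (a + 2 * w) c (c + 2 * h)) <= 4 * Cmod (rect f a' (a' + w) c' (c' + h)).
Proof.
intros Hw Hh Hf.
assert (E := rect_quarters f a c w h Hw Hh Hf). unfold quarter.
repeat destruct Rle_dec; intros [= <- <-]; (split; [lra|]; split; [lra|]); try assumption.
rewrite E in *.
match goal with |- Cmod (?p + ?q + ?r + ?s) <= _ =>
  assert (T1 := Cmod_triangle (p + q + r) s); assert (T2 := Cmod_triangle (p + q) r);
  assert (T3 := Cmod_triangle p q) end.
lra.
Qed.

Fixpoint corner (f : C -> C) (w h a c : R) (n : nat) : R * R :=
  match n with
  | O => (a, c)
  | S n => quarter f (w / 2 ^ S n) (h / 2 ^ S n) (corner f w h a c n)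
  end.

Lemma corner_spec (f : C -> C) (w h a c : R) : 0 <= w -> 0 <= h ->
  diff_on_rect f a (a + w) c (c + h) ->
  forall n, let p := corner f w h a c n in let p' := corner f w h a c (S n) in
  (a <= fst p /\ fst p + w / 2 ^ n <= a + w /\ c <= snd p /\ snd p + h / 2 ^ n <= c + h /\
   Cmod (rect f a (a + w) c (c + h)) <=
     4 ^ n * Cmod (rect f (fst p) (fst p + w / 2 ^ n) (snd p) (snd p + h / 2 ^ n))) /\
  (fst p <= fst p' <= fst p + w / 2 ^ S n /\ snd p <= snd p' <= snd p + h / 2 ^ S n).
Proof.
intros Hw Hh Hf.
assert (E2 : forall x n, x / 2 ^ n = 2 * (x / 2 ^ S n)).
{ intros x n. simpl. field. apply pow_nonzero. lra. }
assert (P2 : forall x n, 0 <= x -> 0 <= x / 2 ^ n).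
{ intros x n Hx. apply Rdiv_le_0_compat; [exact Hx|]. apply pow_lt. lra. }
assert (Step : forall n, let p := corner f w h a c n in let p' := corner f w h a c (S n) in
  (a <= fst p /\ fst p + w / 2 ^ n <= a + w /\ c <= snd p /\ snd p + h / 2 ^ n <= c + h) ->
  (fst p <= fst p' <= fst p + w / 2 ^ S n /\ snd p <= snd p' <= snd p + h / 2 ^ S n /\
   Cmod (rect f (fst p) (fst p + w / 2 ^ n) (snd p) (snd p + h / 2 ^ n)) <=
   4 * Cmod (rect f (fst p') (fst p' + w / 2 ^ S n) (snd p') (snd p' + h / 2 ^ S n)))).
{ intros n p p' Hp. rewrite (E2 w n), (E2 h n) in *.
  apply quarter_spec; try (apply P2; assumption).
  - apply (diff_on_rect_sub f a (a + w) c (c + h)); try assumption; tauto.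
  - rewrite <- surjective_pairing. unfold p'. simpl corner. fold p.
    now rewrite <- surjective_pairing. }
intros n. induction n as [|n IH]; intros p p'.
- assert (H0 : a <= fst p /\ fst p + w / 2 ^ 0 <= a + w /\ c <= snd p /\ snd p + h / 2 ^ 0 <= c + h) by (simpl; lra).
  destruct (Step 0%nat H0) as [H1 [H2 _]]. split; [|tauto].
  destruct H0 as [? [? [? ?]]]. repeat (split; [assumption|]).
  simpl. replace (w / 1) with w by field. replace (h / 1) with h by field. lra.
- destruct IH as [[I1 [I2 [I3 [I4 I5]]]] _].
  destruct (Step n (conj I1 (conj I2 (conj I3 I4)))) as [S1 [S2 S3]].
  cbv zeta in *. subst p p'. set (p := corner f w h a c (S n)) in *.
  rewrite (E2 w n) in I2. rewrite (E2 h n) in I4.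
  assert (H0 : a <= fst p /\ fst p + w / 2 ^ S n <= a + w /\ c <= snd p /\ snd p + h / 2 ^ S n <= c + h).
  { repeat split; lra. }
  destruct (Step (S n) H0) as [H1 [H2 _]]. split; [|tauto].
  destruct H0 as [? [? [? ?]]]. repeat (split; [assumption|]).
  eapply Rle_trans; [exact I5|].
  replace (4 ^ S n) with (4 ^ n * 4) by (simpl; ring). rewrite Rmult_assoc.
  apply Rmult_le_compat_l; [apply pow_le; lra|]. exact S3.
Qed.

(** The common point is the least upper bound of the left ends. *)
Lemma nested_point (u : nat -> R) (w : R) : 0 <= w ->
  (forall n, u n <= u (S n) <= u n + w / 2 ^ S n) ->
  exists p, forall n, u n <= p <= u n + w / 2 ^ n.
Proof.
intros Hw H.
assert (E2 : forall n, w / 2 ^ n = 2 * (w / 2 ^ S n)).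
{ intros n. simpl. field. apply pow_nonzero. lra. }
assert (P2 : forall n, 0 <= w / 2 ^ n).
{ intros n. apply Rdiv_le_0_compat; [exact Hw|]. apply pow_lt. lra. }
assert (Hi : forall n k, u n <= u (n + k)%nat /\ u (n + k)%nat + w / 2 ^ (n + k) <= u n + w / 2 ^ n).
{ intros n k. induction k as [|k IH].
  - rewrite Nat.add_0_r. lra.
  - rewrite Nat.add_succ_r. specialize (H (n + k)%nat). specialize (E2 (n + k)%nat). lra. }
assert (Hub : forall m n, u m <= u n + w / 2 ^ n).
{ intros m n. destruct (Nat.le_ge_cases m n) as [L|L].
  - destruct (Hi m (n - m)%nat) as [H1 _]. replace (m + (n - m))%nat with n in H1 by lia.
    specialize (P2 n). lra.
  - destruct (Hi n (m - n)%nat) as [_ H1]. replace (n + (m - n))%nat with m in H1 by lia.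
    specialize (P2 m). lra. }
destruct (completeness (fun x => exists n, x = u n)) as [p [Hp1 Hp2]].
- exists (u 0%nat + w / 2 ^ 0). intros x [n ->]. apply Hub.
- exists (u 0%nat), 0%nat. reflexivity.
- exists p. intros n. split.
  + apply Hp1. now exists n.
  + apply Hp2. intros x [m ->]. apply Hub.
Qed.

Lemma pow2_small (K e : R) : 0 < e -> exists n : nat, K / 2 ^ n < e.
Proof.
intros He. destruct (Pow_x_infinity 2 ltac:(rewrite Rabs_pos_eq; lra) (K / e + 1)) as [n Hn].
exists n. specialize (Hn n (le_n _)).
assert (Hp : 0 < 2 ^ n) by (apply pow_lt; lra).
rewrite Rabs_pos_eq in Hn by lra.
apply (Rmult_lt_reg_r (2 ^ n)); [exact Hp|].
replace (K / 2 ^ n * 2 ^ n) with K by (field; lra).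
apply (Rmult_ge_compat_r e) in Hn; [|lra].
replace ((K / e + 1) * e) with (K + e) in Hn by (field; lra). lra.
Qed.

(** Goursat's argument: keep the quarter with the largest contribution; near the point to
    which the quarters shrink the function is affine up to an error that is small compared
    with the size of the quarter. *)
Lemma rect_Cauchy (f : C -> C) (a b c d : R) : a <= b -> c <= d ->
  diff_on_rect f a b c d -> rect f a b c d = 0.
Proof.
intros Hab Hcd Hf. apply Cmod_eq_0.
set (w := b - a). set (h := d - c).
replace b with (a + w) in * by (unfold w; ring).
replace d with (c + h) in * by (unfold h; ring).
assert (Hw : 0 <= w) by lra. assert (Hh : 0 <= h) by lra. clearbody w h.
assert (HC := corner_spec f w h a c Hw Hh Hf).
destruct (nested_point (fun n => fst (corner f w h a c n)) w Hw) as [px Hpx].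
{ intros n. apply (HC n). }
destruct (nested_point (fun n => snd (corner f w h a c n)) h Hh) as [py Hpy].
{ intros n. apply (HC n). }
assert (Hp : Cdiff f (pt px py)).
{ specialize (Hpx 0%nat). specialize (Hpy 0%nat). simpl in Hpx, Hpy.
  apply Hf; lra. }
apply Cdiff_iff in Hp. destruct Hp as [l Hl].
apply Rle_antisym; [|apply Cmod_ge_0]. apply Rnot_lt_le. intros HM.
set (M := Cmod (rect f a (a + w) c (c + h))) in *.
set (K := 2 * (w + h) * (w + h) + 1).
assert (HK : 0 < K) by (unfold K; nra).
destruct (Hl (M / (2 * K))) as [dl [Hdl H]].
{ apply Rdiv_lt_0_compat; lra. }
destruct (pow2_small (w + h) dl Hdl) as [n Hn].
destruct (HC n) as [[I1 [I2 [I3 [I4 I5]]]] _].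
specialize (Hpx n). specialize (Hpy n). simpl in Hpx, Hpy.
set (an := fst (corner f w h a c n)) in *. set (cn := snd (corner f w h a c n)) in *.
assert (Ht : 0 < 2 ^ n) by (apply pow_lt; lra).
set (wn := w / 2 ^ n) in *. set (hn := h / 2 ^ n) in *.
assert (Hwn : 0 <= wn) by (apply Rdiv_le_0_compat; assumption).
assert (Hhn : 0 <= hn) by (apply Rdiv_le_0_compat; assumption).
assert (Hs : (w + h) / 2 ^ n = wn + hn) by (unfold wn, hn; field; lra).
rewrite Hs in Hn.
set (p := pt px py) in *.
set (aff := fun s : C => ((f p - l * p) + l * s)%C).
assert (Haff : forall s, Cdiff aff s).
{ intros s. apply Cdiff_plus; [apply Cdiff_const|]. apply Cdiff_mult; [apply Cdiff_const|apply Cdiff_id]. }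
assert (Hfn : diff_on_rect f an (an + wn) cn (cn + hn)).
{ now apply (diff_on_rect_sub f a (a + w) c (c + h)). }
assert (B : Cmod (rect (fun s => f s - aff s)%C an (an + wn) cn (cn + hn)) <=
   2 * (an + wn - an + (cn + hn - cn)) * (M / (2 * K) * (wn + hn))).
{ apply rect_le; try lra.
  - intros x y Hx Hy _. apply Cdiff_minus; [now apply Hfn | apply Haff].
  - intros x y Hx Hy _.
    replace (f (pt x y) - aff (pt x y))%C with (f (pt x y) - f p - l * (pt x y - p))%C by (unfold aff; ring).
    assert (Hd : Cmod (pt x y - p) <= wn + hn).
    { eapply Rle_trans; [apply Cmod_le_Re_Im|]. unfold p, pt; simpl.
      apply Rplus_le_compat; apply Rabs_le; lra. }
    eapply Rle_trans; [apply H; lra|].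
    apply Rmult_le_compat_l; [|exact Hd]. apply Rdiv_le_0_compat; lra. }
rewrite rect_minus in B; [|lra|lra|now apply diff_on_rect_bd|intros x y _ _ _; apply Haff].
unfold aff in B. rewrite rect_affine in B by lra.
unfold Cminus in B. rewrite Copp_0, Cplus_0_r in B.
apply (Rmult_le_compat_l (4 ^ n)) in B; [|apply pow_le; lra].
assert (E4 : 4 ^ n = 2 ^ n * 2 ^ n) by (rewrite <- Rpow_mult_distr; f_equal; ring).
assert (E5 : 4 ^ n * (2 * (an + wn - an + (cn + hn - cn)) * (M / (2 * K) * (wn + hn)))
   = 2 * (w + h) * (w + h) * (M / (2 * K))).
{ rewrite E4. unfold wn, hn. field. split; lra. }
rewrite E5 in B.
assert (B2 : M <= K * (M / (2 * K))).
{ eapply Rle_trans; [exact I5|]. eapply Rle_trans; [exact B|].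
  apply Rmult_le_compat_r; [apply Rdiv_le_0_compat; lra|]. unfold K. lra. }
replace (K * (M / (2 * K))) with (M / 2) in B2 by (field; lra). lra.
Qed.

(** The eight rectangles around the square contribute nothing, by Cauchy's theorem. *)
Lemma rect_shrink (f : C -> C) (a b c d px py r : R) :
  0 < r -> a <= px - r -> px + r <= b -> c <= py - r -> py + r <= d ->
  (forall x y, a <= x <= b -> c <= y <= d -> pt x y <> pt px py -> Cdiff f (pt x y)) ->
  rect f a b c d = rect f (px - r) (px + r) (py - r) (py + r).
Proof.
intros Hr Ha Hb Hc Hd Hf.
assert (Hf' : forall x y, a <= x <= b -> c <= y <= d -> x <> px \/ y <> py -> Cdiff f (pt x y)).
{ intros x y Hx Hy Hn. apply Hf; try assumption. intros [= E1 E2]. tauto. }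
rewrite (rect_split_v f a b c (py - r) d); try lra; try (intros; apply Hf'; lra).
rewrite (rect_split_v f a b (py - r) (py + r) d); try lra; try (intros; apply Hf'; lra).
rewrite (rect_split_h f a (px - r) b (py - r) (py + r)); try lra; try (intros; apply Hf'; lra).
rewrite (rect_split_h f (px - r) (px + r) b (py - r) (py + r)); try lra; try (intros; apply Hf'; lra).
rewrite (rect_Cauchy f a b c (py - r)); try lra; [|intros x y Hx Hy; apply Hf'; lra].
rewrite (rect_Cauchy f a b (py + r) d); try lra; [|intros x y Hx Hy; apply Hf'; lra].
rewrite (rect_Cauchy f a (px - r)); try lra; [|intros x y Hx Hy; apply Hf'; lra].
rewrite (rect_Cauchy f (px + r) b); try lra; [|intros x y Hx Hy; apply Hf'; lra].
ring.
Qed.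

Lemma RInt_inv_square (r : R) : 0 < r ->
  is_RInt (fun x => r / (x * x + r * r)) (- r) r (PI / 2).
Proof.
intros Hr.
assert (E : PI / 2 = minus (atan (r / r)) (atan (- r / r))).
{ unfold minus, plus, opp; simpl. replace (r / r) with 1 by (field; lra).
  replace (- r / r) with (- (1)) by (field; lra). rewrite atan_opp, atan_1. lra. }
rewrite E. apply (is_RInt_derive (fun x => atan (x / r))).
- intros x _. auto_derive; [trivial|]. field. split; nra.
- intros x _. apply (ex_derive_continuous (K := R_AbsRing) (V := R_NormedModule)). auto_derive. nra.
Qed.

Lemma CInt_imag (g : R -> R) (a b I : R) : is_RInt g a b I ->
  CInt (fun x => Ci * RtoC (g x))%C a b = (Ci * RtoC I)%C.
Proof.
intros H. apply (is_RInt_unique (V := C_R_CompleteNormedModule)).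
apply is_CInt_scal.
apply (is_RInt_fct_extend_pair (U := R_NormedModule) (V := R_NormedModule) (fun x => RtoC (g x))).
- exact H.
- assert (E := is_RInt_const (V := R_NormedModule) a b 0). unfold scal in E; simpl in E. unfold mult in E; simpl in E.
  rewrite Rmult_0_r in E. exact E.
Qed.

Lemma pt_minus (x y x' y' : R) : (pt x y - pt x' y')%C = pt (x - x') (y - y').
Proof. reflexivity. Qed.

Lemma pt_neq (x y x' y' : R) : x <> x' \/ y <> y' -> pt x y <> pt x' y'.
Proof. intros H [= E1 E2]. tauto. Qed.

Lemma Cminus_neq_0 (z w : C) : z <> w -> (z - w)%C <> 0.
Proof.
intros H E. apply H. replace z with ((z - w) + w)%C by ring. rewrite E. ring.
Qed.

Lemma Cdiff_simple_pole (k p s : C) : s <> p -> Cdiff (fun s => k / (s - p))%C s.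
Proof.
intros H. apply Cdiff_div; [apply Cdiff_const| |now apply Cminus_neq_0].
apply Cdiff_minus; [apply Cdiff_id|apply Cdiff_const].
Qed.

Lemma is_RInt_shift (g : R -> R) (a b v I : R) : is_RInt g a b I ->
  is_RInt (fun x => g (x - v)) (a + v) (b + v) I.
Proof.
intros H.
apply (is_RInt_ext (fun x => scal 1 (g (1 * x + (- v))))).
- intros x _. unfold scal; simpl; unfold mult; simpl. rewrite !Rmult_1_l. reflexivity.
- apply (is_RInt_comp_lin (V := R_NormedModule)).
  replace (1 * (a + v) + - v) with a by ring.
  replace (1 * (b + v) + - v) with b by ring. exact H.
Qed.

Lemma inv_pt_diff_h (h r : R) : 0 < r ->
  (1 / pt h (- r) - 1 / pt h r)%C = (Ci * RtoC (2 * (r / (h * h + r * r))))%C.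
Proof.
intros Hr. assert (0 < h * h + r * r) by nra.
unfold pt, Cdiv, Cinv, Cmult, Cminus, Cplus, Copp, RtoC, Ci; simpl.
replace (h * (h * 1) + - r * (- r * 1)) with (h * h + r * r) by ring.
replace (h * (h * 1) + r * (r * 1)) with (h * h + r * r) by ring.
f_equal; field; lra.
Qed.

Lemma inv_pt_diff_v (h r : R) : 0 < r ->
  (Ci * (1 / pt r h - 1 / pt (- r) h))%C = (Ci * RtoC (2 * (r / (h * h + r * r))))%C.
Proof.
intros Hr. assert (0 < h * h + r * r) by nra.
unfold pt, Cdiv, Cinv, Cmult, Cminus, Cplus, Copp, RtoC, Ci; simpl.
replace (- r * (- r * 1) + h * (h * 1)) with (h * h + r * r) by ring.
replace (r * (r * 1) + h * (h * 1)) with (h * h + r * r) by ring.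
f_equal; field; lra.
Qed.

(** By symmetry opposite sides combine to integrals of [r / (x^2 + r^2)], each contributing
    [PI / 2] twice. *)
Lemma rect_inv_square (px py r : R) : 0 < r ->
  rect (fun s => 1 / (s - pt px py))%C (px - r) (px + r) (py - r) (py + r) = (Ci * RtoC (2 * PI))%C.
Proof.
intros Hr.
set (f := fun s => (1 / (s - pt px py))%C).
assert (Hf : forall x y, x <> px \/ y <> py -> Cdiff f (pt x y)).
{ intros x y H. apply Cdiff_simple_pole. now apply pt_neq. }
assert (Hh : (hseg f (px - r) (px + r) (py - r) - hseg f (px - r) (px + r) (py + r))%C = (Ci * RtoC PI)%C).
{ rewrite (hseg_diff f); try lra; try (intros; apply Hf; lra).
  rewrite <- (CInt_imag (fun x => 2 * (r / ((x - px) * (x - px) + r * r))) (px - r) (px + r)).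
  - apply CInt_ext; [lra|]. intros x _. unfold f. rewrite !pt_minus.
    replace (py - r - py) with (- r) by ring. replace (py + r - py) with r by ring.
    now apply inv_pt_diff_h.
  - replace PI with (2 * (PI / 2)) by field.
    apply (is_RInt_scal (V := R_NormedModule) (fun x => r / ((x - px) * (x - px) + r * r))).
    replace (px - r) with (- r + px) by ring. rewrite (Rplus_comm px r).
    apply (is_RInt_shift (fun x => r / (x * x + r * r))). now apply RInt_inv_square. }
assert (Hv : (vseg f (px + r) (py - r) (py + r) - vseg f (px - r) (py - r) (py + r))%C = (Ci * RtoC PI)%C).
{ rewrite (vseg_diff f); try lra; try (intros; apply Hf; lra).
  rewrite <- (CInt_imag (fun x => 2 * (r / ((x - py) * (x - py) + r * r))) (py - r) (py + r)).
  - apply CInt_ext; [lra|]. intros x _. unfold f. rewrite !pt_minus.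
    replace (px - r - px) with (- r) by ring. replace (px + r - px) with r by ring.
    now apply inv_pt_diff_v.
  - replace PI with (2 * (PI / 2)) by field.
    apply (is_RInt_scal (V := R_NormedModule) (fun x => r / ((x - py) * (x - py) + r * r))).
    replace (py - r) with (- r + py) by ring. rewrite (Rplus_comm py r).
    apply (is_RInt_shift (fun x => r / (x * x + r * r))). now apply RInt_inv_square. }
unfold rect.
match goal with |- (?h1 + ?v1 - ?h2 - ?v2)%C = _ =>
  replace (h1 + v1 - h2 - v2)%C with ((h1 - h2) + (v1 - v2))%C by ring end.
rewrite Hh, Hv, RtoC_mult. ring.
Qed.

(** Shrinking the contour to a small square reduces the claim to the integral of [k / (s - p)],
    because there the remainder is small compared with the inverse of the side. *)
Lemma rect_residue (f : C -> C) (k : C) (a b c d px py : R) :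
  a < px < b -> c < py < d ->
  (forall x y, a <= x <= b -> c <= y <= d -> pt x y <> pt px py -> Cdiff f (pt x y)) ->
  (forall eps, 0 < eps -> exists delta, 0 < delta /\
     forall s, s <> pt px py -> Cmod (s - pt px py) < delta ->
       Cmod ((s - pt px py) * f s - k) <= eps) ->
  rect f a b c d = (Ci * RtoC (2 * PI) * k)%C.
Proof.
intros Hx Hy Hf Hk.
set (p := pt px py) in *.
replace (rect f a b c d) with (rect f a b c d - Ci * RtoC (2 * PI) * k + Ci * RtoC (2 * PI) * k)%C by ring.
match goal with |- (?u + ?v)%C = _ => assert (E : u = 0); [|rewrite E; ring] end.
apply Cmod_eq_0. apply Rle_antisym; [|apply Cmod_ge_0]. apply le_epsilon. intros eps Heps.
destruct (Hk (eps / 8)) as [dl [Hdl H]]; [lra|].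
set (r := Rmin (dl / 4) (Rmin (Rmin (px - a) (b - px)) (Rmin (py - c) (d - py)))).
assert (Hr : 0 < r) by (repeat apply Rmin_glb_lt; lra).
assert (R0 : r <= dl / 4) by apply Rmin_l.
assert (R1 : r <= Rmin (Rmin (px - a) (b - px)) (Rmin (py - c) (d - py))) by apply Rmin_r.
assert (R2 := Rle_trans _ _ _ R1 (Rmin_l _ _)). assert (R3 := Rle_trans _ _ _ R1 (Rmin_r _ _)).
assert (R4 := Rle_trans _ _ _ R2 (Rmin_l _ _)). assert (R5 := Rle_trans _ _ _ R2 (Rmin_r _ _)).
assert (R6 := Rle_trans _ _ _ R3 (Rmin_l _ _)). assert (R7 := Rle_trans _ _ _ R3 (Rmin_r _ _)).
clearbody r. clear R1 R2 R3.
rewrite (rect_shrink f a b c d px py r); try lra; [|exact Hf].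
rewrite <- (rect_inv_square px py r Hr). fold p.
rewrite Cmult_comm.
assert (Hbd : forall x y, px - r <= x <= px + r -> py - r <= y <= py + r ->
   x = px - r \/ x = px + r \/ y = py - r \/ y = py + r -> pt x y <> p /\ r <= Cmod (pt x y - p)).
{ intros x y Hxx Hyy Hb.
  assert (B : r <= Cmod (pt x y - p)).
  { unfold p. rewrite pt_minus. destruct Hb as [->|[->|[->| ->]]].
    - eapply Rle_trans; [|apply Rabs_Re_le]. simpl. rewrite Rabs_left; lra.
    - eapply Rle_trans; [|apply Rabs_Re_le]. simpl. rewrite Rabs_right; lra.
    - eapply Rle_trans; [|apply Rabs_Im_le]. simpl. rewrite Rabs_left; lra.
    - eapply Rle_trans; [|apply Rabs_Im_le]. simpl. rewrite Rabs_right; lra. }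
  split; [|exact B]. intros E. rewrite E in B. replace (p - p)%C with (RtoC 0) in B by ring.
  rewrite Cmod_0 in B. lra. }
assert (D1 : diff_on_bd f (px - r) (px + r) (py - r) (py + r)).
{ intros x y Hxx Hyy Hb. apply Hf; try lra. now apply Hbd. }
assert (D2 : diff_on_bd (fun s => 1 / (s - p))%C (px - r) (px + r) (py - r) (py + r)).
{ intros x y Hxx Hyy Hb. apply Cdiff_simple_pole. now apply Hbd. }
rewrite <- rect_scal; try lra; [|exact D2].
rewrite <- rect_minus; try lra; [|exact D1|].
2:{ intros x y Hxx Hyy Hb. apply Cdiff_mult; [apply Cdiff_const|now apply D2]. }
rewrite Rplus_0_l.
replace eps with (2 * (px + r - (px - r) + (py + r - (py - r))) * (eps / 8 / r)) by (field; lra).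
apply rect_le; try lra.
- intros x y Hxx Hyy Hb. apply Cdiff_minus; [now apply D1|]. apply Cdiff_mult; [apply Cdiff_const|now apply D2].
- intros x y Hxx Hyy Hb. destruct (Hbd x y Hxx Hyy Hb) as [B1 B2].
  set (s := pt x y) in *.
  assert (B3 : (s - p)%C <> 0) by now apply Cminus_neq_0.
  replace (f s - k * (1 / (s - p)))%C with (((s - p) * f s - k) / (s - p))%C by now field.
  rewrite Cmod_div by exact B3.
  assert (B4 : Cmod (s - p) < dl).
  { eapply Rle_lt_trans; [apply Cmod_le_Re_Im|]. unfold s, p. rewrite pt_minus. simpl.
    apply Rle_lt_trans with (r + r); [|lra]. apply Rplus_le_compat; apply Rabs_le; lra. }
  specialize (H s B1 B4). unfold Rdiv at 1 2.
  apply Rmult_le_compat; try assumption.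
  + apply Cmod_ge_0.
  + left. apply Rinv_0_lt_compat. lra.
  + apply Rinv_le_contravar; lra.
Qed.

(** The limit that [rect_residue] asks for follows from the first order expansion of [D] and the
    continuity of [n] at [p]. *)
Lemma quotient_simple_pole (n D : C -> C) (p D' : C) :
  Cdiff n p -> @is_derive C_AbsRing (AbsRing_NormedModule C_AbsRing) D p D' -> D p = 0 -> D' <> 0 ->
  forall eps, 0 < eps -> exists delta, 0 < delta /\
     forall s, s <> p -> Cmod (s - p) < delta ->
       Cmod ((s - p) * (n s / D s) - n p / D') <= eps.
Proof.
intros Hn HD HD0 HD' eps Heps.
assert (Hm : 0 < Cmod D') by now apply Cmod_gt_0.
set (m := Cmod D') in *. set (N := Cmod (n p)).
assert (HN : 0 <= N) by apply Cmod_ge_0.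
set (e1 := Rmin (m / 2) (eps * m * m / (4 * (N + 1)))).
assert (He1 : 0 < e1).
{ apply Rmin_glb_lt; [lra|]. apply Rdiv_lt_0_compat; [repeat apply Rmult_lt_0_compat; lra|lra]. }
assert (He2 : e1 <= m / 2) by apply Rmin_l.
assert (He3 : e1 <= eps * m * m / (4 * (N + 1))) by apply Rmin_r.
clearbody e1.
destruct (proj1 (is_derive_C_iff D p D') HD e1 He1) as [d1 [Hd1 H1]].
destruct (Cdiff_continuous n p Hn (eps * m / 4)) as [d2 [Hd2 H2]]; [apply Rdiv_lt_0_compat; [nra|lra]|].
exists (Rmin d1 d2). split; [now apply Rmin_glb_lt|].
intros s Hs Hsd.
specialize (H1 s (Rlt_le_trans _ _ _ Hsd (Rmin_l _ _))).
specialize (H2 s (Rlt_le_trans _ _ _ Hsd (Rmin_r _ _))).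
rewrite HD0 in H1. replace (D s - 0 - D' * (s - p))%C with (D s - D' * (s - p))%C in H1 by ring.
set (h := (s - p)%C) in *.
assert (Hh : 0 < Cmod h) by (apply Cmod_gt_0; now apply Cminus_neq_0).
assert (HDs : m / 2 * Cmod h <= Cmod (D s)).
{ assert (T := Cmod_minus_rev (D' * h) (D s)). rewrite Cmod_minus_sym, Cmod_mult in T. fold m in T.
  assert (e1 * Cmod h <= m / 2 * Cmod h) by (apply Rmult_le_compat_r; lra). lra. }
assert (HDs0 : D s <> 0).
{ apply Cmod_gt_0. assert (0 < m / 2 * Cmod h) by (apply Rmult_lt_0_compat; lra). lra. }
replace (h * (n s / D s) - n p / D')%C
  with (((n s - n p) * D' * h - n p * (D s - D' * h)) / (D s * D'))%C by (field; split; assumption).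
rewrite Cmod_div by (now apply Cmult_neq_0). rewrite Cmod_mult. fold m.
assert (Hpos : 0 < Cmod (D s) * m) by (apply Rmult_lt_0_compat; [now apply Cmod_gt_0|lra]).
apply (Rmult_le_reg_r (Cmod (D s) * m)); [exact Hpos|].
unfold Rdiv. rewrite Rmult_assoc, Rinv_l, Rmult_1_r by lra.
unfold Cminus at 1. eapply Rle_trans; [apply Cmod_triangle|]. rewrite Cmod_opp, !Cmod_mult. fold m N.
assert (A1 : Cmod (n s - n p) * m * Cmod h <= eps * m / 4 * m * Cmod h).
{ apply Rmult_le_compat_r; [lra|]. apply Rmult_le_compat_r; lra. }
assert (A2 : N * Cmod (D s - D' * h) <= eps * m * m / 4 * Cmod h).
{ apply Rle_trans with (N * (eps * m * m / (4 * (N + 1)) * Cmod h)).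
  - apply Rmult_le_compat_l; [exact HN|]. eapply Rle_trans; [exact H1|]. apply Rmult_le_compat_r; lra.
  - apply Rle_trans with ((N + 1) * (eps * m * m / (4 * (N + 1)) * Cmod h)).
    + apply Rmult_le_compat_r; [|lra]. apply Rmult_le_pos; [lra|lra].
    + right. field. lra. }
assert (A3 : eps * m * (m / 2 * Cmod h) <= eps * m * Cmod (D s)).
{ apply Rmult_le_compat_l; [nra|exact HDs]. }
nra.
Qed.

(** * Polynomial functions *)

Definition poly_sum (c : nat -> C) (n : nat) (z : C) : C :=
  sum_n (fun k => Cmult (c k) (Cpow z k)) n.

Definition is_poly (n : nat) (F : C -> C) : Prop :=
  exists c : nat -> C, forall z, F z = poly_sum c n z.

Lemma poly_sum_S (c : nat -> C) (n : nat) (z : C) :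
  poly_sum c (S n) z = (poly_sum c n z + c (S n) * Cpow z (S n))%C.
Proof. unfold poly_sum. now rewrite sum_Sn. Qed.

Lemma poly_sum_0 (c : nat -> C) (z : C) : poly_sum c 0 z = c 0%nat.
Proof. unfold poly_sum. rewrite sum_O. simpl. ring. Qed.

Lemma is_poly_ext (n : nat) (F G : C -> C) : (forall z, F z = G z) -> is_poly n F -> is_poly n G.
Proof. intros E [c Hc]. exists c. intros z. now rewrite <- E. Qed.

Lemma is_poly_S (n : nat) (F : C -> C) : is_poly n F -> is_poly (S n) F.
Proof.
intros [c Hc]. exists (fun k => if Nat.leb k n then c k else RtoC 0).
intros z. rewrite Hc, poly_sum_S.
replace (Nat.leb (S n) n) with false by (symmetry; apply Nat.leb_gt; lia).
rewrite Cmult_0_l, Cplus_0_r. unfold poly_sum. apply sum_n_ext_loc.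
intros k Hk. now rewrite (proj2 (Nat.leb_le k n) Hk).
Qed.

Lemma is_poly_le (n m : nat) (F : C -> C) : (n <= m)%nat -> is_poly n F -> is_poly m F.
Proof. intros H HF. induction H; [exact HF|]. now apply is_poly_S. Qed.

Lemma is_poly_const (n : nat) (k : C) : is_poly n (fun _ => k).
Proof.
apply (is_poly_le 0); [lia|]. exists (fun _ => k). intros z. now rewrite poly_sum_0.
Qed.

Lemma is_poly_plus (n : nat) (F G : C -> C) :
  is_poly n F -> is_poly n G -> is_poly n (fun z => F z + G z)%C.
Proof.
intros [c Hc] [d Hd]. exists (fun k => c k + d k)%C. intros z. rewrite Hc, Hd.
clear Hc Hd. induction n as [|n IH].
- now rewrite !poly_sum_0.
- rewrite !poly_sum_S, <- IH. ring.
Qed.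

Lemma is_poly_scal (n : nat) (k : C) (F : C -> C) :
  is_poly n F -> is_poly n (fun z => k * F z)%C.
Proof.
intros [c Hc]. exists (fun j => k * c j)%C. intros z. rewrite Hc. clear Hc.
induction n as [|n IH].
- now rewrite !poly_sum_0.
- rewrite !poly_sum_S, <- IH. ring.
Qed.

Lemma is_poly_X_mult (n : nat) (F : C -> C) : is_poly n F -> is_poly (S n) (fun z => z * F z)%C.
Proof.
intros [c Hc]. exists (fun k => match k with O => RtoC 0 | S k => c k end).
intros z. rewrite Hc. clear Hc. induction n as [|n IH].
- rewrite poly_sum_S, !poly_sum_0. simpl. ring.
- rewrite poly_sum_S, (poly_sum_S _ (S n)), <- IH. rewrite (Cpow_S z (S n)). ring.
Qed.

Lemma is_poly_pow (k n : nat) : (k <= n)%nat -> is_poly n (fun z => Cpow z k).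
Proof.
intros H. apply (is_poly_le k); [exact H|]. clear H n. induction k as [|k IH].
- exact (is_poly_const 0 (RtoC 1)).
- exact (is_poly_X_mult k _ IH).
Qed.

Lemma is_poly_sum_n_m (n a b : nat) (F : nat -> C -> C) :
  (forall k, (a <= k <= b)%nat -> is_poly n (F k)) -> is_poly n (fun z => sum_n_m (fun k => F k z) a b).
Proof.
intros H. induction b as [|b IH].
- destruct a as [|a].
  + apply (is_poly_ext _ (F 0%nat)); [intros z; now rewrite sum_n_n|]. apply H. lia.
  + apply (is_poly_ext _ (fun _ => RtoC 0)); [intros z; now rewrite sum_n_m_zero by lia|]. apply is_poly_const.
- destruct (Nat.le_gt_cases a (S b)) as [L|L].
  + apply (is_poly_ext _ (fun z => sum_n_m (fun k => F k z) a b + F (S b) z)%C).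
    * intros z. now rewrite sum_n_Sm.
    * apply is_poly_plus; [apply IH; intros; apply H; lia|]. apply H. lia.
  + apply (is_poly_ext _ (fun _ => RtoC 0)); [intros z; now rewrite sum_n_m_zero by lia|]. apply is_poly_const.
Qed.

Lemma is_poly_ind_form (n : nat) (F : C -> C) : is_poly (S n) F ->
  exists G k, is_poly n G /\ forall z, F z = (G z + k * Cpow z (S n))%C.
Proof.
intros [c Hc]. exists (poly_sum c n), (c (S n)). split; [now exists c|].
intros z. now rewrite Hc, poly_sum_S.
Qed.

Lemma is_poly_pow_mult (k n : nat) (F : C -> C) :
  is_poly n F -> is_poly (k + n) (fun z => Cpow z k * F z)%C.
Proof.
intros H. induction k as [|k IH]; simpl.
- apply (is_poly_ext _ F); [intros z; ring|exact H].
- apply (is_poly_ext _ (fun z => z * (Cpow z k * F z))%C); [intros z; ring|].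
  now apply is_poly_X_mult.
Qed.

Lemma is_poly_mult (n m : nat) (F G : C -> C) :
  is_poly n F -> is_poly m G -> is_poly (n + m) (fun z => F z * G z)%C.
Proof.
revert F. induction n as [|n IH]; intros F HF HG.
- destruct HF as [c Hc]. apply (is_poly_ext _ (fun z => c 0%nat * G z)%C).
  + intros z. now rewrite Hc, poly_sum_0.
  + now apply is_poly_scal.
- destruct (is_poly_ind_form n F HF) as [H [k [HH E]]].
  apply (is_poly_ext _ (fun z => H z * G z + k * (Cpow z (S n) * G z))%C).
  + intros z. rewrite E. ring.
  + apply is_poly_plus.
    * apply is_poly_S. now apply IH.
    * apply is_poly_scal. now apply is_poly_pow_mult.
Qed.

Lemma is_poly_comp_scal (n : nat) (k : C) (F : C -> C) :
  is_poly n F -> is_poly n (fun z => F (k * z)%C).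
Proof.
intros [c Hc]. exists (fun j => c j * Cpow k j)%C. intros z. rewrite Hc. unfold poly_sum.
apply sum_n_ext. intros j. rewrite Cpow_mult_l. apply Cmult_assoc.
Qed.

(** This is what makes a polynomial times a simple fraction a simple fraction plus a polynomial. *)
Lemma is_poly_diff_quotient (n : nat) (F : C -> C) (p : C) : is_poly (S n) F ->
  exists Q, is_poly n Q /\ forall z, (F z - F p = Q z * (z - p))%C.
Proof.
assert (Hpow : forall k, exists Q, is_poly k Q /\ forall z, (Cpow z (S k) - Cpow p (S k) = Q z * (z - p))%C).
{ intros k. induction k as [|k [Q [HQ E]]].
  - exists (fun _ => RtoC 1). split; [apply is_poly_const|]. intros z. simpl. ring.
  - exists (fun z => z * Q z + Cpow p (S k))%C. split.
    + apply is_poly_plus; [now apply is_poly_X_mult|apply is_poly_const].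
    + intros z. rewrite (Cpow_S z (S k)), (Cpow_S p (S k)).
      transitivity (z * (Cpow z (S k) - Cpow p (S k)) + Cpow p (S k) * (z - p))%C; [ring|].
      rewrite E. ring. }
revert F. induction n as [|n IH]; intros F HF.
- destruct (is_poly_ind_form 0 F HF) as [G [k [[c Hc] E]]].
  exists (fun _ => k). split; [apply is_poly_const|].
  intros z. rewrite !E, !Hc, !poly_sum_0. simpl. ring.
- destruct (is_poly_ind_form (S n) F HF) as [G [k [HG E]]].
  destruct (IH G HG) as [Q1 [HQ1 E1]]. destruct (Hpow (S n)) as [Q2 [HQ2 E2]].
  exists (fun z => Q1 z + k * Q2 z)%C. split.
  + apply is_poly_plus; [now apply is_poly_S|now apply is_poly_scal].
  + intros z. rewrite !E.
    transitivity ((G z - G p) + k * (Cpow z (S (S n)) - Cpow p (S (S n))))%C; [ring|].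
    rewrite E1, E2. ring.
Qed.

(** A polynomial function of degree at most [n] is, up to an arbitrarily small multiple of
    [z^n], one of exact degree [n]. *)
Lemma is_poly_exact_degree (n : nat) (F : C -> C) (tau : R) : is_poly n F -> 0 < tau ->
  exists c k, c n <> RtoC 0 /\ Cmod k <= tau /\
    forall z, poly_sum c n z = (F z + k * Cpow z n)%C.
Proof.
intros [c Hc] Ht.
assert (H : exists k, Cmod k <= tau /\ (c n + k)%C <> 0).
{ destruct (Ceq_dec (c n) 0) as [E|E].
  - exists (RtoC tau). rewrite Cmod_R, Rabs_pos_eq by lra. split; [lra|].
    rewrite E, Cplus_0_l. intros [= H]. lra.
  - exists (RtoC 0). rewrite Cmod_0. split; [lra|]. now rewrite Cplus_0_r. }
destruct H as [k [Hk Hn]].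
exists (fun j => if Nat.eqb j n then (c n + k)%C else c j), k.
split; [now rewrite Nat.eqb_refl|]. split; [exact Hk|].
intros z. rewrite Hc. clear Hc. destruct n as [|n].
- rewrite !poly_sum_0. simpl. ring.
- rewrite !poly_sum_S, Nat.eqb_refl.
  transitivity (poly_sum c n z + (c (S n) + k) * Cpow z (S n))%C; [|ring].
  f_equal. unfold poly_sum. apply sum_n_ext_loc. intros j Hj.
  now rewrite (proj2 (Nat.eqb_neq j (S n))) by lia.
Qed.

(** * Geometric polynomial approximation on star-shaped sets *)

Lemma rect_plus (f g : C -> C) (a b c d : R) : a <= b -> c <= d ->
  diff_on_bd f a b c d -> diff_on_bd g a b c d ->
  rect (fun s => f s + g s)%C a b c d = (rect f a b c d + rect g a b c d)%C.
Proof.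
intros Hab Hcd Hf Hg.
assert (E := rect_minus (fun s => f s + g s)%C g a b c d Hab Hcd).
assert (E2 : rect (fun s => f s + g s - g s)%C a b c d = rect f a b c d).
{ unfold rect, hseg, vseg.
  rewrite (CInt_ext (fun x => f (pt x c) + g (pt x c) - g (pt x c))%C (fun x => f (pt x c))); [|lra|intros; ring].
  rewrite (CInt_ext (fun x => f (pt x d) + g (pt x d) - g (pt x d))%C (fun x => f (pt x d))); [|lra|intros; ring].
  rewrite (CInt_ext (fun y => f (pt a y) + g (pt a y) - g (pt a y))%C (fun y => f (pt a y))); [|lra|intros; ring].
  rewrite (CInt_ext (fun y => f (pt b y) + g (pt b y) - g (pt b y))%C (fun y => f (pt b y))); [|lra|intros; ring].
  reflexivity. }
rewrite <- E2, E; [ring| |exact Hg].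
intros x y Hx Hy Hb. apply Cdiff_plus; [now apply Hf|now apply Hg].
Qed.

Lemma rect_ext (f g : C -> C) (a b c d : R) : a <= b -> c <= d ->
  (forall x y, a <= x <= b -> c <= y <= d -> x = a \/ x = b \/ y = c \/ y = d ->
     f (pt x y) = g (pt x y)) -> rect f a b c d = rect g a b c d.
Proof.
intros Hab Hcd H. unfold rect, hseg, vseg.
rewrite (CInt_ext (fun x => f (pt x c)) (fun x => g (pt x c))); [|lra|intros; apply H; lra].
rewrite (CInt_ext (fun x => f (pt x d)) (fun x => g (pt x d))); [|lra|intros; apply H; lra].
rewrite (CInt_ext (fun y => f (pt a y)) (fun y => g (pt a y))); [|lra|intros; apply H; lra].
rewrite (CInt_ext (fun y => f (pt b y)) (fun y => g (pt b y))); [|lra|intros; apply H; lra].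
reflexivity.
Qed.

Lemma Cdiff_poly_sum (c : nat -> C) (n : nat) (z q : C) :
  Cdiff (fun q => poly_sum c n (z * q))%C q.
Proof.
induction n as [|n IH].
- apply (Cdiff_ext (fun _ => c 0%nat)); [intros; now rewrite poly_sum_0|apply Cdiff_const].
- apply (Cdiff_ext (fun q => poly_sum c n (z * q) + c (S n) * Cpow (z * q) (S n))%C); [intros; now rewrite poly_sum_S|].
  apply Cdiff_plus; [exact IH|]. apply Cdiff_mult; [apply Cdiff_const|]. apply (Cdiff_pow (fun q => z * q)%C).
  apply Cdiff_mult; [apply Cdiff_const|apply Cdiff_id].
Qed.

(** The coefficients of the approximating polynomials arise in this way, with [z] as parameter. *)
Lemma rect_poly_sum (c : nat -> C) (w : C -> C) (z : C) (k : nat) (a b a' b' : R) :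
  a <= b -> a' <= b' -> diff_on_bd w a b a' b' ->
  rect (fun q => poly_sum c k (z * q) * w q)%C a b a' b' =
  poly_sum (fun j => c j * rect (fun q => Cpow q j * w q)%C a b a' b')%C k z.
Proof.
intros Hab Hab' Hw.
assert (Hpow : forall j, diff_on_bd (fun q => Cpow q j * w q)%C a b a' b').
{ intros j x y Hx Hy Hb. apply Cdiff_mult; [apply Cdiff_pow; apply Cdiff_id|now apply Hw]. }
assert (Hps : forall j, diff_on_bd (fun q => poly_sum c j (z * q) * w q)%C a b a' b').
{ intros j x y Hx Hy Hb. apply Cdiff_mult; [apply Cdiff_poly_sum|now apply Hw]. }
induction k as [|k IH].
- rewrite poly_sum_0, <- rect_scal by auto. apply rect_ext; try assumption.
  intros x y _ _ _. rewrite poly_sum_0. change (Cpow (pt x y) 0) with (RtoC 1). ring.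
- rewrite poly_sum_S, <- IH. clear IH.
  rewrite (rect_ext _ (fun q => poly_sum c k (z * q) * w q + (c (S k) * Cpow z (S k)) * (Cpow q (S k) * w q))%C); try assumption.
  + rewrite rect_plus; try assumption; [|apply Hps|].
    * rewrite rect_scal by auto. ring.
    * intros x y Hx Hy Hb. apply Cdiff_mult; [apply Cdiff_const|now apply Hpow].
  + intros x y _ _ _. rewrite poly_sum_S, Cpow_mult_l. ring.
Qed.

Section Star.

Variables (S : C -> Prop) (f : C -> C) (c : nat -> C) (d B : R).
Hypothesis (S_star : forall z t, S z -> 0 <= t <= 1 -> S (z * RtoC t)%C).
Hypothesis (S_le_1 : forall z, S z -> Cmod z <= 1).
Hypothesis (d_pos : 0 < d).
Hypothesis (f_nbhd : forall z, S z -> forall w, Cmod (w - z) < d -> Cdiff f w /\ Cmod (f w) <= B).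
Hypothesis (f_taylor : forall k, exists K r, 0 < r /\
  forall w, Cmod w < r -> Cmod (f w - poly_sum c k w) <= K * Cmod w ^ (Datatypes.S k)).

(* any [L > (2 + PI) / d] keeps the rectangle below within distance [d] of the unit interval *)
Let L := 7 / d.
Let kappa := 1 - exp (- L).
Let E (q : C) := Cexp (RtoC (- L) * q).
Let u (q : C) := ((1 - E q) / RtoC kappa)%C.
Let du (q : C) := (RtoC L * E q / RtoC kappa)%C.
Let a := - (2 / L).
Let b := 1 + 2 / L.
Let h := PI / L.

Local Lemma L_pos : 0 < L.
Proof. unfold L. apply Rdiv_lt_0_compat; lra. Qed.

Local Lemma kappa_bounds : 0 < kappa < 1.
Proof.
unfold kappa. assert (H := L_pos). assert (H1 := exp_pos (- L)).
assert (exp (- L) < exp 0) by (apply exp_increasing; lra). rewrite exp_0 in *. lra.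
Qed.

Local Lemma kappa_neq_0 : RtoC kappa <> 0.
Proof. intros H. apply RtoC_inj in H. assert (K := kappa_bounds). lra. Qed.

Local Lemma L_neq_0 : RtoC L <> 0.
Proof. intros H. apply RtoC_inj in H. assert (K := L_pos). lra. Qed.

Local Lemma h_pos : 0 < h.
Proof. unfold h. apply Rdiv_lt_0_compat; [apply PI_RGT_0|apply L_pos]. Qed.

Local Lemma two_L_pos : 0 < 2 / L.
Proof. apply Rdiv_lt_0_compat; [lra|apply L_pos]. Qed.

(** The rectangle lies within distance [2 / L + PI / L < d] of the unit interval; multiplication by
    [z] maps the interval into the star-shaped set and does not increase distances. *)
Local Lemma close_to_unit_interval (x y : R) (z : C) : S z -> a <= x <= b -> - h <= y <= h ->
  Cdiff f (z * pt x y)%C /\ Cmod (f (z * pt x y)%C) <= B.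
Proof.
intros Hz Hx Hy.
assert (HL := L_pos). assert (H2 := two_L_pos).
assert (Ht : exists t, 0 <= t <= 1 /\ Rabs (x - t) <= 2 / L).
{ unfold a, b in Hx. destruct (Rle_dec x 0).
  - exists 0. split; [lra|]. apply Rabs_le. lra.
  - destruct (Rle_dec x 1).
    + exists x. split; [lra|]. replace (x - x) with 0 by ring. rewrite Rabs_R0. lra.
    + exists 1. split; [lra|]. apply Rabs_le. lra. }
destruct Ht as [t [Ht Hxt]].
apply (f_nbhd (z * RtoC t)%C (S_star z t Hz Ht)).
replace (z * pt x y - z * RtoC t)%C with (z * pt (x - t) y)%C.
2:{ unfold pt. change (RtoC t) with ((t, 0) : C). destruct z. unfold Cminus, Cmult, Cplus, Copp; simpl. f_equal; ring. }
rewrite Cmod_mult.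
assert (Hz1 := S_le_1 z Hz). assert (Hz0 := Cmod_ge_0 z).
assert (Hm : Cmod (pt (x - t) y) <= 2 / L + h).
{ eapply Rle_trans; [apply Cmod_le_Re_Im|]. unfold pt; simpl. apply Rplus_le_compat; [exact Hxt|]. apply Rabs_le. lra. }
assert (Hd : 2 / L + h < d).
{ unfold h, L. assert (PI <= 4) by apply PI_4.
  replace (2 / (7 / d) + PI / (7 / d)) with ((2 + PI) / 7 * d) by (field; lra). nra. }
assert (Hm0 := Cmod_ge_0 (pt (x - t) y)). nra.
Qed.

Local Lemma E_eq_real (x y t : R) : - h <= y <= h -> E (pt x y) = RtoC (exp (- L * t)) -> pt x y = pt t 0.
Proof.
intros Hy H. assert (HL := L_pos).
assert (H1 : Cexp (RtoC (- L) * (pt x y - RtoC t)) = 1).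
{ replace (RtoC (- L) * (pt x y - RtoC t))%C with (RtoC (- L) * pt x y + RtoC (- (- L * t)))%C
    by (rewrite (RtoC_opp (- L * t)), RtoC_mult; ring).
  rewrite Cexp_plus. fold (E (pt x y)). rewrite H, <- Cexp_RtoC, <- Cexp_plus, <- Cexp_0.
  f_equal. rewrite (RtoC_opp (- L * t)). ring. }
assert (E1 : (RtoC (- L) * (pt x y - RtoC t))%C = pt (- L * (x - t)) (- L * y)).
{ unfold pt. change (RtoC t) with ((t, 0) : C). change (RtoC (- L)) with ((- L, 0) : C).
  unfold Cminus, Cmult, Cplus, Copp; simpl. f_equal; ring. }
rewrite E1 in H1. apply Cexp_eq_1 in H1.
- injection H1 as H2 H3. unfold pt. f_equal; nra.
- simpl. assert (P := PI_RGT_0).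
  assert (L * h = PI) by (unfold h; field; lra).
  apply Rabs_def1; nra.
Qed.

(** The other zeros of [u] and [u - 1] are shifted by multiples of [2 PI i / L], twice the height
    of the rectangle above the axis. *)
Local Lemma u_eq_0 (x y : R) : - h <= y <= h -> u (pt x y) = 0 -> pt x y = pt 0 0.
Proof.
intros Hy H. apply E_eq_real; [exact Hy|]. rewrite Rmult_0_r, exp_0.
replace (E (pt x y)) with (1 - u (pt x y) * RtoC kappa)%C by (unfold u; field; apply kappa_neq_0).
rewrite H. ring.
Qed.

Local Lemma u_eq_1 (x y : R) : - h <= y <= h -> u (pt x y) = 1 -> pt x y = pt 1 0.
Proof.
intros Hy H. apply E_eq_real; [exact Hy|].
replace (E (pt x y)) with (1 - u (pt x y) * RtoC kappa)%C by (unfold u; field; apply kappa_neq_0).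
rewrite H. unfold kappa. rewrite Rmult_1_r, RtoC_minus. ring.
Qed.

Local Lemma Cdiff_E (q : C) : Cdiff E q.
Proof. apply Cdiff_Cexp. apply Cdiff_mult; [apply Cdiff_const|apply Cdiff_id]. Qed.

Local Lemma Cdiff_u (q : C) : Cdiff u q.
Proof.
apply Cdiff_div; [|apply Cdiff_const|apply kappa_neq_0].
apply Cdiff_minus; [apply Cdiff_const|apply Cdiff_E].
Qed.

Local Lemma Cdiff_du (q : C) : Cdiff du q.
Proof.
apply Cdiff_div; [|apply Cdiff_const|apply kappa_neq_0].
apply Cdiff_mult; [apply Cdiff_const|apply Cdiff_E].
Qed.

Local Lemma is_Cderive_u (k q : C) : is_Cderive (fun q => u q - k)%C q (du q).
Proof.
assert (H := is_Cderive_Cexp_lin (RtoC (- L)) 1 q).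
apply is_derive_C_iff. intros eps Heps.
assert (Hk := kappa_bounds).
destruct (proj1 (is_derive_C_iff _ _ _) H (eps * kappa)) as [dl [Hdl H1]]; [apply Rmult_lt_0_compat; lra|].
exists dl. split; [exact Hdl|]. intros w Hw. specialize (H1 w Hw).
match type of H1 with Cmod ?v <= _ => set (V := v) in * end.
replace (u w - k - (u q - k) - du q * (w - q))%C with (- V / RtoC kappa)%C.
2:{ unfold V, u, du, E. rewrite RtoC_opp. field. apply kappa_neq_0. }
rewrite Cmod_div by apply kappa_neq_0. rewrite Cmod_opp, Cmod_R, Rabs_pos_eq by lra.
apply (Rmult_le_reg_r kappa); [lra|].
replace (Cmod V / kappa * kappa) with (Cmod V) by (field; lra). lra.
Qed.

Local Lemma du_neq_0 (q : C) : du q <> 0.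
Proof.
unfold du. assert (H1 := kappa_neq_0). assert (H2 := L_neq_0). assert (H3 := Cexp_neq_0 (RtoC (- L) * q)).
intros H0. apply (Cmult_neq_0 _ _ H2 H3). fold (E q).
transitivity (RtoC L * E q / RtoC kappa * RtoC kappa)%C; [now field|]. rewrite H0. ring.
Qed.

Local Lemma is_Cderive_u_0 : is_Cderive u (pt 0 0) (du (pt 0 0)).
Proof.
apply (is_derive_ext (K := C_AbsRing) (V := AbsRing_NormedModule C_AbsRing) (fun q => (u q - 0)%C)).
- intros t. change ((u t - 0)%C = u t). ring.
- apply is_Cderive_u.
Qed.

Local Lemma u_0 : u (pt 0 0) = 0.
Proof.
unfold u, E. change (pt 0 0) with (RtoC 0).
replace (RtoC (- L) * 0)%C with (RtoC 0) by ring. rewrite Cexp_0. field. apply kappa_neq_0.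
Qed.

Local Lemma u_1 : u (pt 1 0) = 1.
Proof.
unfold u, E. change (pt 1 0) with (RtoC 1).
replace (RtoC (- L) * 1)%C with (RtoC (- L)) by ring. rewrite Cexp_RtoC.
replace (1 - RtoC (exp (- L)))%C with (RtoC kappa) by (unfold kappa; now rewrite RtoC_minus).
field. apply kappa_neq_0.
Qed.

Let m := 1 - exp (- L - 2).
Let rho := kappa / m.

Local Lemma rho_bounds : 0 < rho < 1.
Proof.
assert (H := kappa_bounds). unfold rho, m.
assert (exp (- L - 2) < exp (- L)) by (apply exp_increasing; lra).
unfold kappa in *. split.
- apply Rdiv_lt_0_compat; lra.
- apply Rlt_div_l; lra.
Qed.

Local Lemma Cmod_E (x y : R) : Cmod (E (pt x y)) = exp (- L * x).
Proof. unfold E. rewrite Cmod_Cexp. f_equal. simpl. ring. Qed.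

(** On the horizontal sides [exp (- L q)] is negative, on the left side its modulus is at least
    [3], and on the right side it is smaller than its value [exp (- L)] at [q = 1]. *)
Local Lemma u_large (x y : R) : a <= x <= b -> - h <= y <= h ->
  x = a \/ x = b \/ y = - h \/ y = h -> / rho <= Cmod (u (pt x y)).
Proof.
intros Hx Hy Hb. assert (HL := L_pos). assert (Hk := kappa_bounds).
assert (He := exp_pos (- L - 2)).
assert (Hm : m <= Cmod (1 - E (pt x y))%C).
{ destruct Hb as [H|[H|H]].
  - assert (T := Cmod_minus_rev (E (pt x y)) 1). rewrite Cmod_minus_sym, Cmod_E, Cmod_1 in T.
    assert (T2 : 1 + 2 <= exp (- L * x)).
    { replace (- L * x) with 2 by (rewrite H; unfold a; field; lra). left. apply exp_ineq1. lra. }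
    unfold m. lra.
  - assert (T := Cmod_minus_rev 1 (E (pt x y))). rewrite Cmod_E, Cmod_1 in T.
    replace (- L * x) with (- L - 2) in T by (rewrite H; unfold b; field; lra).
    unfold m. lra.
  - assert (T : E (pt x y) = RtoC (- exp (- L * x))).
    { unfold E, Cexp.
      replace (Re (RtoC (- L) * pt x y)) with (- L * x) by (simpl; ring).
      replace (cos (Im (RtoC (- L) * pt x y))) with (- (1)).
      2:{ destruct H as [->| ->].
          - replace (Im _) with PI by (unfold h; simpl; field; lra). now rewrite cos_PI.
          - replace (Im _) with (- PI) by (unfold h; simpl; field; lra). now rewrite cos_neg, cos_PI. }
      replace (sin (Im (RtoC (- L) * pt x y))) with 0.
      2:{ destruct H as [->| ->].
          - replace (Im _) with PI by (unfold h; simpl; field; lra). now rewrite sin_PI.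
          - replace (Im _) with (- PI) by (unfold h; simpl; field; lra). rewrite sin_neg, sin_PI. ring. }
      unfold RtoC. f_equal; ring. }
    rewrite T, <- RtoC_minus, Cmod_R.
    assert (He2 := exp_pos (- L * x)). rewrite Rabs_pos_eq by lra. unfold m. lra. }
unfold u. rewrite Cmod_div by apply kappa_neq_0. rewrite Cmod_R, (Rabs_pos_eq kappa) by lra.
unfold rho. replace (/ (kappa / m)) with (m / kappa).
- apply Rmult_le_compat_r; [left; apply Rinv_0_lt_compat; lra|exact Hm].
- field. split; [|lra]. assert (R := rho_bounds). intros E0. unfold rho in R. rewrite E0 in R. unfold Rdiv in R. rewrite Rinv_0, Rmult_0_r in R. lra.
Qed.

Local Lemma du_bound (x y : R) : a <= x <= b -> Cmod (du (pt x y)) <= L * exp 2 / kappa.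
Proof.
intros Hx. assert (HL := L_pos). assert (Hk := kappa_bounds).
unfold du. rewrite Cmod_div by apply kappa_neq_0. rewrite Cmod_mult, Cmod_E, !Cmod_R, !Rabs_pos_eq by lra.
apply Rmult_le_compat_r; [left; apply Rinv_0_lt_compat; lra|].
apply Rmult_le_compat_l; [lra|].
assert (- L * x <= 2).
{ destruct Hx as [Hx _]. unfold a in Hx. apply (Rmult_le_compat_l L) in Hx; [|lra].
  replace (L * - (2 / L)) with (- (2)) in Hx by (field; lra). lra. }
destruct (Req_dec (- L * x) 2) as [->|N]; [lra|]. left. apply exp_increasing. lra.
Qed.

Local Lemma box : a <= b /\ - h <= h /\ a < 0 < b /\ - h < 0 < h /\ a < 1 < b.
Proof. assert (H := h_pos). assert (H2 := two_L_pos). unfold a, b. lra. Qed.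

Local Lemma Cdiff_fz (x y : R) (z : C) : S z -> a <= x <= b -> - h <= y <= h ->
  Cdiff (fun q => f (z * q))%C (pt x y).
Proof.
intros Hz Hx Hy. apply (Cdiff_comp f (fun q => (z * q)%C)).
- now apply close_to_unit_interval.
- apply Cdiff_mult; [apply Cdiff_const|apply Cdiff_id].
Qed.

(** The integrand of Cauchy's formula after [n] steps of the expansion
    [1 / (u - 1) = 1 / u + 1 / u^2 + ... + 1 / (u^n (u - 1))]. *)
Let H (n : nat) (z q : C) := (f (z * q) * (du q / (Cpow (u q) n * (u q - 1))))%C.

Local Lemma u_neq_0 (x y : R) : - h <= y <= h -> pt x y <> pt 0 0 -> u (pt x y) <> 0.
Proof. intros Hy Hn H0. now apply Hn, u_eq_0. Qed.

Local Lemma u_neq_1 (x y : R) : - h <= y <= h -> pt x y <> pt 1 0 -> (u (pt x y) - 1)%C <> 0.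
Proof.
intros Hy Hn H0. apply Hn, u_eq_1; [exact Hy|].
replace (u (pt x y)) with (u (pt x y) - 1 + 1)%C by ring. rewrite H0. ring.
Qed.

Local Lemma contour_avoids_0_and_1 (x y : R) : a <= x <= b -> - h <= y <= h ->
  x = a \/ x = b \/ y = - h \/ y = h -> pt x y <> pt 0 0 /\ pt x y <> pt 1 0.
Proof.
intros Hx Hy Hb. assert (K := box). split; apply pt_neq; lra.
Qed.

(** [q = 1] is the only singularity, since [f (z q)] is analytic on the rectangle. *)
Local Lemma Cauchy_formula (z : C) : S z -> rect (H 0 z) a b (- h) h = (Ci * RtoC (2 * PI) * f z)%C.
Proof.
intros Hz. assert (K := box). unfold H.
apply (rect_residue _ _ a b (- h) h 1 0); try lra.
- intros x y Hx Hy Hn. apply Cdiff_mult; [now apply Cdiff_fz|].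
  apply Cdiff_div; [apply Cdiff_du| |].
  + apply Cdiff_mult; [apply (Cdiff_const (RtoC 1))|]. apply Cdiff_minus; [apply Cdiff_u|apply Cdiff_const].
  + simpl. rewrite Cmult_1_l. now apply u_neq_1.
- intros eps Heps.
  destruct (quotient_simple_pole (fun q => f (z * q) * du q)%C (fun q => u q - 1)%C (pt 1 0) (du (pt 1 0)))
    with (eps := eps) as [dl [Hdl HH]]; try assumption.
  + apply Cdiff_mult; [apply Cdiff_fz; try assumption; lra|apply Cdiff_du].
  + apply is_Cderive_u.
  + rewrite u_1. ring.
  + apply du_neq_0.
  + set (dl' := Rmin dl (Rmin (2 / L) h)).
    assert (D1 : dl' <= dl) by apply Rmin_l.
    assert (D2 : dl' <= 2 / L) by (eapply Rle_trans; [apply Rmin_r|apply Rmin_l]).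
    assert (D3 : dl' <= h) by (eapply Rle_trans; [apply Rmin_r|apply Rmin_r]).
    exists dl'. split.
    { repeat apply Rmin_glb_lt; try assumption; [apply two_L_pos|apply h_pos]. }
    intros s Hs Hsd. specialize (HH s Hs (Rlt_le_trans _ _ _ Hsd D1)).
    replace (f (z * pt 1 0) * du (pt 1 0) / du (pt 1 0))%C with (f z) in HH.
    2:{ replace (z * pt 1 0)%C with z by (change (pt 1 0) with (RtoC 1); ring). field. apply du_neq_0. }
    eapply Rle_trans; [|exact HH]. right. f_equal. f_equal. f_equal. simpl.
    rewrite Cmult_1_l. unfold Cdiv. ring.
Qed.

Local Lemma H_step (n : nat) (z : C) : S z ->
  rect (H n z) a b (- h) h =
  (rect (fun q => f (z * q) * (du q / Cpow (u q) (Datatypes.S n)))%C a b (- h) h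
   + rect (H (Datatypes.S n) z) a b (- h) h)%C.
Proof.
intros Hz. assert (K := box). rewrite <- rect_plus; try lra.
- apply rect_ext; try lra. intros x y Hx Hy Hb. unfold H.
  destruct (contour_avoids_0_and_1 x y Hx Hy Hb) as [N0 N1].
  assert (U0 := u_neq_0 x y Hy N0). assert (U1 := u_neq_1 x y Hy N1).
  rewrite (Cpow_S _ n). field. repeat split; try assumption. now apply Cpow_nz.
- intros x y Hx Hy Hb. destruct (contour_avoids_0_and_1 x y Hx Hy Hb) as [N0 N1].
  apply Cdiff_mult; [now apply Cdiff_fz|]. apply Cdiff_div; [apply Cdiff_du|apply Cdiff_pow, Cdiff_u|].
  now apply Cpow_nz, u_neq_0.
- intros x y Hx Hy Hb. destruct (contour_avoids_0_and_1 x y Hx Hy Hb) as [N0 N1].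
  apply Cdiff_mult; [now apply Cdiff_fz|]. apply Cdiff_div; [apply Cdiff_du| |].
  + apply Cdiff_mult; [apply Cdiff_pow, Cdiff_u|]. apply Cdiff_minus; [apply Cdiff_u|apply Cdiff_const].
  + apply Cmult_neq_0; [now apply Cpow_nz, u_neq_0|now apply u_neq_1].
Qed.

(** The only singularity is at [q = 0], where the Taylor polynomial of degree [n] captures
    everything that the pole of order [n + 1] sees. *)
Local Lemma coefficient_taylor (n : nat) (z : C) : S z ->
  rect (fun q => f (z * q) * (du q / Cpow (u q) (Datatypes.S n)))%C a b (- h) h =
  rect (fun q => poly_sum c n (z * q) * (du q / Cpow (u q) (Datatypes.S n)))%C a b (- h) h.
Proof.
intros Hz. assert (K := box).
set (w := fun q => (du q / Cpow (u q) (Datatypes.S n))%C).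
assert (Hw : forall x y, - h <= y <= h -> pt x y <> pt 0 0 -> Cdiff w (pt x y)).
{ intros x y Hy N0. apply Cdiff_div; [apply Cdiff_du|apply Cdiff_pow, Cdiff_u|].
  now apply Cpow_nz, u_neq_0. }
assert (E0 : rect (fun q => f (z * q) * w q - poly_sum c n (z * q) * w q)%C a b (- h) h = (Ci * RtoC (2 * PI) * 0)%C).
{ apply (rect_residue _ _ a b (- h) h 0 0); try lra.
  - intros x y Hx Hy N0. apply Cdiff_minus; apply Cdiff_mult; try (now apply Hw).
    + now apply Cdiff_fz.
    + apply Cdiff_poly_sum.
  - intros eps Heps.
    destruct (f_taylor n) as [K0 [r [Hr HT]]].
    set (D0 := Cmod (du (pt 0 0))).
    assert (HD0 : 0 < D0) by (apply Cmod_gt_0, du_neq_0).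
    destruct (proj1 (is_derive_C_iff _ _ _) is_Cderive_u_0 (D0 / 2)) as [d1 [Hd1 H1]]; [lra|].
    destruct (Cdiff_continuous du (pt 0 0) (Cdiff_du _) 1 Rlt_0_1) as [d2 [Hd2 H2]].
    set (K1 := (Rabs K0 + 1) * ((D0 + 1) * (2 / D0) ^ Datatypes.S n)).
    assert (HK1 : 0 < K1).
    { assert (T := Rabs_pos K0). unfold K1. apply Rmult_lt_0_compat; [lra|]. apply Rmult_lt_0_compat; [lra|].
      apply pow_lt. apply Rdiv_lt_0_compat; lra. }
    set (dl := Rmin (Rmin d1 d2) (Rmin r (eps / K1))).
    assert (M1 : dl <= d1) by (eapply Rle_trans; [apply Rmin_l|apply Rmin_l]).
    assert (M2 : dl <= d2) by (eapply Rle_trans; [apply Rmin_l|apply Rmin_r]).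
    assert (M3 : dl <= r) by (eapply Rle_trans; [apply Rmin_r|apply Rmin_l]).
    assert (M4 : dl <= eps / K1) by (eapply Rle_trans; [apply Rmin_r|apply Rmin_r]).
    exists dl. split.
    { repeat apply Rmin_glb_lt; try assumption. now apply Rdiv_lt_0_compat. }
    intros s Hs Hsd. specialize (H1 s (Rlt_le_trans _ _ _ Hsd M1)). specialize (H2 s (Rlt_le_trans _ _ _ Hsd M2)).
    change (pt 0 0) with (RtoC 0) in *. replace (s - 0)%C with s in * by ring.
    assert (Hs0 : 0 < Cmod s) by now apply Cmod_gt_0.
    assert (T0 := u_0). change (pt 0 0) with (RtoC 0) in T0. rewrite T0 in H1.
    replace (u s - 0 - du 0 * s)%C with (u s - du 0 * s)%C in H1 by ring.
    assert (Hu : D0 / 2 * Cmod s <= Cmod (u s)).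
    { assert (T := Cmod_minus_rev (du 0 * s) (u s)). rewrite Cmod_minus_sym, Cmod_mult in T.
      fold D0 in T. lra. }
    assert (Hu0 : u s <> 0).
    { apply Cmod_gt_0. assert (0 < D0 / 2 * Cmod s) by (apply Rmult_lt_0_compat; lra). lra. }
    assert (Hdu : Cmod (du s) <= D0 + 1).
    { assert (T := Cmod_minus_rev (du s) (du 0)). unfold D0. change (pt 0 0) with (RtoC 0). lra. }
    assert (Hzs : Cmod (z * s) <= Cmod s).
    { rewrite Cmod_mult. assert (T := S_le_1 z Hz). nra. }
    specialize (HT (z * s)%C ltac:(lra)).
    replace (s * (f (z * s) * w s - poly_sum c n (z * s) * w s) - 0)%C
      with (s * ((f (z * s) - poly_sum c n (z * s)) * w s))%C by ring.
    rewrite !Cmod_mult. unfold w. rewrite Cmod_div by now apply Cpow_nz. rewrite Cmod_pow.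
    apply Rle_trans with (Cmod s * K1).
    2:{ apply Rle_trans with (eps / K1 * K1); [|right; field; lra]. apply Rmult_le_compat_r; lra. }
    apply Rmult_le_compat_l; [lra|]. unfold K1.
    apply Rle_trans with (((Rabs K0 + 1) * Cmod s ^ Datatypes.S n) * ((D0 + 1) * (2 / D0) ^ Datatypes.S n / Cmod s ^ Datatypes.S n)).
    + apply Rmult_le_compat; [apply Cmod_ge_0| | |].
      * apply Rdiv_le_0_compat; [apply Cmod_ge_0|]. apply pow_lt. now apply Cmod_gt_0.
      * eapply Rle_trans; [exact HT|]. assert (T := Rle_abs K0). assert (T' := Rabs_pos K0).
        apply Rle_trans with ((Rabs K0 + 1) * Cmod (z * s) ^ Datatypes.S n).
        -- apply Rmult_le_compat_r; [apply pow_le, Cmod_ge_0|lra].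
        -- apply Rmult_le_compat_l; [lra|]. apply pow_incr. split; [apply Cmod_ge_0|exact Hzs].
      * unfold Rdiv at 2. rewrite Rmult_assoc. apply Rmult_le_compat; [apply Cmod_ge_0| |exact Hdu|].
        -- left. apply Rinv_0_lt_compat. apply pow_lt. now apply Cmod_gt_0.
        -- rewrite <- !pow_inv, <- Rpow_mult_distr. apply pow_incr. split.
           ++ left. apply Rinv_0_lt_compat. now apply Cmod_gt_0.
           ++ replace (2 / D0 * / Cmod s) with (/ (D0 / 2 * Cmod s)) by (field; lra).
              apply Rinv_le_contravar; [|exact Hu]. apply Rmult_lt_0_compat; lra.
    + right. assert (HX : 0 < Cmod s ^ Datatypes.S n) by now apply pow_lt.
      set (X := Cmod s ^ Datatypes.S n) in *. set (Y := (2 / D0) ^ Datatypes.S n). field. lra. }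
rewrite rect_minus in E0; try lra.
- change (rect (fun q => f (z * q) * w q)%C a b (- h) h =
    rect (fun q => poly_sum c n (z * q) * w q)%C a b (- h) h).
  match goal with |- ?l = ?r => replace l with (l - r + r)%C by ring end. rewrite E0. ring.
- intros x y Hx Hy Hb. destruct (contour_avoids_0_and_1 x y Hx Hy Hb) as [N0 N1]. apply Cdiff_mult; [now apply Cdiff_fz|now apply Hw].
- intros x y Hx Hy Hb. destruct (contour_avoids_0_and_1 x y Hx Hy Hb) as [N0 N1]. apply Cdiff_mult; [apply Cdiff_poly_sum|now apply Hw].
Qed.

Local Lemma H_expansion (n : nat) : exists P, is_poly n P /\
  forall z, S z -> (Ci * RtoC (2 * PI) * f z)%C = (P z + rect (H (Datatypes.S n) z) a b (- h) h)%C.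
Proof.
assert (K := box).
assert (Hc : forall k, exists P, is_poly k P /\ forall z, S z ->
  rect (fun q => f (z * q) * (du q / Cpow (u q) (Datatypes.S k)))%C a b (- h) h = P z).
{ intros k.
  exists (poly_sum (fun j => c j * rect (fun q => Cpow q j * (du q / Cpow (u q) (Datatypes.S k)))%C a b (- h) h)%C k).
  split; [eexists; reflexivity|].
  intros z Hz. rewrite coefficient_taylor by exact Hz.
  apply (rect_poly_sum c (fun q => du q / Cpow (u q) (Datatypes.S k))%C); try lra.
  intros x y Hx Hy Hb. destruct (contour_avoids_0_and_1 x y Hx Hy Hb) as [N0 N1].
  apply Cdiff_div; [apply Cdiff_du|apply Cdiff_pow, Cdiff_u|]. now apply Cpow_nz, u_neq_0. }
induction n as [|n [P [HP IH]]].
- destruct (Hc 0%nat) as [P [HP E0]]. exists P. split; [exact HP|].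
  intros z Hz. rewrite <- Cauchy_formula, H_step, E0 by exact Hz. reflexivity.
- destruct (Hc (Datatypes.S n)) as [Q [HQ E0]]. exists (fun z => P z + Q z)%C.
  split; [apply is_poly_plus; [now apply is_poly_S|exact HQ]|].
  intros z Hz. rewrite IH, (H_step (Datatypes.S n)), E0 by exact Hz. ring.
Qed.

(** [n + 1] steps of the expansion leave a remainder of size [rho^n], with [1 / rho] the lower bound
    of [|u|] on the contour. *)
Lemma geometric_approximation : exists K rho0, 0 < K /\ 0 < rho0 < 1 /\
  forall n, exists P, is_poly n P /\ forall z, S z -> Cmod (f z - P z) <= K * rho0 ^ n.
Proof.
assert (Kb := box). assert (Hr := rho_bounds). assert (Hk := kappa_bounds). assert (HL := L_pos).
set (U := L * exp 2 / kappa).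
assert (HU : 0 < U).
{ apply Rdiv_lt_0_compat; [|lra]. apply Rmult_lt_0_compat; [lra|apply exp_pos]. }
set (K := 2 * (b - a + (h - - h)) * ((Rabs B + 1) * (U * (/ (/ rho - 1))))).
assert (Hr1 : 1 < / rho) by (rewrite <- Rinv_1; apply Rinv_lt_contravar; lra).
assert (HB := Rabs_pos B).
assert (HK : 0 < K).
{ unfold K. apply Rmult_lt_0_compat; [lra|]. apply Rmult_lt_0_compat; [lra|].
  apply Rmult_lt_0_compat; [exact HU|]. apply Rinv_0_lt_compat. lra. }
exists K, rho. split; [exact HK|]. split; [exact Hr|].
intros n. destruct (H_expansion n) as [P [HP E0]].
assert (H2pi : (Ci * RtoC (2 * PI))%C <> 0).
{ apply Cmod_gt_0. rewrite Cmod_mult, Cmod_Ci, Cmod_R, Rmult_1_l. assert (P0 := PI_RGT_0).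
  rewrite Rabs_pos_eq; lra. }
exists (fun z => / (Ci * RtoC (2 * PI)) * P z)%C. split; [now apply is_poly_scal|].
intros z Hz.
replace (f z - / (Ci * RtoC (2 * PI)) * P z)%C with ((Ci * RtoC (2 * PI) * f z - P z) / (Ci * RtoC (2 * PI)))%C
  by (generalize dependent (Ci * RtoC (2 * PI))%C; intros k _ Hk0; field; exact Hk0).
rewrite E0 by exact Hz.
replace (P z + rect (H (Datatypes.S n) z) a b (- h) h - P z)%C with (rect (H (Datatypes.S n) z) a b (- h) h) by ring.
rewrite Cmod_div by exact H2pi.
assert (Hb : Cmod (rect (H (Datatypes.S n) z) a b (- h) h) <= K * rho ^ n).
{ unfold K. rewrite Rmult_assoc.
  apply rect_le; try lra.
  - intros x y Hx Hy Hb. destruct (contour_avoids_0_and_1 x y Hx Hy Hb) as [N0 N1].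
    apply Cdiff_mult; [now apply Cdiff_fz|]. apply Cdiff_div; [apply Cdiff_du| |].
    + apply Cdiff_mult; [apply Cdiff_pow, Cdiff_u|]. apply Cdiff_minus; [apply Cdiff_u|apply Cdiff_const].
    + apply Cmult_neq_0; [now apply Cpow_nz, u_neq_0|now apply u_neq_1].
  - intros x y Hx Hy Hb. destruct (contour_avoids_0_and_1 x y Hx Hy Hb) as [N0 N1].
    assert (U0 := u_neq_0 x y Hy N0). assert (U1 := u_neq_1 x y Hy N1).
    assert (Hu := u_large x y Hx Hy Hb).
    unfold H. rewrite Cmod_mult, Cmod_div by (apply Cmult_neq_0; [now apply Cpow_nz|exact U1]).
    rewrite Cmod_mult, Cmod_pow. rewrite Rmult_assoc.
    apply Rmult_le_compat; [apply Cmod_ge_0| | |].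
    + apply Rdiv_le_0_compat; [apply Cmod_ge_0|]. apply Rmult_lt_0_compat; [apply pow_lt; lra|now apply Cmod_gt_0].
    + assert (T := proj2 (close_to_unit_interval x y z Hz Hx Hy)). assert (T2 := Rle_abs B). lra.
    + rewrite Rmult_assoc. apply Rmult_le_compat; [apply Cmod_ge_0| |now apply du_bound|].
      * left. apply Rinv_0_lt_compat. apply Rmult_lt_0_compat; [apply pow_lt; lra|now apply Cmod_gt_0].
      * rewrite Rinv_mult, Rmult_comm. apply Rmult_le_compat.
        -- left. apply Rinv_0_lt_compat. now apply Cmod_gt_0.
        -- left. apply Rinv_0_lt_compat. apply pow_lt. lra.
        -- apply Rinv_le_contravar; [lra|].
           assert (T := Cmod_minus_rev (u (pt x y)) 1). rewrite Cmod_1 in T. lra.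
        -- rewrite <- (Rinv_inv rho) at 1. rewrite pow_inv.
           apply Rinv_le_contravar; [apply pow_lt; lra|].
           apply Rle_trans with ((/ rho) ^ Datatypes.S n).
           ++ simpl. assert (0 < (/ rho) ^ n) by (apply pow_lt; lra). nra.
           ++ apply pow_incr. lra. }
rewrite Cmod_mult, Cmod_Ci, Rmult_1_l, Cmod_R.
assert (P0 := PI_RGT_0). rewrite Rabs_pos_eq by lra.
assert (PI2 : 1 <= 2 * PI) by (assert (T := PI2_1); lra).
apply Rle_div_l; [lra|].
assert (0 <= K * rho ^ n) by (apply Rmult_le_pos; [lra|apply pow_le; lra]).
nra.
Qed.
End Star.

(** * The sector *)

Lemma Rabs_sin_le (x : R) : Rabs (sin x) <= Rabs x.
Proof.
assert (H : forall t, 0 < t -> Rabs (sin t) <= t).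
{ intros t Ht. apply Rabs_le. split.
  - destruct (Rle_dec t 1).
    + assert (0 <= sin t) by (assert (P := PI2_1); apply sin_ge_0; lra). lra.
    + assert (T := SIN_bound t). lra.
  - left. now apply sin_lt_x. }
destruct (Rtotal_order x 0) as [L|[->|L]].
- rewrite <- Rabs_Ropp, <- sin_neg, <- (Rabs_Ropp x), (Rabs_pos_eq (- x)) by lra. apply H. lra.
- rewrite sin_0. lra.
- rewrite (Rabs_pos_eq x) by lra. now apply H.
Qed.

Lemma Cmod_Cexp_imag_minus_1 (t : R) : Cmod (Cexp (0, t)%R - 1) <= Rabs t.
Proof.
assert (E := cos_2a_sin (t / 2)). replace (2 * (t / 2)) with t in E by field.
assert (E2 := sin2_cos2 t). unfold Rsqr in E2.
assert (S2 := Rsqr_le_abs_1 _ _ (Rabs_sin_le (t / 2))). unfold Rsqr in S2.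
unfold Cmod, Cexp; simpl. rewrite exp_0.
match goal with |- sqrt ?e <= _ => replace e with (2 - 2 * cos t) by lra end.
apply Rsqr_incr_0_var; [|apply Rabs_pos].
rewrite Rsqr_sqrt by (assert (T := COS_bound t); lra). rewrite <- Rsqr_abs. unfold Rsqr. lra.
Qed.

Lemma sector_polar (beta : R) (z : C) : 0 <= beta < 2 -> sector beta z ->
  exists x phi, 0 <= x <= 1 /\ - (beta * PI / 2) <= phi <= beta * PI / 2 /\
    z = (RtoC x * Cexp (0, phi)%R)%C.
Proof.
intros Hb [x [sep [Hx [Hth [H|H]]]]]; assert (P := PI_RGT_0).
- exists x, (sep * PI / 2). split; [exact Hx|]. split; [nra|exact H].
- exists x, (- (sep * PI / 2)). split; [exact Hx|]. split; [nra|exact H].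
Qed.

Lemma polar_sector (beta x phi : R) : 0 <= beta < 2 -> 0 <= x <= 1 ->
  - (beta * PI / 2) <= phi <= beta * PI / 2 -> sector beta (RtoC x * Cexp (0, phi)%R)%C.
Proof.
intros Hb Hx Hp. assert (P := PI_RGT_0).
assert (B : forall t, 0 <= t <= beta * PI / 2 -> 0 <= 2 * t / PI <= beta).
{ intros t Ht. split; [apply Rdiv_le_0_compat; lra|]. apply Rle_div_l; lra. }
destruct (Rle_dec 0 phi).
- exists x, (2 * phi / PI). split; [exact Hx|]. split; [apply B; lra|]. left.
  do 2 f_equal. f_equal. field. lra.
- exists x, (2 * (- phi) / PI). split; [exact Hx|]. split; [apply B; lra|]. right.
  do 2 f_equal. f_equal. field. lra.
Qed.

Lemma Cmod_polar (x phi : R) : 0 <= x -> Cmod (RtoC x * Cexp (0, phi)%R) = x.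
Proof. intros Hx. rewrite Cmod_mult, Cmod_Cexp, Cmod_R, Rabs_pos_eq by lra. simpl. rewrite exp_0. ring. Qed.

Lemma sector_star (beta : R) (z : C) (t : R) : 0 <= beta < 2 -> sector beta z -> 0 <= t <= 1 ->
  sector beta (z * RtoC t)%C.
Proof.
intros Hb Hz Ht. destruct (sector_polar beta z Hb Hz) as [x [phi [Hx [Hp ->]]]].
replace (RtoC x * Cexp (0, phi)%R * RtoC t)%C with (RtoC (x * t) * Cexp (0, phi)%R)%C by (rewrite RtoC_mult; ring).
apply polar_sector; [exact Hb|nra|exact Hp].
Qed.

Lemma sector_Cmod_le_1 (beta : R) (z : C) : 0 <= beta < 2 -> sector beta z -> Cmod z <= 1.
Proof.
intros Hb Hz. destruct (sector_polar beta z Hb Hz) as [x [phi [Hx [Hp ->]]]].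
rewrite Cmod_polar; lra.
Qed.

Definition sector_gap (beta : R) : R := cos (beta * PI / 4).

Lemma sector_gap_bounds (beta : R) : 0 <= beta < 2 -> 0 < sector_gap beta <= 1.
Proof.
intros Hb. assert (P := PI_RGT_0). split; [apply cos_gt_0; nra|]. apply COS_bound.
Qed.

(** Rotating by half the argument of [z] makes the real part of [y + z] at least
    [cos (beta PI / 4) (y + |z|)]. *)
Lemma gap_polar (beta y x phi : R) : 0 <= beta < 2 -> 0 <= y -> 0 <= x ->
  - (beta * PI / 2) <= phi <= beta * PI / 2 ->
  sector_gap beta * (y + x) <= Cmod (RtoC y + RtoC x * Cexp (0, phi)%R).
Proof.
intros Hb Hy Hx Hp. assert (P := PI_RGT_0).
assert (Hc : sector_gap beta <= cos (phi / 2)).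
{ unfold sector_gap. destruct (Rle_dec 0 phi).
  - apply cos_decr_1; nra.
  - rewrite <- (cos_neg (phi / 2)). apply cos_decr_1; nra. }
rewrite <- (Rmult_1_l (Cmod _)).
replace 1 with (Cmod (Cexp (0, - (phi / 2))%R)) by (rewrite Cmod_Cexp; simpl; apply exp_0).
rewrite <- Cmod_mult.
eapply Rle_trans; [|apply Rabs_Re_le]. eapply Rle_trans; [|apply Rle_abs].
replace (Re _) with (cos (phi / 2) * (y + x)).
- apply Rmult_le_compat_r; lra.
- replace (Cexp (0, - (phi / 2))%R * (y + x * Cexp (0, phi)%R))%C
    with (RtoC y * Cexp (0, - (phi / 2))%R + RtoC x * (Cexp (0, - (phi / 2))%R * Cexp (0, phi)%R))%C by ring.
  rewrite <- Cexp_plus.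
  replace ((0, - (phi / 2))%R + (0, phi)%R)%C with ((0, phi / 2) : C) by (unfold Cplus; simpl; f_equal; field).
  unfold Cexp; simpl. rewrite exp_0, cos_neg. ring.
Qed.

Lemma gap_sector (beta y : R) (z : C) : 0 <= beta < 2 -> 0 <= y -> sector beta z ->
  sector_gap beta * (y + Cmod z) <= Cmod (RtoC y + z).
Proof.
intros Hb Hy Hz. destruct (sector_polar beta z Hb Hz) as [x [phi [Hx [Hp ->]]]].
rewrite Cmod_polar by lra. apply gap_polar; lra.
Qed.

(** * Polynomial approximation on the sector *)

Lemma pow_n_Cpow (z : C) (k : nat) : @pow_n C_Ring z k = Cpow z k.
Proof. induction k as [|k IH]; simpl; [reflexivity|]. now rewrite IH. Qed.

Lemma bounded_prefix (t : nat -> C) (B : R) (N : nat) :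
  (forall n, (N <= n)%nat -> Cmod (t n) <= B) -> exists B', forall n, Cmod (t n) <= B'.
Proof.
revert B. induction N as [|N IH]; intros B H.
- exists B. intros n. apply H. lia.
- apply (IH (Rmax B (Cmod (t N)))). intros n Hn.
  destruct (Nat.eq_dec n N) as [->|Hne]; [apply Rmax_r|].
  eapply Rle_trans; [apply H; lia|apply Rmax_l].
Qed.

Lemma is_pseries_partial (c : nat -> C) (h l : C) :
  is_pseries (K := C_AbsRing) (V := C_NormedModule) c h l ->
  forall eps, 0 < eps -> exists N, forall n, (N <= n)%nat -> Cmod (poly_sum c n h - l) < eps.
Proof.
intros H eps Heps.
destruct (H (fun y => Cmod (y - l) < eps)) as [N HN].
- apply locally_C. exists (mkposreal eps Heps). intros y Hy. exact Hy.
- exists N. intros n Hn. specialize (HN n Hn).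
  replace (poly_sum c n h) with (sum_n (fun k => scal (pow_n (K := C_Ring) h k) (c k)) n); [exact HN|].
  unfold poly_sum. apply sum_n_ext. intros k. rewrite pow_n_Cpow.
  change ((Cpow h k * c k)%C = (c k * Cpow h k)%C). apply Cmult_comm.
Qed.

(** Convergence at radius [r / 2] bounds the coefficients, and the geometric series bounds the
    tail. *)
Lemma pseries_taylor (c : nat -> C) (G : C -> C) (r : R) : 0 < r ->
  (forall h, Cmod h < r -> is_pseries (K := C_AbsRing) (V := C_NormedModule) c h (G h)) ->
  exists B, forall k h, Cmod h < r / 4 -> Cmod (G h - poly_sum c k h) <= B * (2 / r * Cmod h) ^ S k.
Proof.
intros Hr HG.
assert (Hh0 : Cmod (RtoC (r / 2)) < r) by (rewrite Cmod_R, Rabs_pos_eq; lra).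
assert (HB : exists B, forall k, Cmod (c k * Cpow (RtoC (r / 2)) k) <= B).
{ destruct (is_pseries_partial _ _ _ (HG _ Hh0) 1 Rlt_0_1) as [N HN].
  apply (bounded_prefix _ 2 (S N)). intros [|n] Hn; [lia|].
  assert (H1 := HN n ltac:(lia)). assert (H2 := HN (S n) ltac:(lia)).
  replace (c (S n) * Cpow (RtoC (r / 2)) (S n))%C with
    ((poly_sum c (S n) (RtoC (r / 2)) - G (RtoC (r / 2))) - (poly_sum c n (RtoC (r / 2)) - G (RtoC (r / 2))))%C
    by (rewrite poly_sum_S; ring).
  unfold Cminus at 1. eapply Rle_trans; [apply Cmod_triangle|]. rewrite Cmod_opp. lra. }
destruct HB as [B HB].
assert (HB0 : 0 <= B) by (eapply Rle_trans; [apply Cmod_ge_0|apply (HB 0%nat)]).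
exists (2 * B). intros k h Hh.
set (q := 2 / r * Cmod h).
assert (Hq : 0 <= q <= 1 / 2).
{ assert (T := Cmod_ge_0 h). unfold q. split.
  - apply Rmult_le_pos; [|exact T]. apply Rdiv_le_0_compat; lra.
  - apply (Rmult_le_reg_l (r / 2)); [lra|]. replace (r / 2 * (2 / r * Cmod h)) with (Cmod h) by (field; lra). lra. }
assert (Hterm : forall j, Cmod (c j * Cpow h j) <= B * q ^ j).
{ intros j. specialize (HB j). rewrite Cmod_mult, Cmod_pow in *.
  rewrite Cmod_R, Rabs_pos_eq in HB by lra.
  replace (Cmod h) with (r / 2 * q) by (unfold q; field; lra). rewrite Rpow_mult_distr, <- Rmult_assoc.
  apply Rmult_le_compat_r; [apply pow_le; lra|exact HB]. }
assert (Hsum : forall m, Cmod (poly_sum c (k + m) h - poly_sum c k h) <= 2 * B * q ^ S k * (1 - (1 / 2) ^ m)).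
{ induction m as [|m IH].
  - rewrite Nat.add_0_r. replace (poly_sum c k h - poly_sum c k h)%C with (RtoC 0) by ring.
    rewrite Cmod_0. simpl. right. ring.
  - rewrite Nat.add_succ_r, poly_sum_S.
    replace (poly_sum c (k + m) h + c (S (k + m)) * Cpow h (S (k + m)) - poly_sum c k h)%C with
      (poly_sum c (k + m) h - poly_sum c k h + c (S (k + m)) * Cpow h (S (k + m)))%C by ring.
    eapply Rle_trans; [apply Cmod_triangle|].
    assert (T := Hterm (S (k + m))). replace (S (k + m)) with (S k + m)%nat in T by lia. rewrite pow_add in T.
    assert (T2 : q ^ m <= (1 / 2) ^ m) by (apply pow_incr; lra).
    assert (T3 : 0 <= q ^ S k) by (apply pow_le; lra).
    assert (T4 : B * (q ^ S k * q ^ m) <= B * (q ^ S k * (1 / 2) ^ m)).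
    { apply Rmult_le_compat_l; [exact HB0|]. apply Rmult_le_compat_l; assumption. }
    change (S (k + m)) with (S k + m)%nat.
    replace ((1 / 2) ^ S m) with (1 / 2 * (1 / 2) ^ m) by reflexivity. lra. }
assert (Hh' : Cmod h < r) by lra.
apply le_epsilon. intros eps Heps.
destruct (is_pseries_partial _ _ _ (HG h Hh') eps Heps) as [N HN].
specialize (HN (k + N)%nat ltac:(lia)). specialize (Hsum N).
replace (G h - poly_sum c k h)%C with ((poly_sum c (k + N) h - poly_sum c k h) - (poly_sum c (k + N) h - G h))%C by ring.
unfold Cminus at 1. eapply Rle_trans; [apply Cmod_triangle|]. rewrite Cmod_opp.
assert (T : 0 <= 2 * B * q ^ S k) by (apply Rmult_le_pos; [lra|apply pow_le; lra]).
assert (T2 : 0 <= (1 / 2) ^ N) by (apply pow_le; lra). fold q. nra.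
Qed.

Lemma analytic_taylor (g : C -> C) (z0 : C) : analytic_at g z0 ->
  exists c B r, 0 < r /\ forall k w, Cmod (w - z0) < r ->
    Cmod (g w - poly_sum c k (w - z0)) <= B * (Cmod (w - z0) / (2 * r)) ^ S k.
Proof.
intros [c [r [Hr H]]].
destruct (pseries_taylor c (fun h => g (z0 + h)%C) r Hr) as [B HB].
- intros h Hh. assert (E : h = (z0 + h - z0)%C) by ring.
  rewrite E at 1. apply H. now rewrite <- E.
- exists c, B, (r / 4). split; [lra|]. intros k w Hw. specialize (HB k (w - z0)%C Hw).
  replace (z0 + (w - z0))%C with w in HB by ring.
  replace (Cmod (w - z0) / (2 * (r / 4))) with (2 / r * Cmod (w - z0)) by (field; lra). exact HB.
Qed.

(** The derivative is the coefficient of order one; the expansion up to that order has a quadratic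
    error. *)
Lemma analytic_Cdiff (g : C -> C) (z0 : C) : analytic_at g z0 -> Cdiff g z0.
Proof.
intros H. destruct (analytic_taylor g z0 H) as [c [B [r [Hr HT]]]].
assert (E0 : g z0 = c 0%nat).
{ assert (T := HT 0%nat z0). replace (z0 - z0)%C with (RtoC 0) in T by ring.
  rewrite Cmod_0 in T. specialize (T Hr). rewrite poly_sum_0 in T.
  unfold Rdiv in T. rewrite Rmult_0_l in T. simpl in T. rewrite Rmult_0_l, Rmult_0_r in T.
  assert (T1 : Cmod (g z0 - c 0%nat) = 0) by (apply Rle_antisym; [exact T|apply Cmod_ge_0]).
  apply Cmod_eq_0 in T1. replace (g z0) with (g z0 - c 0%nat + c 0%nat)%C by ring. rewrite T1. ring. }
apply Cdiff_iff. exists (c 1%nat). intros eps Heps.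
set (K := (Rabs B + 1) / (4 * r * r)).
assert (HK : 0 < K).
{ assert (T := Rabs_pos B). unfold K. apply Rdiv_lt_0_compat; [lra|]. repeat apply Rmult_lt_0_compat; lra. }
exists (Rmin r (eps / K)). split; [apply Rmin_glb_lt; [exact Hr|now apply Rdiv_lt_0_compat]|].
intros w Hw. specialize (HT 1%nat w (Rlt_le_trans _ _ _ Hw (Rmin_l _ _))).
assert (Hw2 := Rlt_le_trans _ _ _ Hw (Rmin_r _ _)).
rewrite poly_sum_S, poly_sum_0 in HT. simpl Cpow in HT. rewrite E0.
replace (g w - c 0%nat - c 1%nat * (w - z0))%C with (g w - (c 0%nat + c 1%nat * ((w - z0) * 1)))%C by ring.
eapply Rle_trans; [exact HT|].
set (x := Cmod (w - z0)) in *. assert (Hx : 0 <= x) by apply Cmod_ge_0.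
apply Rle_trans with (K * x * x).
- replace (B * (x / (2 * r)) ^ 2) with (B / (4 * r * r) * (x * x)) by (field; lra).
  replace (K * x * x) with (K * (x * x)) by ring. apply Rmult_le_compat_r; [nra|]. unfold K, Rdiv.
  apply Rmult_le_compat_r; [left; apply Rinv_0_lt_compat; repeat apply Rmult_lt_0_compat; lra|].
  assert (T := Rle_abs B). lra.
- apply Rmult_le_compat_r; [exact Hx|]. apply Rlt_le in Hw2.
  apply (Rmult_le_compat_l K) in Hw2; [|lra]. replace (K * (eps / K)) with eps in Hw2 by (field; lra). exact Hw2.
Qed.

Lemma polar_Lipschitz (x phi x' phi' : R) : 0 <= x' <= 1 ->
  Cmod (RtoC x * Cexp (0, phi)%R - RtoC x' * Cexp (0, phi')%R) <= Rabs (x - x') + Rabs (phi - phi').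
Proof.
intros Hx'.
replace (RtoC x * Cexp (0, phi)%R - RtoC x' * Cexp (0, phi')%R)%C with
  (RtoC (x - x') * Cexp (0, phi)%R + RtoC x' * (Cexp (0, phi')%R * (Cexp (0, phi - phi')%R - 1)))%C.
2:{ replace (Cexp (0, phi)%R) with (Cexp (0, phi')%R * Cexp (0, phi - phi')%R)%C.
    - rewrite RtoC_minus. ring.
    - rewrite <- Cexp_plus. f_equal. unfold Cplus; simpl. f_equal; ring. }
eapply Rle_trans; [apply Cmod_triangle|].
rewrite !Cmod_mult, !Cmod_R, !Cmod_Cexp. simpl. rewrite exp_0.
assert (T := Cmod_Cexp_imag_minus_1 (phi - phi')). rewrite (Rabs_pos_eq x') by lra.
assert (T2 := Cmod_ge_0 (Cexp (0, phi - phi')%R - 1)). nra.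
Qed.

(** Compactness of the sector turns analyticity near it into bounds on a uniform neighbourhood. *)
Lemma analytic_uniform_nbhd (beta : R) (g : C -> C) : 0 <= beta < 2 ->
  analytic_in_nbhd (sector beta) g ->
  exists d, 0 < d /\ forall z, sector beta z -> forall w, Cmod (w - z) < d ->
    Cdiff g w /\ Cmod (g w) <= / d.
Proof.
intros Hb [U [HU [HSU Hg]]].
set (Phi := beta * PI / 2).
set (p := fun x phi => (RtoC x * Cexp (0, phi)%R)%C).
set (good := fun (x phi dl : R) => forall w, Cmod (w - p x phi) < 3 * dl -> Cdiff g w /\ Cmod (g w) <= / dl).
assert (Hloc : forall x phi, exists dl : posreal,
   0 <= x <= 1 -> - Phi <= phi <= Phi -> good x phi dl).
{ intros x phi. destruct (excluded_middle_informative (0 <= x <= 1 /\ - Phi <= phi <= Phi)) as [[Hx Hp]|N].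
  2:{ exists (mkposreal 1 Rlt_0_1). tauto. }
  assert (Hu := HSU _ (polar_sector beta x phi Hb Hx Hp)). fold (p x phi) in Hu.
  destruct (proj1 (locally_C _ _) (HU _ Hu)) as [e He].
  destruct (Cdiff_continuous g (p x phi) (analytic_Cdiff g _ (Hg _ Hu)) 1 Rlt_0_1) as [e2 [He2 Hc]].
  set (M := Cmod (g (p x phi)) + 1).
  assert (HM : 0 < M) by (unfold M; generalize (Cmod_ge_0 (g (p x phi))); lra).
  set (dl := Rmin (Rmin (e / 3) (e2 / 3)) (/ M)).
  assert (Hdl : 0 < dl).
  { assert (T := cond_pos e). repeat apply Rmin_glb_lt; try lra. now apply Rinv_0_lt_compat. }
  assert (D1 : dl <= e / 3) by (eapply Rle_trans; [apply Rmin_l|apply Rmin_l]).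
  assert (D2 : dl <= e2 / 3) by (eapply Rle_trans; [apply Rmin_l|apply Rmin_r]).
  assert (D3 : dl <= / M) by apply Rmin_r.
  exists (mkposreal dl Hdl). intros _ _ w Hw. simpl in *. split.
  - apply analytic_Cdiff, Hg. apply He. change (Cmod (w - p x phi) < e). lra.
  - specialize (Hc w ltac:(lra)). apply Rle_trans with M.
    + unfold M. assert (T := Cmod_minus_rev (g w) (g (p x phi))). lra.
    + rewrite <- (Rinv_inv M). apply Rinv_le_contravar; assumption. }
set (delta := fun x phi => proj1_sig (constructive_indefinite_description _ (Hloc x phi))).
assert (Hdelta : forall x phi, 0 <= x <= 1 -> - Phi <= phi <= Phi -> good x phi (delta x phi)).
{ intros x phi. unfold delta. destruct (constructive_indefinite_description _ _) as [dl H]. exact H. }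
destruct (compactness_value_2d 0 1 (- Phi) Phi delta) as [d Hd].
exists d. split; [apply cond_pos|]. intros z Hz w Hw.
apply NNPP. intros N.
destruct (sector_polar beta z Hb Hz) as [x [phi [Hx [Hp ->]]]].
apply (Hd x phi Hx Hp). intros [u [v [Hu [Hv [D1 [D2 D3]]]]]]. apply N.
assert (T := polar_Lipschitz x phi u v Hu).
destruct (Hdelta u v Hu Hv w) as [G1 G2].
- unfold p.
  replace (w - RtoC u * Cexp (0, v)%R)%C with ((w - RtoC x * Cexp (0, phi)%R) + (RtoC x * Cexp (0, phi)%R - RtoC u * Cexp (0, v)%R))%C by ring.
  eapply Rle_lt_trans; [apply Cmod_triangle|]. simpl in *. lra.
- split; [exact G1|]. eapply Rle_trans; [exact G2|]. apply Rinv_le_contravar; [apply cond_pos|exact D3].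
Qed.

Lemma sector_0 (beta : R) : 0 <= beta < 2 -> sector beta 0.
Proof.
intros Hb. replace (RtoC 0) with (RtoC 0 * Cexp (0, 0)%R)%C by ring.
assert (P := PI_RGT_0). apply polar_sector; [exact Hb|lra|nra].
Qed.

(** Compactness supplies the uniform neighbourhood, and the power series at the vertex of the sector
    supplies the Taylor polynomials. *)
Lemma analytic_geometric_approximation (beta : R) (g : C -> C) : 0 <= beta < 2 ->
  analytic_in_nbhd (sector beta) g ->
  exists K rho, 0 < K /\ 0 < rho < 1 /\
    forall n, exists P, is_poly n P /\ forall z, sector beta z -> Cmod (g z - P z) <= K * rho ^ n.
Proof.
intros Hb Hg. destruct (analytic_uniform_nbhd beta g Hb Hg) as [d [Hd H]].
assert (H0 : analytic_at g 0).
{ destruct Hg as [U [_ [H1 H2]]]. apply H2, H1, sector_0, Hb. }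
destruct (analytic_taylor g 0 H0) as [c [B [r [Hr HT]]]].
apply (geometric_approximation (sector beta) g c d (/ d)).
- intros z t Hz Ht. now apply sector_star.
- intros z Hz. now apply (sector_Cmod_le_1 beta).
- exact Hd.
- exact H.
- intros k. exists (B / (2 * r) ^ S k), r. split; [exact Hr|]. intros w Hw.
  specialize (HT k w). replace (w - 0)%C with w in HT by ring. specialize (HT Hw).
  eapply Rle_trans; [exact HT|]. right. unfold Rdiv. rewrite Rpow_mult_distr, pow_inv. ring.
Qed.

Lemma Cinv_geometric (w : C) (k : nat) : (1 + w)%C <> 0 ->
  (/ (1 + w) - sum_n (fun j => Cpow (- w) j) k)%C = (Cpow (- w) (S k) / (1 + w))%C.
Proof.
intros Hw. induction k as [|k IH].
- rewrite sum_O. simpl. field. exact Hw.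
- rewrite sum_Sn.
  transitivity ((/ (1 + w) - sum_n (fun j => Cpow (- w) j) k) - Cpow (- w) (S k))%C.
  + change plus with Cplus. ring.
  + rewrite IH. rewrite (Cpow_S (- w) (S k)). field. exact Hw.
Qed.

Lemma inverse_geometric_approximation (beta A : R) : 0 <= beta < 2 -> 0 < A ->
  exists K rho, 0 < K /\ 0 < rho < 1 /\
    forall n, exists P, is_poly n P /\
      forall z, sector beta z -> Cmod (/ (1 + z / RtoC A) - P z) <= K * rho ^ n.
Proof.
intros Hb HA. assert (Hgap := sector_gap_bounds beta Hb).
set (c0 := sector_gap beta) in *.
assert (HA0 : RtoC A <> 0) by (intros E; apply RtoC_inj in E; lra).
assert (Hmin : forall z, sector beta z -> forall w, Cmod (w - z) < A * c0 / 2 -> c0 / 2 <= Cmod (1 + w / RtoC A)).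
{ intros z Hz w Hw.
  assert (T := gap_sector beta A z Hb (Rlt_le _ _ HA) Hz). fold c0 in T.
  assert (T1 := Cmod_minus_rev (RtoC A + z) (z - w)).
  replace (RtoC A + z - (z - w))%C with (RtoC A * (1 + w / RtoC A))%C in T1 by (field; exact HA0).
  rewrite Cmod_mult, Cmod_R, Rabs_pos_eq, Cmod_minus_sym in T1 by lra.
  assert (T2 := Cmod_ge_0 z). apply (Rmult_le_reg_l A); [exact HA|]. nra. }
assert (Hnz : forall z, sector beta z -> forall w, Cmod (w - z) < A * c0 / 2 -> (1 + w / RtoC A)%C <> 0).
{ intros z Hz w Hw. apply Cmod_gt_0. specialize (Hmin z Hz w Hw). lra. }
apply (geometric_approximation (sector beta) (fun z => / (1 + z / RtoC A))%C
  (fun k => Cpow (- (1 / RtoC A)) k) (A * c0 / 2) (2 / c0)).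
- intros z t Hz Ht. now apply sector_star.
- intros z Hz. now apply (sector_Cmod_le_1 beta).
- nra.
- intros z Hz w Hw. split.
  + apply Cdiff_inv; [|now apply (Hnz z)].
    apply Cdiff_plus; [apply Cdiff_const|]. apply Cdiff_div; [apply Cdiff_id|apply Cdiff_const|exact HA0].
  + rewrite Cmod_inv by now apply (Hnz z). replace (2 / c0) with (/ (c0 / 2)) by (field; lra).
    apply Rinv_le_contravar; [lra|]. now apply (Hmin z).
- intros k. exists (2 / c0 * (/ A) ^ S k), (A * c0 / 2). split; [nra|]. intros w Hw.
  assert (Hw0 : Cmod (w - 0) < A * c0 / 2) by (replace (w - 0)%C with w by ring; exact Hw).
  assert (N := Hnz 0 (sector_0 beta Hb) w Hw0). assert (M := Hmin 0 (sector_0 beta Hb) w Hw0).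
  replace (poly_sum (fun j => Cpow (- (1 / RtoC A)) j) k w) with (sum_n (fun j => Cpow (- (w / RtoC A)) j) k).
  2:{ unfold poly_sum. apply sum_n_ext. intros j. rewrite <- Cpow_mult_l. f_equal. field. exact HA0. }
  rewrite Cinv_geometric by exact N. rewrite Cmod_div by exact N. rewrite Cmod_pow, Cmod_opp, Cmod_div by exact HA0.
  rewrite Cmod_R, Rabs_pos_eq by lra.
  replace (2 / c0 * (/ A) ^ S k * Cmod w ^ S k) with ((Cmod w / A) ^ S k * (2 / c0))
    by (unfold Rdiv; rewrite Rpow_mult_distr; ring).
  apply Rmult_le_compat_l.
  + apply pow_le. apply Rdiv_le_0_compat; [apply Cmod_ge_0|exact HA].
  + replace (2 / c0) with (/ (c0 / 2)) by (field; lra). apply Rinv_le_contravar; lra.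
Qed.

(** * The summation kernel *)

Definition ker_exponent (e : R) (s : C) : C := (RtoC (- (e * (2 * PI))) * Ci * (s * s))%C.

(** For [e = 1] the kernel decays in the upper half plane and for [e = -1] in the lower one;
    both have simple poles at the square roots of the positive integers. *)
Definition ker (e : R) (s : C) : C := (/ (Cexp (ker_exponent e s) - 1))%C.

Lemma ker_exponent_pt (e x y : R) :
  ker_exponent e (pt x y) = pt (4 * PI * e * x * y) (- (e * (2 * PI)) * (x * x - y * y)).
Proof. unfold ker_exponent, pt, Ci, RtoC, Cmult; simpl. f_equal; ring. Qed.

Lemma ker_sum (s : C) : Cexp (ker_exponent 1 s) <> 1 -> (ker 1 s + ker (- (1)) s)%C = RtoC (- (1)).
Proof.
intros H. unfold ker.
replace (ker_exponent (- (1)) s) with (- ker_exponent 1 s)%C.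
2:{ unfold ker_exponent. unfold RtoC, Ci, Cmult, Copp; simpl. f_equal; ring. }
rewrite Cexp_opp. assert (N := Cexp_neq_0 (ker_exponent 1 s)).
set (E := Cexp (ker_exponent 1 s)) in *.
assert (N1 : (E - 1)%C <> 0) by now apply Cminus_neq_0.
assert (N2 : (1 - E)%C <> 0).
{ intros H0. apply N1. replace (E - 1)%C with (- (1 - E))%C by ring. rewrite H0. ring. }
rewrite (RtoC_opp 1). field. repeat split; try assumption.
Qed.

Lemma Cdiff_ker_exponent (e : R) (s : C) : Cdiff (ker_exponent e) s.
Proof.
apply Cdiff_mult; [apply Cdiff_const|]. apply Cdiff_mult; apply Cdiff_id.
Qed.

Lemma Cdiff_ker (e : R) (s : C) : Cexp (ker_exponent e s) <> 1 -> Cdiff (ker e) s.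
Proof.
intros H. apply Cdiff_inv.
- apply Cdiff_minus; [apply Cdiff_Cexp, Cdiff_ker_exponent|apply Cdiff_const].
- now apply Cminus_neq_0.
Qed.

Lemma is_Cderive_Cexp_comp (g : C -> C) (m z dg : C) : is_Cderive g z dg ->
  is_Cderive (fun w => Cexp (g w) - m)%C z (dg * Cexp (g z))%C.
Proof.
intros Hg.
apply (is_derive_ext (K := C_AbsRing) (V := AbsRing_NormedModule C_AbsRing)
  (fun w => (Cexp (g w) + (- m))%C)); [reflexivity|].
replace (dg * Cexp (g z))%C with (dg * Cexp (g z) + 0)%C by ring.
apply (is_derive_plus (K := C_AbsRing) (V := AbsRing_NormedModule C_AbsRing)
  (fun w => Cexp (g w)%C) (fun _ => (- m)%C)).
- apply (is_derive_comp (K := C_AbsRing) (V := AbsRing_NormedModule C_AbsRing) Cexp g); [|exact Hg].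
  apply is_Cderive_Cexp.
- apply (is_derive_const (K := C_AbsRing) (V := AbsRing_NormedModule C_AbsRing)).
Qed.

Lemma is_Cderive_ker_exponent (e : R) (z : C) :
  is_Cderive (ker_exponent e) z (RtoC (- (e * (2 * PI))) * Ci * (RtoC 2 * z))%C.
Proof.
apply is_derive_C_iff. intros eps Heps.
set (k := (RtoC (- (e * (2 * PI))) * Ci)%C).
assert (Hk : 0 < Cmod k + 1) by (generalize (Cmod_ge_0 k); lra).
exists (eps / (Cmod k + 1)). split; [now apply Rdiv_lt_0_compat|].
intros w Hw. unfold ker_exponent. fold k.
replace (k * (w * w) - k * (z * z) - k * (RtoC 2 * z) * (w - z))%C with (k * (w - z) * (w - z))%C.
2:{ change (RtoC 2) with (RtoC (1 + 1)). rewrite RtoC_plus. ring. }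
rewrite !Cmod_mult. apply Rmult_le_compat_r; [apply Cmod_ge_0|].
apply Rlt_le in Hw. apply (Rmult_le_compat_l (Cmod k + 1)) in Hw; [|lra].
replace ((Cmod k + 1) * (eps / (Cmod k + 1))) with eps in Hw by (field; lra).
assert (T := Cmod_ge_0 (w - z)). lra.
Qed.

Lemma ker_neq_1_off_axis (e x y : R) : e * x * y <> 0 -> Cexp (ker_exponent e (pt x y)) <> 1.
Proof.
intros H E. apply (f_equal Cmod) in E. rewrite Cmod_Cexp, ker_exponent_pt, Cmod_1 in E. simpl in E.
rewrite <- exp_0 in E. apply exp_inv in E. apply H. assert (P := PI_RGT_0). nra.
Qed.

Lemma ker_decay (e x y q : R) : 0 < q -> q <= 4 * PI * e * x * y ->
  Cexp (ker_exponent e (pt x y)) <> 1 /\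
  Cmod (ker e (pt x y)) <= / (1 - exp (- q)) * exp (- (4 * PI * e * x * y)).
Proof.
intros Hq H. split.
- apply ker_neq_1_off_axis. intros E.
  replace (4 * PI * e * x * y) with (4 * PI * (e * x * y)) in H by ring. rewrite E in H. lra.
- set (t := 4 * PI * e * x * y) in *. unfold ker.
  assert (T := Cmod_minus_rev (Cexp (ker_exponent e (pt x y))) 1).
  rewrite Cmod_Cexp, ker_exponent_pt, Cmod_1 in T. simpl in T. fold t in T.
  assert (E1 : 1 < exp t) by (rewrite <- exp_0; apply exp_increasing; lra).
  rewrite Cmod_inv.
  2:{ apply Cmod_gt_0. rewrite ker_exponent_pt. fold t. lra. }
  rewrite ker_exponent_pt. fold t.
  assert (E2 : exp (- q) < 1) by (rewrite <- exp_0; apply exp_increasing; lra).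
  assert (E3 : exp (- t) <= exp (- q)) by (destruct (Req_dec t q) as [->|N]; [lra|left; apply exp_increasing; lra]).
  assert (E4 : exp (- t) * exp t = 1) by (rewrite <- exp_plus, Rplus_opp_l; apply exp_0).
  replace (exp (- t)) with (/ exp t) in * by (symmetry; apply exp_Ropp).
  rewrite <- Rinv_mult. apply Rinv_le_contravar.
  + apply Rmult_lt_0_compat; lra.
  + eapply Rle_trans; [|exact T]. nra.
Qed.

(** On vertical lines halfway between two poles, near the real axis. *)
Lemma ker_half (e x y : R) (j : nat) : e = 1 \/ e = - (1) -> x * x = INR j + 1 / 2 ->
  - (1 / 4) <= y <= 1 / 4 ->
  Cexp (ker_exponent e (pt x y)) <> 1 /\ Cmod (ker e (pt x y)) <= 1.
Proof.
intros He Hx Hy. assert (P := PI_RGT_0).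
assert (H : 1 <= Cmod (Cexp (ker_exponent e (pt x y)) - 1)).
{ eapply Rle_trans; [|apply Rabs_Re_le]. rewrite ker_exponent_pt, Hx. unfold Cexp; simpl.
  set (t := exp (4 * PI * e * x * y)). assert (Ht : 0 < t) by apply exp_pos.
  assert (Hc : cos (- (e * (2 * PI)) * (INR j + 1 / 2 - y * y)) <= 0).
  { replace (cos (- (e * (2 * PI)) * (INR j + 1 / 2 - y * y))) with (- cos (2 * PI * (y * y))).
    - assert (0 <= y * y <= 1 / 16) by nra.
      assert (0 <= cos (2 * PI * (y * y))) by (apply cos_ge_0; nra). lra.
    - transitivity (cos (2 * PI * (INR j + 1 / 2 - y * y))).
      + replace (2 * PI * (INR j + 1 / 2 - y * y)) with (- (2 * PI * (y * y)) + PI + 2 * INR j * PI) by field.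
        now rewrite cos_period, neg_cos, cos_neg.
      + destruct He as [->| ->].
        * rewrite <- cos_neg. f_equal. ring.
        * f_equal. ring. }
  rewrite Rabs_left1; nra. }
assert (N : (Cexp (ker_exponent e (pt x y)) - 1)%C <> 0) by (apply Cmod_gt_0; lra).
split.
- intros E. apply N. rewrite E. ring.
- unfold ker. rewrite Cmod_inv by exact N. apply Rle_trans with (/ 1); [|lra].
  apply Rinv_le_contravar; lra.
Qed.

(** * The integrand *)

Definition half_node (j : nat) : R := sqrt (INR j + 1 / 2).

Lemma half_node_sqr (j : nat) : half_node j * half_node j = INR j + 1 / 2.
Proof. apply sqrt_sqrt. assert (T := pos_INR j). lra. Qed.

Lemma half_node_pos (j : nat) : 1 / 2 < half_node j.
Proof.
assert (T := pos_INR j). assert (E := half_node_sqr j). assert (N : 0 <= half_node j) by apply sqrt_pos. nra.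
Qed.

Lemma half_node_lt (i j : nat) : (i < j)%nat -> half_node i < half_node j.
Proof. intros H. apply sqrt_lt_1; assert (T := pos_INR i); apply lt_INR in H; lra. Qed.

Lemma half_node_le (i j : nat) : (i <= j)%nat -> half_node i <= half_node j.
Proof. intros H. apply sqrt_le_1; assert (T := pos_INR i); apply le_INR in H; lra. Qed.

Lemma node_between (j : nat) : half_node j < sqrt (INR (S j)) < half_node (S j).
Proof. rewrite S_INR. assert (T := pos_INR j). unfold half_node. rewrite S_INR. split; apply sqrt_lt_1; lra. Qed.

Lemma node_sqr (j : nat) : sqrt (INR j) * sqrt (INR j) = INR j.
Proof. apply sqrt_sqrt, pos_INR. Qed.

Section Integrand.

Variables (alpha sigma A beta : R).
Hypothesis (Hsigma : 0 < sigma).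
Hypothesis (HA : 0 < A).
Hypothesis (Hbeta : 0 <= beta < 2).

(** [log y] for [y = A exp (sigma (s - nu))]. *)
Definition log_y (nu : R) (s : C) : C := (RtoC sigma * (s - RtoC nu) + RtoC (ln A))%C.
Definition y_pow (nu a : R) (s : C) : C := Cexp (RtoC a * log_y nu s).
(** The weights [1], [log y] and [sigma s] are all of this form. *)
Definition weight (c1 c0 : R) (s : C) : C := (RtoC c1 * (RtoC sigma * s) + RtoC c0)%C.
Definition num (nu c1 c0 : R) (s : C) : C := (weight c1 c0 s * y_pow nu alpha s)%C.
(** [1 + z / y]. *)
Definition den (nu : R) (z s : C) : C := (1 + z * y_pow nu (- (1)) s)%C.
(** The modulus of [z / y] on the line [Re s = x]. *)
Definition ratio (nu : R) (z : C) (x : R) : R := Cmod z * exp (- (sigma * (x - nu) + ln A)).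

Let Phi := beta * PI / 2.
(** Below this height the only poles are the nodes, and the kernel is bounded by [1] on the vertical
    lines through the half nodes. *)
Definition low_height : R := Rmin (1 / 4) ((PI - Phi) / (2 * sigma)).
Definition period : R := 2 * PI / sigma.
Let v1 := low_height.
Let V := period.

Lemma Phi_bounds : 0 <= Phi < PI.
Proof. unfold Phi. assert (P := PI_RGT_0). split; nra. Qed.

Lemma low_height_bounds : 0 < v1 <= 1 / 4 /\ sigma * v1 <= (PI - Phi) / 2.
Proof.
assert (P := Phi_bounds). unfold v1, low_height.
assert (T1 := Rmin_l (1 / 4) ((PI - Phi) / (2 * sigma))). assert (T2 := Rmin_r (1 / 4) ((PI - Phi) / (2 * sigma))).
split; [split; [apply Rmin_glb_lt; [lra|apply Rdiv_lt_0_compat; lra]|exact T1]|].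
apply (Rmult_le_compat_l sigma) in T2; [|lra].
replace (sigma * ((PI - Phi) / (2 * sigma))) with ((PI - Phi) / 2) in T2 by (field; lra). exact T2.
Qed.

Lemma sigma_period : sigma * V = 2 * PI.
Proof. unfold V, period. field. lra. Qed.

Lemma sigma_neq_0 : RtoC sigma <> 0.
Proof. intros E. apply RtoC_inj in E. lra. Qed.

Lemma log_y_pt (nu x y : R) : log_y nu (pt x y) = pt (sigma * (x - nu) + ln A) (sigma * y).
Proof. unfold log_y, pt, RtoC, Cmult, Cminus, Cplus, Copp; simpl. f_equal; ring. Qed.

Lemma Cmod_y_pow (nu a x y : R) : Cmod (y_pow nu a (pt x y)) = exp (a * (sigma * (x - nu) + ln A)).
Proof. unfold y_pow. rewrite Cmod_Cexp, log_y_pt. f_equal. simpl. ring. Qed.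

Lemma Cdiff_log_y (nu : R) (s : C) : Cdiff (log_y nu) s.
Proof.
apply Cdiff_plus; [|apply Cdiff_const]. apply Cdiff_mult; [apply Cdiff_const|].
apply Cdiff_minus; [apply Cdiff_id|apply Cdiff_const].
Qed.

Lemma Cdiff_y_pow (nu a : R) (s : C) : Cdiff (y_pow nu a) s.
Proof. apply Cdiff_Cexp. apply Cdiff_mult; [apply Cdiff_const|apply Cdiff_log_y]. Qed.

Lemma Cdiff_weight (c1 c0 : R) (s : C) : Cdiff (weight c1 c0) s.
Proof.
apply Cdiff_plus; [|apply Cdiff_const]. apply Cdiff_mult; [apply Cdiff_const|].
apply Cdiff_mult; [apply Cdiff_const|apply Cdiff_id].
Qed.

Lemma Cdiff_num (nu c1 c0 : R) (s : C) : Cdiff (num nu c1 c0) s.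
Proof. apply Cdiff_mult; [apply Cdiff_weight|apply Cdiff_y_pow]. Qed.

Lemma Cdiff_den (nu : R) (z s : C) : Cdiff (den nu z) s.
Proof.
apply Cdiff_plus; [apply Cdiff_const|]. apply Cdiff_mult; [apply Cdiff_const|apply Cdiff_y_pow].
Qed.

Lemma Cmod_den_term (nu x y : R) (z : C) : Cmod (z * y_pow nu (- (1)) (pt x y)) = ratio nu z x.
Proof. rewrite Cmod_mult, Cmod_y_pow. unfold ratio. f_equal. f_equal. ring. Qed.

Lemma ratio_decr (nu x x' : R) (z : C) : x <= x' -> ratio nu z x' <= ratio nu z x.
Proof.
intros H. unfold ratio. apply Rmult_le_compat_l; [apply Cmod_ge_0|].
destruct (Req_dec x x') as [->|N]; [lra|]. left. apply exp_increasing. nra.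
Qed.

Lemma den_ge_small (nu x y t : R) (z : C) : ratio nu z x <= t -> 1 - t <= Cmod (den nu z (pt x y)).
Proof.
intros H. assert (T := Cmod_minus_rev 1 (- (z * y_pow nu (- (1)) (pt x y)))).
rewrite Cmod_opp, Cmod_den_term, Cmod_1 in T. unfold den.
replace (1 + z * y_pow nu (- (1)) (pt x y))%C with (1 - - (z * y_pow nu (- (1)) (pt x y)))%C by ring. lra.
Qed.

Lemma den_ge_large (nu x y t : R) (z : C) : t <= ratio nu z x -> t - 1 <= Cmod (den nu z (pt x y)).
Proof.
intros H. assert (T := Cmod_minus_rev (z * y_pow nu (- (1)) (pt x y)) (- (1))).
rewrite Cmod_opp, Cmod_den_term, Cmod_1 in T. unfold den.
replace (1 + z * y_pow nu (- (1)) (pt x y))%C with (z * y_pow nu (- (1)) (pt x y) - - (1))%C by ring. lra.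
Qed.

Lemma y_pow_shift (nu a x y : R) :
  y_pow nu a (pt x (y + V)) = (y_pow nu a (pt x y) * Cexp (0, a * (2 * PI))%R)%C.
Proof.
unfold y_pow. rewrite <- Cexp_plus. f_equal. rewrite !log_y_pt.
replace (sigma * (y + V)) with (sigma * y + 2 * PI) by (rewrite <- sigma_period; ring).
unfold pt, RtoC, Cmult, Cplus; simpl. f_equal; ring.
Qed.

Lemma Cexp_2PI (k : R) : k = 1 \/ k = - (1) -> Cexp (0, k * (2 * PI))%R = 1.
Proof.
intros Hk. unfold Cexp; simpl. rewrite exp_0.
destruct Hk as [->| ->].
- replace (1 * (2 * PI)) with (2 * PI) by ring. rewrite cos_2PI, sin_2PI. unfold RtoC. f_equal; ring.
- replace (- (1) * (2 * PI)) with (- (2 * PI)) by ring. rewrite cos_neg, sin_neg, cos_2PI, sin_2PI.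
  unfold RtoC. f_equal; ring.
Qed.

Lemma den_shift (nu x y : R) (z : C) : den nu z (pt x (y + V)) = den nu z (pt x y).
Proof. unfold den. rewrite y_pow_shift, Cexp_2PI by tauto. ring. Qed.

Lemma weight_shift (c1 c0 x y : R) :
  weight c1 c0 (pt x (y + V)) = (weight c1 c0 (pt x y) + RtoC (2 * PI * c1) * Ci)%C.
Proof.
unfold weight. replace (2 * PI * c1) with (c1 * (sigma * V)) by (rewrite sigma_period; ring).
unfold pt, RtoC, Ci, Cmult, Cplus; simpl. f_equal; ring.
Qed.

(** On these three lines [y] is positive, and the sector avoids the negative real axis. *)
Lemma den_ge_gap (nu x y : R) (z : C) : sector beta z -> y = 0 \/ y = V \/ y = - V ->
  sector_gap beta <= Cmod (den nu z (pt x y)).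
Proof.
intros Hz Hy.
assert (E : den nu z (pt x y) = den nu z (pt x 0)).
{ destruct Hy as [->|[->| ->]]; [reflexivity| |].
  - rewrite <- (den_shift nu x 0). f_equal. f_equal. ring.
  - rewrite <- (den_shift nu x (- V)). f_equal. f_equal. ring. }
rewrite E. unfold den.
set (t := exp (sigma * (x - nu) + ln A)). assert (Ht : 0 < t) by apply exp_pos.
assert (E2 : y_pow nu (- (1)) (pt x 0) = RtoC (/ t)).
{ unfold y_pow. rewrite log_y_pt. unfold t. rewrite <- exp_Ropp, <- Cexp_RtoC. f_equal.
  unfold pt, RtoC, Cmult; simpl. f_equal; ring. }
rewrite E2.
assert (Ht0 : RtoC t <> 0) by (intros E0; apply RtoC_inj in E0; lra).
replace (1 + z * RtoC (/ t))%C with ((RtoC t + z) / RtoC t)%C.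
2:{ rewrite RtoC_inv by lra. field. exact Ht0. }
rewrite Cmod_div by exact Ht0. rewrite Cmod_R, Rabs_pos_eq by lra.
assert (T := gap_sector beta t z Hbeta (Rlt_le _ _ Ht) Hz).
assert (G := sector_gap_bounds beta Hbeta). assert (T2 := Cmod_ge_0 z).
apply Rle_div_r; [lra|]. nra.
Qed.

(** The solutions of [y = - z] nearest to the real axis, for [z = exp (lam + i phi)] and
    [e = 1] or [e = -1]. *)
Definition zpole (nu lam phi e : R) : C := pt (nu + (lam - ln A) / sigma) ((phi + e * PI) / sigma).

Lemma log_y_zpole (nu lam phi e : R) : log_y nu (zpole nu lam phi e) = pt lam (phi + e * PI).
Proof. unfold zpole. rewrite log_y_pt. unfold pt. f_equal; field; lra. Qed.

Lemma Cexp_PI (e : R) : e = 1 \/ e = - (1) -> Cexp (0, e * PI)%R = (- (1))%C.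
Proof.
intros He. unfold Cexp; simpl. rewrite exp_0.
destruct He as [->| ->].
- replace (1 * PI) with PI by ring. rewrite cos_PI, sin_PI. unfold RtoC, Copp; simpl. f_equal; ring.
- replace (- (1) * PI) with (- PI) by ring. rewrite cos_neg, sin_neg, cos_PI, sin_PI.
  unfold RtoC, Copp; simpl. f_equal; ring.
Qed.

Lemma den_zero_unique (nu lam phi e x y : R) : e = 1 \/ e = - (1) ->
  Rabs (phi + e * PI - sigma * y) < 2 * PI ->
  den nu (Cexp (lam, phi)) (pt x y) = 0 -> pt x y = zpole nu lam phi e.
Proof.
intros He Hy H.
assert (E : Cexp ((lam, phi) + RtoC (- (1)) * log_y nu (pt x y) + (0, e * PI)%R) = 1).
{ rewrite !Cexp_plus, Cexp_PI by exact He. fold (y_pow nu (- (1)) (pt x y)).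
  replace (Cexp (lam, phi) * y_pow nu (- (1)) (pt x y))%C with (den nu (Cexp (lam, phi)) (pt x y) - 1)%C
    by (unfold den; ring).
  rewrite H. ring. }
replace ((lam, phi) + RtoC (- (1)) * log_y nu (pt x y) + (0, e * PI)%R)%C
  with (pt (lam - (sigma * (x - nu) + ln A)) (phi + e * PI - sigma * y)) in E.
2:{ rewrite log_y_pt. unfold pt, RtoC, Cmult, Cplus; simpl. f_equal; ring. }
apply Cexp_eq_1 in E; [|exact Hy]. injection E as E1 E2.
unfold zpole, pt. f_equal; apply (Rmult_eq_reg_l sigma); try lra; field_simplify; lra.
Qed.

Lemma den_zpole (nu lam phi e : R) : e = 1 \/ e = - (1) ->
  den nu (Cexp (lam, phi)) (zpole nu lam phi e) = 0.
Proof.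
intros He. unfold den, y_pow. rewrite log_y_zpole, <- Cexp_plus.
assert (He' : - e = 1 \/ - e = - (1)) by lra.
replace ((lam, phi) + RtoC (- (1)) * pt lam (phi + e * PI))%C with ((0, - e * PI) : C).
- rewrite Cexp_PI by exact He'. ring.
- unfold pt, RtoC, Cmult, Cplus; simpl. f_equal; ring.
Qed.

Lemma is_Cderive_den (nu : R) (z s : C) :
  is_Cderive (den nu z) s (- RtoC sigma * (den nu z s - 1))%C.
Proof.
assert (H := is_Cderive_Cexp_lin (RtoC (- sigma)) 0 s).
set (k := Cexp (RtoC (- (1)) * (RtoC (ln A) - RtoC sigma * RtoC nu))).
assert (E : forall t, den nu z t = (1 + z * k * Cexp (RtoC (- sigma) * t))%C).
{ intros t. unfold den, y_pow, k. rewrite <- Cmult_assoc, <- Cexp_plus. do 3 f_equal.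
  unfold log_y. rewrite (RtoC_opp sigma), (RtoC_opp 1). ring. }
apply is_derive_C_iff. intros eps Heps.
assert (Hk : 0 < Cmod (z * k) + 1) by (generalize (Cmod_ge_0 (z * k)); lra).
destruct (proj1 (is_derive_C_iff _ _ _) H (eps / (Cmod (z * k) + 1))) as [d [Hd H1]]; [now apply Rdiv_lt_0_compat|].
exists d. split; [exact Hd|]. intros w Hw. specialize (H1 w Hw). rewrite !E.
match type of H1 with Cmod ?v <= _ => set (D := v) in * end.
match goal with |- Cmod ?u <= _ => replace u with (z * k * D)%C end.
2:{ unfold D. rewrite (RtoC_opp sigma). ring. }
rewrite Cmod_mult. assert (T := Cmod_ge_0 D). assert (T2 := Cmod_ge_0 (z * k)).
apply Rle_trans with ((Cmod (z * k) + 1) * (eps / (Cmod (z * k) + 1) * Cmod (w - s))).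
- apply Rmult_le_compat; lra.
- right. field. lra.
Qed.

Lemma is_Cderive_den_zpole (nu lam phi e : R) : e = 1 \/ e = - (1) ->
  is_Cderive (den nu (Cexp (lam, phi))) (zpole nu lam phi e) (RtoC sigma).
Proof.
intros He. assert (H := is_Cderive_den nu (Cexp (lam, phi)) (zpole nu lam phi e)).
rewrite den_zpole in H by exact He.
replace (- RtoC sigma * (0 - 1))%C with (RtoC sigma) in H by ring. exact H.
Qed.

(** Where the zeros of the denominator lie relative to the strip [a <= Re s <= b], together with
    the resulting contribution [r e g] of the zero of index [e] to contour integrals of
    [g / den]. *)
Definition residues (nu a b : R) (z : C) (r : R -> (C -> C) -> C) : Prop :=
  (ratio nu z a < 1 /\ forall e g, r e g = 0) \/
  (exists lam phi, z = Cexp (lam, phi) /\ - Phi <= phi <= Phi /\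
     a < nu + (lam - ln A) / sigma < b /\
     forall e g, r e g = (Ci * RtoC (2 * PI) * (g (zpole nu lam phi e) / RtoC sigma))%C).

Lemma rect_residues (nu a b c d e : R) (z : C) (r : R -> (C -> C) -> C) (g : C -> C) :
  a <= b -> c <= d -> e = 1 \/ e = - (1) ->
  residues nu a b z r ->
  (forall phi, - Phi <= phi <= Phi -> sigma * c < phi + e * PI < sigma * d /\
     phi + e * PI - sigma * d > - (2 * PI) /\ phi + e * PI - sigma * c < 2 * PI) ->
  diff_on_rect g a b c d ->
  rect (fun s => g s / den nu z s)%C a b c d = r e g.
Proof.
intros Hab Hcd He [[Hsm Hr]|[lam [phi [-> [Hphi [Hx Hr]]]]]] Hh Hg; rewrite Hr.
- apply rect_Cauchy; try assumption. intros x y Hx Hy.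
  apply Cdiff_div; [now apply Hg|apply Cdiff_den|].
  apply Cmod_gt_0.
  assert (T := den_ge_small nu x y (ratio nu z a) z (ratio_decr nu a x z (proj1 Hx))). lra.
- destruct (Hh phi Hphi) as [H1 [H2 H3]].
  assert (Hc : c < (phi + e * PI) / sigma < d).
  { split; [apply Rlt_div_r|apply Rlt_div_l]; lra. }
  apply (rect_residue _ _ a b c d (nu + (lam - ln A) / sigma) ((phi + e * PI) / sigma)); try assumption.
  + intros x y Hxx Hyy Hn. apply Cdiff_div; [now apply Hg|apply Cdiff_den|].
    intros H0. apply Hn. apply (den_zero_unique nu lam phi e x y He); [|exact H0].
    apply Rabs_def1; nra.
  + apply (quotient_simple_pole g (den nu (Cexp (lam, phi))) (zpole nu lam phi e) (RtoC sigma)).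
    * apply Hg; lra.
    * now apply is_Cderive_den_zpole.
    * now apply den_zpole.
    * apply sigma_neq_0.
Qed.

(** The lowest zeros have height [(PI - Phi) / sigma], at least twice [low_height]. *)
Lemma den_neq_0_low (nu a b x y : R) (z : C) (r : R -> (C -> C) -> C) :
  residues nu a b z r -> a <= x -> - v1 <= y <= v1 -> den nu z (pt x y) <> 0.
Proof.
intros Hres Hx Hy. destruct Hres as [[Hsm _]|[lam [phi [-> [Hphi _]]]]].
- apply Cmod_gt_0. assert (T := den_ge_small nu x y (ratio nu z a) z (ratio_decr nu a x z Hx)). lra.
- intros H0. destruct low_height_bounds as [[B1 B2] B3]. assert (P := Phi_bounds).
  assert (Hs : - (sigma * v1) <= sigma * y <= sigma * v1) by nra.
  apply (den_zero_unique nu lam phi 1 x y) in H0; [|tauto|apply Rabs_def1; lra].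
  injection H0 as _ E. assert (E2 : sigma * y = phi + 1 * PI) by (rewrite E; field; lra). lra.
Qed.

(** * The quadrature identity *)

Definition integrand (nu c1 c0 : R) (z s : C) : C := (num nu c1 c0 s / den nu z s)%C.
Definition kintegrand (nu c1 c0 : R) (z : C) (e : R) (s : C) : C :=
  (num nu c1 c0 s * ker e s / den nu z s)%C.
Definition qterm (nu c1 c0 : R) (z : C) (j : nat) : C :=
  (integrand nu c1 c0 z (RtoC (sqrt (INR j))) / RtoC (2 * sqrt (INR j)))%C.

(** Between two consecutive half nodes [x^2] stays within [1 / 2] of the integer [j + 1]. *)
Lemma ker_pole_on_axis (x : R) (j : nat) : half_node j <= x <= half_node (S j) ->
  Cexp (ker_exponent 1 (pt x 0)) = 1 -> x = sqrt (INR (S j)).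
Proof.
intros Hx H. rewrite ker_exponent_pt in H.
assert (E1 := half_node_sqr j). assert (E2 := half_node_sqr (S j)). rewrite S_INR in E2.
assert (H0 := half_node_pos j). assert (P := PI_RGT_0).
assert (E : 2 * PI * (x * x - INR (S j)) = 0).
{ apply cos_eq_1.
  - assert (B1 : half_node j * half_node j <= x * x) by (apply Rmult_le_compat; lra).
    assert (B2 : x * x <= half_node (S j) * half_node (S j)) by (apply Rmult_le_compat; lra).
    rewrite S_INR. apply Rabs_def1; nra.
  - unfold Cexp in H; simpl in H. injection H as Hc _.
    replace (4 * PI * 1 * x * 0) with 0 in Hc by ring. rewrite exp_0, Rmult_1_l in Hc.
    rewrite <- Hc. rewrite <- (cos_period _ (S j)), <- cos_neg. f_equal. rewrite S_INR. simpl. ring. }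
apply Rmult_integral in E. destruct E as [E|E]; [lra|].
replace (INR (S j)) with (x * x) by lra. rewrite sqrt_square; lra.
Qed.

Lemma low_ker_neq_1 (x y : R) (j : nat) : half_node j <= x <= half_node (S j) -> - v1 <= y <= v1 ->
  pt x y <> pt (sqrt (INR (S j))) 0 -> Cexp (ker_exponent 1 (pt x y)) <> 1.
Proof.
intros Hx Hy Hn. assert (H0 := half_node_pos j).
destruct (Req_dec y 0) as [->|N].
- intros E. apply Hn. now rewrite (ker_pole_on_axis x j Hx E).
- apply ker_neq_1_off_axis. rewrite Rmult_1_l. apply Rmult_integral_contrapositive. split; lra.
Qed.

(** At [s = sqrt j] the exponential [exp (- 2 PI i s^2)] has derivative [- 4 PI i sqrt j], so the
    residue of the kernel times [2 PI i] is [- 1 / (2 sqrt j)]. *)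
Lemma low_column (nu c1 c0 a b : R) (z : C) (r : R -> (C -> C) -> C) (j : nat) :
  residues nu a b z r -> a <= half_node j ->
  rect (kintegrand nu c1 c0 z 1) (half_node j) (half_node (S j)) (- v1) v1 = (- qterm nu c1 c0 z (S j))%C.
Proof.
intros Hres Ha. assert (Hn := node_between j). assert (H0 := half_node_pos j).
destruct low_height_bounds as [[B1 B2] B3].
set (p := sqrt (INR (S j))) in *.
assert (Hp0 : RtoC p <> 0) by (intros E; apply RtoC_inj in E; lra).
set (q := fun s => (num nu c1 c0 s / den nu z s)%C).
assert (Hden : forall x y, half_node j <= x -> - v1 <= y <= v1 -> den nu z (pt x y) <> 0).
{ intros x y Hx Hy. apply (den_neq_0_low nu a b x y z r Hres); [lra|exact Hy]. }
assert (HP : RtoC PI <> 0) by (intros E; apply RtoC_inj in E; assert (T := PI_RGT_0); lra).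
assert (HCi : Ci <> 0) by (intros [= E1]; lra).
assert (H2 : RtoC 2 <> 0) by (intros E; apply RtoC_inj in E; lra).
set (D' := (RtoC (- (1 * (2 * PI))) * Ci * (RtoC 2 * pt p 0))%C).
assert (HD' : D' = (- (RtoC 2 * RtoC PI * Ci * (RtoC 2 * RtoC p)))%C).
{ unfold D'. change (pt p 0) with (RtoC p). rewrite RtoC_opp, !RtoC_mult. ring. }
assert (Hexp : Cexp (ker_exponent 1 (pt p 0)) = 1).
{ rewrite ker_exponent_pt. unfold pt, Cexp; simpl.
  replace (4 * PI * 1 * p * 0) with 0 by ring. rewrite exp_0.
  replace (- (1 * (2 * PI)) * (p * p - 0 * 0)) with (- (0 + 2 * INR (S j) * PI)).
  2:{ unfold p. rewrite Rmult_0_l, Rminus_0_r, node_sqr. ring. }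
  rewrite cos_neg, sin_neg, cos_period, sin_period, cos_0, sin_0. unfold RtoC. f_equal; ring. }
rewrite (rect_residue (kintegrand nu c1 c0 z 1) (q (pt p 0) / D')%C _ _ (- v1) v1 p 0); try lra.
- unfold qterm. fold p. unfold q, integrand. change (pt p 0) with (RtoC p). rewrite HD', !RtoC_mult.
  assert (Hd := Hden p 0 ltac:(lra) ltac:(lra)). change (pt p 0) with (RtoC p) in Hd.
  field. repeat split; assumption.
- intros x y Hx Hy Hne. apply Cdiff_div; [|apply Cdiff_den|apply Hden; lra].
  apply Cdiff_mult; [apply Cdiff_num|]. apply Cdiff_ker. now apply (low_ker_neq_1 x y j).
- intros eps Heps.
  destruct (quotient_simple_pole q (fun s => Cexp (ker_exponent 1 s) - 1)%C (pt p 0) D') with (eps := eps)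
    as [dl [Hdl HH]]; try assumption.
  + apply Cdiff_div; [apply Cdiff_num|apply Cdiff_den|apply Hden; lra].
  + assert (T := is_Cderive_Cexp_comp (ker_exponent 1) 1 (pt p 0) _ (is_Cderive_ker_exponent 1 (pt p 0))).
    rewrite Hexp, Cmult_1_r in T. exact T.
  + rewrite Hexp. ring.
  + rewrite HD'. intros E.
    assert (N : (RtoC 2 * RtoC PI * Ci * (RtoC 2 * RtoC p))%C <> 0) by (repeat apply Cmult_neq_0; assumption).
    apply N. apply (f_equal Copp) in E. rewrite Copp_0 in E. rewrite <- E. ring.
  + exists dl. split; [exact Hdl|]. intros s Hs Hsd. specialize (HH s Hs Hsd).
    eapply Rle_trans; [|exact HH]. right. f_equal. f_equal. f_equal.
    unfold kintegrand, q, ker, Cdiv. ring.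
Qed.

Lemma Cdiff_kintegrand_upper (nu c1 c0 e x y : R) (z : C) : e * x * y <> 0 ->
  den nu z (pt x y) <> 0 -> Cdiff (kintegrand nu c1 c0 z e) (pt x y).
Proof.
intros He Hd. apply Cdiff_div; [|apply Cdiff_den|exact Hd].
apply Cdiff_mult; [apply Cdiff_num|]. apply Cdiff_ker. now apply ker_neq_1_off_axis.
Qed.

Lemma Cdiff_kintegrand_half (nu c1 c0 e y : R) (z : C) (j : nat) : e = 1 \/ e = - (1) ->
  - v1 <= y <= v1 -> den nu z (pt (half_node j) y) <> 0 ->
  Cdiff (kintegrand nu c1 c0 z e) (pt (half_node j) y).
Proof.
intros He Hy Hd. apply Cdiff_div; [|apply Cdiff_den|exact Hd].
destruct low_height_bounds as [[B1 B2] B3].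
apply Cdiff_mult; [apply Cdiff_num|]. apply Cdiff_ker. apply (ker_half e _ y j He).
- apply half_node_sqr.
- lra.
Qed.

Lemma low_strip (nu c1 c0 b : R) (z : C) (r : R -> (C -> C) -> C) (i m : nat) :
  residues nu (half_node i) b z r ->
  rect (kintegrand nu c1 c0 z 1) (half_node i) (half_node (i + m)) (- v1) v1 =
  (- sum_n_m (qterm nu c1 c0 z) (S i) (i + m))%C.
Proof.
intros Hres. destruct low_height_bounds as [[B1 B2] B3].
assert (Hd : forall x y, half_node i <= x -> - v1 <= y <= v1 -> den nu z (pt x y) <> 0).
{ intros x y Hx Hy. now apply (den_neq_0_low nu (half_node i) b x y z r). }
induction m as [|m IH].
- rewrite Nat.add_0_r, sum_n_m_zero by lia. change (rect (kintegrand nu c1 c0 z 1) (half_node i) (half_node i) (- v1) v1 = - 0)%C.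
  rewrite Copp_0. apply rect_Cauchy; try lra. intros x y Hx Hy.
  replace x with (half_node i) by lra. apply Cdiff_kintegrand_half; [tauto|exact Hy|apply Hd; lra].
- rewrite Nat.add_succ_r.
  assert (L1 : half_node i <= half_node (i + m)) by (apply half_node_le; lia).
  assert (L2 : half_node (i + m) < half_node (S (i + m))) by (apply half_node_lt; lia).
  assert (Hdf : forall y, y = - v1 \/ y = v1 -> forall x, half_node i <= x <= half_node (S (i + m)) ->
     Cdiff (kintegrand nu c1 c0 z 1) (pt x y)).
  { intros y Hy x Hx. assert (T := half_node_pos i). apply Cdiff_kintegrand_upper; [|apply Hd; lra].
    rewrite Rmult_1_l. apply Rmult_integral_contrapositive. lra. }
  rewrite (rect_split_h _ (half_node i) (half_node (i + m)) (half_node (S (i + m)))); try lra.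
  + rewrite IH, (low_column nu c1 c0 (half_node i) b z r (i + m) Hres L1), sum_n_Sm by lia.
    change plus with Cplus. ring.
  + apply Hdf. tauto.
  + apply Hdf. tauto.
Qed.

(** The contribution of a vertical line to the quadrature identity; the sign of the last term comes
    from the relation [ker 1 + ker (-1) = -1]. *)
Definition edge (nu c1 c0 : R) (z : C) (x : R) : C :=
  (vseg (kintegrand nu c1 c0 z 1) x (- v1) v1 + vseg (kintegrand nu c1 c0 z 1) x v1 V
   - vseg (kintegrand nu c1 c0 z (- (1))%R) x (- V) (- v1))%C.

Lemma heights : 0 < v1 < V /\ 0 < sigma * v1 <= (PI - Phi) / 2 /\ sigma * V = 2 * PI.
Proof.
destruct low_height_bounds as [[B1 B2] B3]. assert (P := Phi_bounds). assert (E := sigma_period).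
repeat split; try assumption.
- apply (Rmult_lt_reg_l sigma); lra.
- now apply Rmult_lt_0_compat.
Qed.

(** The kernel [ker 1] is integrated around the nodes and then over the upper strip.  On the lower
    side of the strip around the axis it is [- 1 - ker (-1)]: the first part yields the integral, and
    the second part is moved down. *)
Lemma quadrature_identity (nu c1 c0 : R) (z : C) (r : R -> (C -> C) -> C) (i J : nat) :
  (i < J)%nat -> residues nu (half_node i) (half_node J) z r ->
  (forall x, den nu z (pt x V) <> 0 /\ den nu z (pt x (- V)) <> 0) ->
  (forall y, den nu z (pt (half_node i) y) <> 0) -> (forall y, den nu z (pt (half_node J) y) <> 0) ->
  sum_n_m (qterm nu c1 c0 z) (S i) J =
  (hseg (integrand nu c1 c0 z) (half_node i) (half_node J) (- v1)
   + (r 1 (fun s => num nu c1 c0 s * ker 1 s) - r (- (1))%R (fun s => num nu c1 c0 s * ker (- (1))%R s))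
   + (hseg (kintegrand nu c1 c0 z 1) (half_node i) (half_node J) V
      + hseg (kintegrand nu c1 c0 z (- (1))%R) (half_node i) (half_node J) (- V))
   + edge nu c1 c0 z (half_node i) - edge nu c1 c0 z (half_node J))%C.
Proof.
intros HiJ Hres HV Hl Hr.
destruct heights as [Hv [Hs1 HsV]]. assert (P := Phi_bounds).
assert (Hab := half_node_lt i J HiJ). assert (H0 := half_node_pos i).
set (a := half_node i) in *. set (b := half_node J) in *.
assert (E1 := low_strip nu c1 c0 b z r i (J - i) Hres).
replace (i + (J - i))%nat with J in E1 by lia. fold a b in E1.
assert (E2 : rect (kintegrand nu c1 c0 z 1) a b v1 V = r 1 (fun s => num nu c1 c0 s * ker 1 s)%C).
{ apply (rect_residues nu a b v1 V 1 z r (fun s => num nu c1 c0 s * ker 1 s)%C); try lra; [exact Hres|intros; lra|].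
  intros x y Hx Hy. apply Cdiff_mult; [apply Cdiff_num|]. apply Cdiff_ker, ker_neq_1_off_axis.
  rewrite Rmult_1_l. apply Rmult_integral_contrapositive. lra. }
assert (E3 : rect (kintegrand nu c1 c0 z (- (1))%R) a b (- V) (- v1) = r (- (1))%R (fun s => num nu c1 c0 s * ker (- (1))%R s)%C).
{ apply (rect_residues nu a b (- V) (- v1) (- (1))%R z r (fun s => num nu c1 c0 s * ker (- (1))%R s)%C); try lra; [exact Hres|intros; lra|].
  intros x y Hx Hy. apply Cdiff_mult; [apply Cdiff_num|]. apply Cdiff_ker, ker_neq_1_off_axis.
  nra. }
assert (E4 : (hseg (kintegrand nu c1 c0 z 1) a b (- v1) + hseg (kintegrand nu c1 c0 z (- (1))%R) a b (- v1)
   = - hseg (integrand nu c1 c0 z) a b (- v1))%C).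
{ assert (Hd : forall x, a <= x -> den nu z (pt x (- v1)) <> 0).
  { intros x Hx. apply (den_neq_0_low nu a b x (- v1) z r Hres Hx). lra. }
  assert (X1 : ex_CIntegral (fun x => kintegrand nu c1 c0 z 1 (pt x (- v1))) a b).
  { apply ex_hseg; [lra|]. intros x Hx. apply Cdiff_kintegrand_upper; [nra|apply Hd; lra]. }
  assert (X2 : ex_CIntegral (fun x => kintegrand nu c1 c0 z (- (1))%R (pt x (- v1))) a b).
  { apply ex_hseg; [lra|]. intros x Hx. apply Cdiff_kintegrand_upper; [nra|apply Hd; lra]. }
  assert (X3 : ex_CIntegral (fun x => integrand nu c1 c0 z (pt x (- v1))) a b).
  { apply ex_hseg; [lra|]. intros x Hx. apply Cdiff_div; [apply Cdiff_num|apply Cdiff_den|apply Hd; lra]. }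
  unfold hseg. rewrite <- (CInt_plus _ _ a b X1 X2).
  replace (- CInt (fun x : R => integrand nu c1 c0 z (pt x (- v1))) a b)%C
    with (RtoC (- (1)) * CInt (fun x : R => integrand nu c1 c0 z (pt x (- v1))) a b)%C by (rewrite RtoC_opp; ring).
  rewrite <- (CInt_scal _ _ a b X3). apply CInt_ext; [lra|]. intros x Hx.
  unfold kintegrand, integrand.
  rewrite <- (ker_sum (pt x (- v1))); [unfold Cdiv; ring|]. apply ker_neq_1_off_axis. nra. }
unfold edge. unfold rect in E1, E2, E3.
assert (ES : exists S : C, sum_n_m (qterm nu c1 c0 z) (Datatypes.S i) J = S) by now eexists.
destruct ES as [S ES]. rewrite ES in *.
match type of E4 with (?p + ?q)%C = (- ?u)%C => set (h1 := p) in *; set (h2 := q) in *; set (I0 := u) in * end.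
rewrite <- E2, <- E3.
match goal with |- ?l = ?r => change (@eq C l r) end.
transitivity (- - S)%C; [ring|]. rewrite <- E1.
replace h1 with (- I0 - h2)%C by (rewrite <- E4; ring). ring.
Qed.

Lemma integrand_shift (nu c1 c0 x y : R) (z : C) : den nu z (pt x y) <> 0 ->
  integrand nu c1 c0 z (pt x (y + V)) =
  (Cexp (0, alpha * (2 * PI))%R * (integrand nu c1 c0 z (pt x y) +
     RtoC (2 * PI * c1) * Ci * integrand nu 0 1 z (pt x y)))%C.
Proof.
intros Hd. unfold integrand, num. rewrite den_shift, weight_shift, y_pow_shift.
replace (weight 0 1 (pt x y)) with (RtoC 1) by (unfold weight; ring). field. exact Hd.
Qed.

(** The two horizontal sides are one period apart, so both are expressed by the integral over the
    lower one; a weight that is not constant adds a multiple of the integral without weight. *)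
Lemma period_identity (nu c1 c0 : R) (z : C) (r : R -> (C -> C) -> C) (i J : nat) :
  (i < J)%nat -> residues nu (half_node i) (half_node J) z r ->
  (forall y, den nu z (pt (half_node i) y) <> 0) -> (forall y, den nu z (pt (half_node J) y) <> 0) ->
  let I0 c1 c0 := hseg (integrand nu c1 c0 z) (half_node i) (half_node J) (- v1) in
  let q := Cexp (0, alpha * (2 * PI))%R in
  ((1 - q) * I0 c1 c0 - q * (RtoC (2 * PI * c1) * Ci) * I0 0 1)%C =
  (r 1 (num nu c1 c0) + vseg (integrand nu c1 c0 z) (half_node i) (- v1) (- v1 + V)
   - vseg (integrand nu c1 c0 z) (half_node J) (- v1) (- v1 + V))%C.
Proof.
intros HiJ Hres Hl Hr I0 q.
destruct heights as [Hv [Hs1 HsV]]. assert (P := Phi_bounds).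
assert (Hab := half_node_lt i J HiJ).
set (a := half_node i) in *. set (b := half_node J) in *.
assert (E : rect (integrand nu c1 c0 z) a b (- v1) (- v1 + V) = r 1 (num nu c1 c0)).
{ apply (rect_residues nu a b (- v1) (- v1 + V) 1 z r (num nu c1 c0)); try lra; [exact Hres|intros; lra|].
  intros x y _ _. apply Cdiff_num. }
assert (Hd : forall x, a <= x -> den nu z (pt x (- v1)) <> 0).
{ intros x Hx. apply (den_neq_0_low nu a b x (- v1) z r Hres Hx). lra. }
assert (X : forall k1 k0, ex_CIntegral (fun x => integrand nu k1 k0 z (pt x (- v1))) a b).
{ intros k1 k0. apply ex_hseg; [lra|]. intros x Hx. apply Cdiff_div; [apply Cdiff_num|apply Cdiff_den|apply Hd; lra]. }
assert (E2 : hseg (integrand nu c1 c0 z) a b (- v1 + V) =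
   (q * (I0 c1 c0 + RtoC (2 * PI * c1) * Ci * I0 0 1))%C).
{ unfold I0, hseg. rewrite <- (CInt_scal (RtoC (2 * PI * c1) * Ci) _ a b (X 0 1)).
  rewrite <- (CInt_plus _ _ a b (X c1 c0) (ex_CInt_scal _ _ a b (X 0 1))).
  rewrite <- (CInt_scal q _ a b).
  - apply CInt_ext; [lra|]. intros x Hx. apply integrand_shift. apply Hd. lra.
  - apply ex_CInt_plus; [apply X|apply ex_CInt_scal, X]. }
rewrite <- E. unfold rect. rewrite E2. fold (I0 c1 c0). ring.
Qed.

(** * Error estimates *)

Hypothesis (Halpha : 0 < alpha).

(** The least height of a zero of the denominator. *)
Let v0 := (PI - Phi) / sigma.

(** Up to constant factors, the size of [y^alpha] times that of the kernel at the real part [x]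
    and the height of the lowest possible zero of the denominator. *)
Definition decay (nu x : R) : R := exp (- (sigma * alpha * nu) + (sigma * alpha - 4 * PI * v0) * x).

Definition wbound (nu c1 c0 xmax W : R) : Prop :=
  forall x y, half_node 0 <= x <= xmax -> - V <= y <= V -> Cmod (weight c1 c0 (pt x y)) * decay nu x <= W.

Definition A_pow : R := exp (alpha * ln A).
Definition ker_const : R := / (1 - exp (- (2 * PI * v1))).
(** The two candidate left edges are more than [1 / 2] apart, and [|z / y|] decreases by the factor
    [exp (- sigma / 2)] over that distance; so for each [z] it is outside of [(sep, 1 / sep)] on one
    of them. *)
Definition sep : R := exp (- (sigma / 4)).

Lemma lowest_zero_height_bounds : v1 <= v0 < V.
Proof.
destruct heights as [Hv [Hs1 HsV]]. assert (P := Phi_bounds).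
assert (E : sigma * v0 = PI - Phi) by (unfold v0; field; lra).
split; [apply (Rmult_le_reg_l sigma)|apply (Rmult_lt_reg_l sigma)]; lra.
Qed.

Lemma A_pow_pos : 0 < A_pow.
Proof. apply exp_pos. Qed.

Lemma ker_const_ge_1 : 1 <= ker_const.
Proof.
destruct heights as [Hv _]. assert (P := PI_RGT_0).
assert (H : exp (- (2 * PI * v1)) < 1) by (rewrite <- exp_0; apply exp_increasing; nra).
assert (H2 := exp_pos (- (2 * PI * v1))).
unfold ker_const. apply Rle_trans with (/ 1); [lra|]. apply Rinv_le_contravar; lra.
Qed.

Lemma sep_bounds : 0 < sep < 1.
Proof. split; [apply exp_pos|]. unfold sep. rewrite <- exp_0. apply exp_increasing. lra. Qed.

Lemma exp_le (x y : R) : x <= y -> exp x <= exp y.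
Proof. intros [H| ->]; [left; now apply exp_increasing|lra]. Qed.

Lemma Cmod_y_pow_decay (nu x y : R) :
  Cmod (y_pow nu alpha (pt x y)) = A_pow * exp (4 * PI * v0 * x) * decay nu x.
Proof.
rewrite Cmod_y_pow. unfold A_pow, decay. rewrite <- !exp_plus. f_equal. ring.
Qed.

Lemma num_le (nu c1 c0 xmax W x y : R) : wbound nu c1 c0 xmax W ->
  half_node 0 <= x <= xmax -> - V <= y <= V ->
  Cmod (num nu c1 c0 (pt x y)) <= A_pow * exp (4 * PI * v0 * x) * W.
Proof.
intros HW Hx Hy. unfold num. rewrite Cmod_mult, Cmod_y_pow_decay.
specialize (HW x y Hx Hy).
replace (Cmod (weight c1 c0 (pt x y)) * (A_pow * exp (4 * PI * v0 * x) * decay nu x))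
  with (A_pow * exp (4 * PI * v0 * x) * (Cmod (weight c1 c0 (pt x y)) * decay nu x)) by ring.
apply Rmult_le_compat_l; [|exact HW].
apply Rmult_le_pos; [left; apply A_pow_pos|left; apply exp_pos].
Qed.

Lemma ker_le (e x y h : R) : 1 / 2 <= x -> v1 <= h <= e * y ->
  Cmod (ker e (pt x y)) <= ker_const * exp (- (4 * PI * x * h)).
Proof.
intros Hx Hy. destruct heights as [Hv _]. assert (P := PI_RGT_0).
assert (T1 : 1 / 2 * v1 <= x * h) by (apply Rmult_le_compat; lra).
assert (T2 : x * h <= x * (e * y)) by (apply Rmult_le_compat_l; lra).
destruct (ker_decay e x y (2 * PI * v1)) as [_ H]; [nra| |].
- replace (4 * PI * e * x * y) with (4 * PI * (x * (e * y))) by ring. nra.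
- eapply Rle_trans; [exact H|]. apply Rmult_le_compat_l; [assert (T := ker_const_ge_1); unfold ker_const in *; lra|].
  apply exp_le. replace (4 * PI * e * x * y) with (4 * PI * (x * (e * y))) by ring. nra.
Qed.

Lemma ker_edge_le (e y : R) (j : nat) : e = 1 \/ e = - (1) -> - v1 <= e * y ->
  Cmod (ker e (pt (half_node j) y)) <= ker_const.
Proof.
intros He Hy. assert (HK := ker_const_ge_1). destruct low_height_bounds as [[B1 B2] _]. assert (P := PI_RGT_0).
assert (Hx := half_node_pos j).
destruct (Rle_dec v1 (e * y)) as [L|L].
- eapply Rle_trans; [apply (ker_le e (half_node j) y v1); lra|].
  rewrite <- (Rmult_1_r ker_const) at 2. apply Rmult_le_compat_l; [lra|]. rewrite <- exp_0. apply exp_le.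
  assert (0 <= half_node j * v1) by (apply Rmult_le_pos; lra). nra.
- destruct (ker_half e (half_node j) y j He (half_node_sqr j)) as [_ T]; [|lra].
  destruct He as [-> | ->]; lra.
Qed.

Lemma vseg_le (f : C -> C) (x c d M : R) : c <= d ->
  (forall y, c <= y <= d -> Cdiff f (pt x y)) -> (forall y, c <= y <= d -> Cmod (f (pt x y)) <= M) ->
  Cmod (vseg f x c d) <= (d - c) * M.
Proof.
intros Hcd Hf HM. unfold vseg. rewrite Cmod_mult, Cmod_Ci, Rmult_1_l.
apply CInt_le; [exact Hcd|now apply ex_vseg|exact HM].
Qed.

Lemma Cmod_div_le (u v : C) (a b : R) : Cmod u <= a -> 0 < b -> b <= Cmod v -> Cmod (u / v) <= a / b.
Proof.
intros Hu Hb Hv. assert (v <> 0) by (apply Cmod_gt_0; lra).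
rewrite Cmod_div by assumption. unfold Rdiv. apply Rmult_le_compat; [apply Cmod_ge_0| |exact Hu|].
- left. apply Rinv_0_lt_compat. lra.
- apply Rinv_le_contravar; lra.
Qed.

Lemma Cdiff_kintegrand_edge (nu c1 c0 e y : R) (z : C) (j : nat) : e = 1 \/ e = - (1) ->
  - v1 <= e * y -> den nu z (pt (half_node j) y) <> 0 ->
  Cdiff (kintegrand nu c1 c0 z e) (pt (half_node j) y).
Proof.
intros He Hy Hd. assert (Hx := half_node_pos j). destruct heights as [Hv _].
destruct (Rle_dec v1 (e * y)) as [L|L].
- apply Cdiff_kintegrand_upper; [|exact Hd].
  replace (e * half_node j * y) with (half_node j * (e * y)) by ring.
  apply Rmult_integral_contrapositive. lra.
- apply Cdiff_kintegrand_half; [exact He| |exact Hd]. destruct He as [-> | ->]; lra.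
Qed.

Lemma Cmod_plus3 (u v w : C) : Cmod (u + v - w) <= Cmod u + Cmod v + Cmod w.
Proof.
unfold Cminus. eapply Rle_trans; [apply Cmod_triangle|]. rewrite Cmod_opp.
assert (T := Cmod_triangle u v). lra.
Qed.

Lemma edge_le (nu c1 c0 M t : R) (z : C) (j : nat) : 0 < t ->
  (forall y, t <= Cmod (den nu z (pt (half_node j) y))) ->
  (forall y, - V <= y <= V -> Cmod (num nu c1 c0 (pt (half_node j) y)) <= M) ->
  Cmod (edge nu c1 c0 z (half_node j)) <= 2 * V * (M * ker_const / t).
Proof.
intros Ht Hd HM. destruct heights as [Hv _]. assert (HK := ker_const_ge_1).
assert (Hd0 : forall y, den nu z (pt (half_node j) y) <> 0).
{ intros y. apply Cmod_gt_0. specialize (Hd y). lra. }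
assert (B : forall e y, e = 1 \/ e = - (1) -> - v1 <= e * y -> - V <= y <= V ->
   Cmod (kintegrand nu c1 c0 z e (pt (half_node j) y)) <= M * ker_const / t).
{ intros e y He Hy HyV. apply Cmod_div_le; [|exact Ht|apply Hd].
  rewrite Cmod_mult. apply Rmult_le_compat; try apply Cmod_ge_0; [now apply HM|now apply ker_edge_le]. }
unfold edge. eapply Rle_trans; [apply Cmod_plus3|].
assert (B1 : Cmod (vseg (kintegrand nu c1 c0 z 1) (half_node j) (- v1) v1) <= (v1 - - v1) * (M * ker_const / t)).
{ apply vseg_le; [lra| |]; intros y Hy; [apply Cdiff_kintegrand_edge|apply B]; try tauto; try lra. apply Hd0. }
assert (B2 : Cmod (vseg (kintegrand nu c1 c0 z 1) (half_node j) v1 V) <= (V - v1) * (M * ker_const / t)).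
{ apply vseg_le; [lra| |]; intros y Hy; [apply Cdiff_kintegrand_edge|apply B]; try tauto; try lra. apply Hd0. }
assert (B3 : Cmod (vseg (kintegrand nu c1 c0 z (- (1))) (half_node j) (- V) (- v1)) <= (- v1 - - V) * (M * ker_const / t)).
{ apply vseg_le; [lra| |]; intros y Hy; [apply Cdiff_kintegrand_edge|apply B]; try tauto; try lra. apply Hd0. }
lra.
Qed.

Lemma RInt_exp_decay (M k a b : R) : a <= b -> 0 <= a -> 0 < k -> 0 <= M ->
  ex_RInt (fun x => M * exp (- (k * x))) a b /\ RInt (fun x => M * exp (- (k * x))) a b <= M / k.
Proof.
intros Hab Ha Hk HM.
assert (H : is_RInt (fun x => M * exp (- (k * x))) a b (minus (- (M / k) * exp (- (k * b))) (- (M / k) * exp (- (k * a))))).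
{ apply (is_RInt_derive (fun x => - (M / k) * exp (- (k * x)))).
  - intros x _. auto_derive; [trivial|]. field. lra.
  - intros x _. apply (ex_derive_continuous (K := R_AbsRing) (V := R_NormedModule)). auto_derive. trivial. }
split; [eexists; exact H|]. rewrite (is_RInt_unique _ _ _ _ H).
unfold minus, plus, opp; simpl.
assert (E1 := exp_pos (- (k * b))).
assert (E2 : exp (- (k * a)) <= 1) by (rewrite <- exp_0; apply exp_le; nra).
assert (E3 : 0 <= M / k) by (apply Rdiv_le_0_compat; lra). nra.
Qed.

(** On these lines the kernel decays faster than the bound in [decay] allows for, by the factor
    [exp (- 4 PI (V - v0) x)], which is integrable. *)
Lemma line_le (nu c1 c0 e W : R) (z : C) (i J : nat) : e = 1 \/ e = - (1) ->
  (i < J)%nat -> sector beta z -> wbound nu c1 c0 (half_node J) W -> 0 <= W ->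
  Cmod (hseg (kintegrand nu c1 c0 z e) (half_node i) (half_node J) (e * V)) <=
  A_pow * ker_const / sector_gap beta / (4 * PI * (V - v0)) * W.
Proof.
intros He HiJ Hz HW HW0. destruct heights as [Hv _]. assert (HV := lowest_zero_height_bounds). assert (P := PI_RGT_0).
assert (Hg := sector_gap_bounds beta Hbeta). assert (HK := ker_const_ge_1). assert (HKA := A_pow_pos).
assert (Hab := half_node_lt i J HiJ). assert (H0 := half_node_pos i). assert (H00 := half_node_le 0 i ltac:(lia)).
assert (HeV : e * V = V \/ e * V = - V) by (destruct He as [-> | ->]; lra).
assert (Hee : e * (e * V) = V) by (destruct He as [-> | ->]; lra).
assert (Hden : forall x, sector_gap beta <= Cmod (den nu z (pt x (e * V)))).
{ intros x. apply den_ge_gap; [exact Hz|]. tauto. }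
set (k := 4 * PI * (V - v0)).
assert (Hk : 0 < k) by (unfold k; apply Rmult_lt_0_compat; lra).
set (M := A_pow * ker_const / sector_gap beta * W).
assert (HM : 0 <= M).
{ unfold M. apply Rmult_le_pos; [|exact HW0]. apply Rdiv_le_0_compat; [|lra]. apply Rmult_le_pos; lra. }
destruct (RInt_exp_decay M k (half_node i) (half_node J)) as [R1 R2]; try lra.
apply Rle_trans with (M / k); [|right; unfold M; field; split; lra].
eapply Rle_trans; [|exact R2].
apply CInt_le_RInt; [lra| |exact R1|].
- apply ex_hseg; [lra|]. intros x Hx. apply Cdiff_kintegrand_upper.
  + replace (e * x * (e * V)) with (x * (e * (e * V))) by ring. rewrite Hee.
    apply Rmult_integral_contrapositive. lra.
  + apply Cmod_gt_0. specialize (Hden x). lra.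
- intros x Hx.
  apply Rle_trans with (A_pow * exp (4 * PI * v0 * x) * W * (ker_const * exp (- (4 * PI * x * V))) / sector_gap beta).
  + apply Cmod_div_le; [|lra|apply Hden]. rewrite Cmod_mult.
    apply Rmult_le_compat; try apply Cmod_ge_0.
    * apply (num_le nu c1 c0 (half_node J)); [exact HW|lra|lra].
    * apply ker_le; lra.
  + right. unfold M, k. replace (- (4 * PI * (V - v0) * x)) with (4 * PI * v0 * x + - (4 * PI * x * V)) by ring.
    rewrite exp_plus. field. lra.
Qed.

(** The zeros have height at least [v0], so the decay of the kernel there compensates the factor
    [exp (4 PI v0 x)]. *)
Lemma residue_le (nu c1 c0 e W : R) (z : C) (r : R -> (C -> C) -> C) (i J : nat) : e = 1 \/ e = - (1) ->
  residues nu (half_node i) (half_node J) z r -> wbound nu c1 c0 (half_node J) W -> 0 <= W ->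
  Cmod (r e (fun s => num nu c1 c0 s * ker e s)%C) <= 2 * PI * (A_pow * ker_const / sigma) * W.
Proof.
intros He Hres HW HW0. destruct heights as [Hv [Hs1 HsV]]. assert (HV := lowest_zero_height_bounds). assert (P := Phi_bounds).
assert (HK := ker_const_ge_1). assert (HKA := A_pow_pos).
destruct Hres as [[_ Hr]|[lam [phi [_ [Hphi [Hx Hr]]]]]]; rewrite Hr.
- rewrite Cmod_0. apply Rmult_le_pos; [|exact HW0]. apply Rmult_le_pos; [lra|].
  apply Rdiv_le_0_compat; [|lra]. apply Rmult_le_pos; lra.
- set (x := nu + (lam - ln A) / sigma) in *. set (y := (phi + e * PI) / sigma).
  change (zpole nu lam phi e) with (pt x y).
  assert (H0 := half_node_pos i). assert (H00 := half_node_le 0 i ltac:(lia)).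
  assert (Ey : sigma * y = phi + e * PI) by (unfold y; field; lra).
  assert (Ev : sigma * v0 = PI - Phi) by (unfold v0; field; lra).
  assert (Hy : - V <= y <= V).
  { split; apply (Rmult_le_reg_l sigma); try exact Hsigma; destruct He as [-> | ->]; lra. }
  assert (Hey : v0 <= e * y).
  { apply (Rmult_le_reg_l sigma); [exact Hsigma|]. replace (sigma * (e * y)) with (e * (sigma * y)) by ring.
    rewrite Ev, Ey. destruct He as [-> | ->]; lra. }
  rewrite !Cmod_mult, Cmod_Ci, Cmod_R, Rabs_pos_eq by lra. rewrite Cmod_div by apply sigma_neq_0.
  rewrite Cmod_mult, Cmod_R, (Rabs_pos_eq sigma) by lra.
  assert (B1 := num_le nu c1 c0 (half_node J) W x y HW ltac:(lra) Hy).
  assert (B2 := ker_le e x y v0 ltac:(lra) ltac:(lra)).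
  assert (B3 : Cmod (num nu c1 c0 (pt x y)) * Cmod (ker e (pt x y)) <= A_pow * ker_const * W).
  { eapply Rle_trans; [apply Rmult_le_compat; try apply Cmod_ge_0; [exact B1|exact B2]|].
    right. replace (- (4 * PI * x * v0)) with (- (4 * PI * v0 * x)) by ring. rewrite exp_Ropp.
    assert (T := exp_pos (4 * PI * v0 * x)). field. lra. }
  rewrite Rmult_1_l.
  replace (2 * PI * (A_pow * ker_const / sigma) * W) with (2 * PI * (A_pow * ker_const * W / sigma)) by (field; lra).
  apply Rmult_le_compat_l; [lra|]. unfold Rdiv. apply Rmult_le_compat_r; [left; now apply Rinv_0_lt_compat|exact B3].
Qed.

Definition separated (nu : R) (z : C) (a : R) : Prop := ratio nu z a <= sep \/ / sep <= ratio nu z a.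

Lemma separated_den (nu a y : R) (z : C) : separated nu z a -> 1 - sep <= Cmod (den nu z (pt a y)).
Proof.
intros [H|H].
- now apply den_ge_small.
- eapply Rle_trans; [|apply (den_ge_large nu a y (/ sep)); exact H].
  destruct sep_bounds as [T1 T2].
  assert (E : sep * / sep = 1) by (field; lra).
  assert (1 < / sep) by (rewrite <- Rinv_1; apply Rinv_lt_contravar; lra). nra.
Qed.

Lemma half_node_1_le_2 : half_node 1 <= 2.
Proof. assert (E := half_node_sqr 1). assert (T := half_node_pos 1). simpl in E. nra. Qed.

Lemma wbound_le (nu c1 c0 x x' W : R) : x' <= x -> wbound nu c1 c0 x W -> wbound nu c1 c0 x' W.
Proof. intros H HW u y Hu Hy. apply HW; lra. Qed.

Lemma num_left_le (nu c1 c0 W y : R) (i : nat) : (i <= 1)%nat -> wbound nu c1 c0 (half_node 1) W -> 0 <= W ->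
  - V <= y <= V -> Cmod (num nu c1 c0 (pt (half_node i) y)) <= A_pow * exp (8 * PI * v0) * W.
Proof.
intros Hi HW HW0 Hy. destruct heights as [Hv _]. assert (HV := lowest_zero_height_bounds). assert (P := PI_RGT_0).
assert (Ha := half_node_le i 1 Hi). assert (T := half_node_1_le_2). assert (H0 := half_node_le 0 i ltac:(lia)).
assert (Hp := half_node_pos 0).
eapply Rle_trans; [apply (num_le nu c1 c0 (half_node 1) W); [exact HW|lra|exact Hy]|].
apply Rmult_le_compat_r; [exact HW0|]. apply Rmult_le_compat_l; [left; apply A_pow_pos|]. apply exp_le.
replace (8 * PI * v0) with (4 * PI * v0 * 2) by ring. apply Rmult_le_compat_l; [|lra].
apply Rmult_le_pos; lra.
Qed.

Lemma quadrature_error : exists K, 0 < K /\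
  forall nu c1 c0 W z r i J, (i <= 1)%nat -> (i < J)%nat -> sector beta z ->
    separated nu z (half_node i) -> residues nu (half_node i) (half_node J) z r ->
    (forall y, den nu z (pt (half_node J) y) <> 0) ->
    wbound nu c1 c0 (half_node J) W -> 0 <= W ->
    Cmod (sum_n_m (qterm nu c1 c0 z) (S i) J
      - hseg (integrand nu c1 c0 z) (half_node i) (half_node J) (- v1)
      + edge nu c1 c0 z (half_node J)) <= K * W.
Proof.
destruct heights as [Hv [Hs1 HsV]]. assert (HV := lowest_zero_height_bounds). assert (P := PI_RGT_0).
assert (HK := ker_const_ge_1). assert (HKA := A_pow_pos). assert (Hth := sep_bounds). assert (Hg := sector_gap_bounds beta Hbeta).
set (KR := 2 * PI * (A_pow * ker_const / sigma)).
set (KL := A_pow * ker_const / sector_gap beta / (4 * PI * (V - v0))).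
set (KE := 2 * V * (A_pow * exp (8 * PI * v0) * ker_const / (1 - sep))).
assert (HKR : 0 < KR).
{ unfold KR. apply Rmult_lt_0_compat; [lra|]. apply Rdiv_lt_0_compat; [apply Rmult_lt_0_compat; lra|lra]. }
assert (HKL : 0 < KL).
{ unfold KL. apply Rdiv_lt_0_compat; [|apply Rmult_lt_0_compat; lra].
  apply Rdiv_lt_0_compat; [apply Rmult_lt_0_compat; lra|lra]. }
assert (HKE : 0 < KE).
{ unfold KE. apply Rmult_lt_0_compat; [lra|]. apply Rdiv_lt_0_compat; [|lra].
  assert (T := exp_pos (8 * PI * v0)). apply Rmult_lt_0_compat; [apply Rmult_lt_0_compat; lra|lra]. }
exists (2 * KR + 2 * KL + KE). split; [lra|].
intros nu c1 c0 W z r i J Hi HiJ Hz Hsep Hres HJ HW HW0.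
assert (Hdl : forall y, 1 - sep <= Cmod (den nu z (pt (half_node i) y))).
{ intros y. now apply separated_den. }
rewrite (quadrature_identity nu c1 c0 z r i J HiJ Hres).
- match goal with |- Cmod (?I0 + (?r1 - ?r2) + (?l1 + ?l2) + ?e1 - ?e2 - ?I0 + ?e2) <= _ =>
    replace (I0 + (r1 - r2) + (l1 + l2) + e1 - e2 - I0 + e2)%C with ((l1 + r1 - r2) + (l2 + e1))%C by ring;
    assert (B1 : Cmod r1 <= KR * W) by (apply (residue_le nu c1 c0 1 W z r i J); tauto);
    assert (B2 : Cmod r2 <= KR * W) by (apply (residue_le nu c1 c0 (- (1)) W z r i J); tauto);
    assert (B3 : Cmod l1 <= KL * W);
    [|assert (B4 : Cmod l2 <= KL * W);
      [|assert (B5 : Cmod e1 <= KE * W);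
        [|eapply Rle_trans; [apply Cmod_triangle|];
          assert (T1 := Cmod_plus3 l1 r1 r2); assert (T2 := Cmod_triangle l2 e1); lra]]]
  end.
  + replace V with (1 * V) at 1 by ring. apply line_le; tauto.
  + replace (- V) with (- (1) * V) at 1 by ring. apply line_le; tauto.
  + eapply Rle_trans; [apply (edge_le nu c1 c0 (A_pow * exp (8 * PI * v0) * W) (1 - sep)); [lra|exact Hdl|]|].
    * intros y Hy. apply num_left_le; try assumption.
      apply (wbound_le nu c1 c0 (half_node J)); [|exact HW]. apply half_node_le. lia.
    * right. unfold KE. field. lra.
- intros x. split; apply Cmod_gt_0.
  + assert (T := den_ge_gap nu x V z Hz ltac:(tauto)). lra.
  + assert (T := den_ge_gap nu x (- V) z Hz ltac:(tauto)). lra.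
- intros y. apply Cmod_gt_0. specialize (Hdl y). lra.
- exact HJ.
Qed.

Lemma period_error : exists K, 0 < K /\
  forall nu c1 c0 W z r i J, (i <= 1)%nat -> (i < J)%nat -> sector beta z ->
    separated nu z (half_node i) -> residues nu (half_node i) (half_node J) z r ->
    (forall y, den nu z (pt (half_node J) y) <> 0) ->
    wbound nu c1 c0 (half_node 1) W -> 0 <= W ->
    let I0 c1 c0 := hseg (integrand nu c1 c0 z) (half_node i) (half_node J) (- v1) in
    let q := Cexp (0, alpha * (2 * PI))%R in
    Cmod ((1 - q) * I0 c1 c0 - q * (RtoC (2 * PI * c1) * Ci) * I0 0 1 - r 1 (num nu c1 c0)
      + vseg (integrand nu c1 c0 z) (half_node J) (- v1) (- v1 + V)) <= K * W.
Proof.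
destruct heights as [Hv [Hs1 HsV]]. assert (HV := lowest_zero_height_bounds). assert (P := PI_RGT_0).
assert (HKA := A_pow_pos). assert (Hth := sep_bounds).
set (KE := V * (A_pow * exp (8 * PI * v0) / (1 - sep))).
assert (HKE : 0 < KE).
{ unfold KE. apply Rmult_lt_0_compat; [lra|]. apply Rdiv_lt_0_compat; [|lra].
  assert (T := exp_pos (8 * PI * v0)). apply Rmult_lt_0_compat; lra. }
exists KE. split; [exact HKE|].
intros nu c1 c0 W z r i J Hi HiJ Hz Hsep Hres HJ HW HW0 I0 q.
assert (Hdl : forall y, 1 - sep <= Cmod (den nu z (pt (half_node i) y))).
{ intros y. now apply separated_den. }
assert (Hdl0 : forall y, den nu z (pt (half_node i) y) <> 0).
{ intros y. apply Cmod_gt_0. specialize (Hdl y). lra. }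
unfold I0, q. rewrite (period_identity nu c1 c0 z r i J HiJ Hres Hdl0 HJ).
match goal with |- Cmod (?r1 + ?e1 - ?e2 - ?r1 + ?e2) <= _ => replace (r1 + e1 - e2 - r1 + e2)%C with e1 by ring end.
apply Rle_trans with ((- v1 + V - - v1) * (A_pow * exp (8 * PI * v0) * W / (1 - sep))).
- apply vseg_le; [lra| |].
  + intros y Hy. apply Cdiff_div; [apply Cdiff_num|apply Cdiff_den|apply Hdl0].
  + intros y Hy. apply Cmod_div_le; [|lra|apply Hdl]. apply num_left_le; try assumption. lra.
- right. unfold KE. field. lra.
Qed.

(** * Polynomial and rational parts *)

(** Partial sums of the geometric series of [1 / (1 + z / y)], where [|z / y| <= 1 / 2]. *)
Lemma right_edge_poly (nu b c d M : R) (n : nat) (G : C -> C) : c <= d ->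
  2 <= exp (sigma * (b - nu) + ln A) ->
  (forall y, c <= y <= d -> Cdiff G (pt b y)) -> (forall y, c <= y <= d -> Cmod (G (pt b y)) <= M) ->
  exists P, is_poly n P /\ forall z, Cmod z <= 1 ->
    Cmod (vseg (fun s => G s / den nu z s)%C b c d - P z) <= (d - c) * (M * (1 / 2) ^ n).
Proof.
intros Hcd Hb HG HM.
set (t := y_pow nu (- (1))).
assert (Ht : forall y, Cmod (t (pt b y)) <= 1 / 2).
{ intros y. unfold t. rewrite Cmod_y_pow. replace (- (1) * (sigma * (b - nu) + ln A)) with (- (sigma * (b - nu) + ln A)) by ring.
  rewrite exp_Ropp. replace (1 / 2) with (/ 2) by field. apply Rinv_le_contravar; lra. }
assert (Hden : forall z y, Cmod z <= 1 -> 1 / 2 <= Cmod (den nu z (pt b y))).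
{ intros z y Hz. replace (1 / 2) with (1 - 1 / 2) by field. apply den_ge_small.
  rewrite <- (Cmod_den_term nu b y). fold t. rewrite Cmod_mult.
  assert (T := Ht y). assert (T1 := Cmod_ge_0 z). assert (T2 := Cmod_ge_0 (t (pt b y))). nra. }
assert (Hden0 : forall z y, Cmod z <= 1 -> den nu z (pt b y) <> 0).
{ intros z y Hz. apply Cmod_gt_0. specialize (Hden z y Hz). lra. }
set (ck := fun k => vseg (fun s => G s * Cpow (- t s) k)%C b c d).
set (f := fun z k s => (G s * Cpow (- t s) k / den nu z s)%C).
assert (Hdiff : forall k y, c <= y <= d -> Cdiff (fun s => G s * Cpow (- t s) k)%C (pt b y)).
{ intros k y Hy. apply Cdiff_mult; [now apply HG|]. apply (Cdiff_pow (fun s => - t s)%C).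
  apply (Cdiff_ext (fun s => 0 - t s)%C); [intros; ring|]. apply Cdiff_minus; [apply Cdiff_const|apply Cdiff_y_pow]. }
assert (Hf : forall z k y, Cmod z <= 1 -> c <= y <= d -> Cdiff (f z k) (pt b y)).
{ intros z k y Hz Hy. apply Cdiff_div; [now apply Hdiff|apply Cdiff_den|now apply Hden0]. }
assert (Hstep : forall z k, Cmod z <= 1 -> (vseg (f z k) b c d - ck k)%C = (z * vseg (f z (S k)) b c d)%C).
{ intros z k Hz. unfold ck. rewrite <- (vseg_minus (f z k)), <- vseg_scal; try assumption.
  - unfold vseg. f_equal. apply CInt_ext; [exact Hcd|]. intros y Hy. unfold f.
    rewrite (Cpow_S _ k).
    assert (E : den nu z (pt b y) = (1 + z * t (pt b y))%C) by reflexivity.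
    assert (N := Hden0 z y Hz). rewrite E in *. field. exact N.
  - intros y Hy. now apply Hf.
  - intros y Hy. now apply Hf.
  - intros y Hy. now apply Hdiff. }
assert (Hind : forall z k, Cmod z <= 1 ->
  (vseg (fun s => G s / den nu z s)%C b c d - poly_sum ck k z)%C = (Cpow z (S k) * vseg (f z (S k)) b c d)%C).
{ intros z k Hz. induction k as [|k IH].
  - rewrite poly_sum_0. assert (T := Hstep z 0%nat Hz).
    replace (vseg (fun s => G s / den nu z s)%C b c d) with (vseg (f z 0%nat) b c d).
    + rewrite T. simpl. ring.
    + unfold vseg. f_equal. apply CInt_ext; [exact Hcd|]. intros y Hy. unfold f, Cdiv. simpl. ring.
  - rewrite poly_sum_S.
    replace (vseg (fun s => G s / den nu z s)%C b c d - (poly_sum ck k z + ck (S k) * Cpow z (S k)))%C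
      with (vseg (fun s => G s / den nu z s)%C b c d - poly_sum ck k z - ck (S k) * Cpow z (S k))%C by ring.
    rewrite IH. rewrite (Cpow_S z (S k)).
    transitivity (Cpow z (S k) * (vseg (f z (S k)) b c d - ck (S k)))%C; [ring|].
    rewrite Hstep by exact Hz. ring. }
exists (poly_sum ck n). split; [now exists ck|]. intros z Hz. rewrite Hind by exact Hz.
rewrite Cmod_mult, Cmod_pow.
assert (HM0 : 0 <= M) by (eapply Rle_trans; [apply Cmod_ge_0|apply (HM c); lra]).
assert (B : Cmod (vseg (f z (S n)) b c d) <= (d - c) * (M * (1 / 2) ^ n)).
{ apply vseg_le; [exact Hcd|intros y Hy; now apply Hf|]. intros y Hy.
  replace (M * (1 / 2) ^ n) with (M * (1 / 2) ^ S n / (1 / 2)) by (simpl; field).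
  apply Cmod_div_le; [|lra|now apply Hden]. rewrite Cmod_mult, Cmod_pow, Cmod_opp.
  apply Rmult_le_compat; [apply Cmod_ge_0|apply pow_le, Cmod_ge_0|now apply HM|].
  apply pow_incr. split; [apply Cmod_ge_0|apply Ht]. }
assert (B2 : Cmod z ^ S n <= 1) by (rewrite <- (pow1 (S n)); apply pow_incr; split; [apply Cmod_ge_0|exact Hz]).
assert (B3 : 0 <= Cmod z ^ S n) by apply pow_le, Cmod_ge_0.
assert (B4 := Cmod_ge_0 (vseg (f z (S n)) b c d)). nra.
Qed.

Definition far (nu b : R) : Prop := 2 <= exp (sigma * (b - nu) + ln A).

Lemma far_ratio (nu b : R) (z : C) : far nu b -> Cmod z <= 1 -> ratio nu z b <= 1 / 2.
Proof.
intros Hb Hz. unfold ratio. rewrite exp_Ropp. unfold far in Hb.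
assert (T : / exp (sigma * (b - nu) + ln A) <= / 2) by (apply Rinv_le_contravar; lra).
assert (T1 := Cmod_ge_0 z). assert (T2 : 0 < / exp (sigma * (b - nu) + ln A)) by (apply Rinv_0_lt_compat, exp_pos). nra.
Qed.

Lemma far_den (nu b y : R) (z : C) : far nu b -> Cmod z <= 1 -> den nu z (pt b y) <> 0.
Proof.
intros Hb Hz. apply Cmod_gt_0.
assert (T := den_ge_small nu b y (1 / 2) z (far_ratio nu b z Hb Hz)). lra.
Qed.

Lemma Cdiff_num_ker_edge (nu c1 c0 e y : R) (j : nat) : e = 1 \/ e = - (1) -> - v1 <= e * y ->
  Cdiff (fun s => num nu c1 c0 s * ker e s)%C (pt (half_node j) y).
Proof.
intros He Hy. assert (Hx := half_node_pos j). destruct low_height_bounds as [[B1 B2] _].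
apply Cdiff_mult; [apply Cdiff_num|]. apply Cdiff_ker.
destruct (Rle_dec v1 (e * y)) as [L|L].
- apply ker_neq_1_off_axis. replace (e * half_node j * y) with (half_node j * (e * y)) by ring.
  apply Rmult_integral_contrapositive. lra.
- apply (ker_half e (half_node j) y j He (half_node_sqr j)). destruct He as [-> | ->]; lra.
Qed.

Lemma edge_poly (nu c1 c0 M : R) (J n : nat) : far nu (half_node J) ->
  (forall y, - V <= y <= V -> Cmod (num nu c1 c0 (pt (half_node J) y)) <= M) ->
  exists P, is_poly n P /\ forall z, Cmod z <= 1 ->
    Cmod (edge nu c1 c0 z (half_node J) - P z) <= 2 * V * (M * ker_const * (1 / 2) ^ n).
Proof.
intros Hb HM. destruct heights as [Hv _].
assert (B : forall e y, e = 1 \/ e = - (1) -> - v1 <= e * y -> - V <= y <= V ->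
   Cmod (num nu c1 c0 (pt (half_node J) y) * ker e (pt (half_node J) y)) <= M * ker_const).
{ intros e y He Hy HyV. rewrite Cmod_mult. apply Rmult_le_compat; try apply Cmod_ge_0; [now apply HM|now apply ker_edge_le]. }
assert (B0 : forall e c d, e = 1 \/ e = - (1) -> - V <= c <= d -> d <= V ->
   (forall y, c <= y <= d -> - v1 <= e * y) ->
   exists P, is_poly n P /\ forall z, Cmod z <= 1 ->
     Cmod (vseg (kintegrand nu c1 c0 z e) (half_node J) c d - P z) <= (d - c) * (M * ker_const * (1 / 2) ^ n)).
{ intros e c d He Hc Hd Hy.
  apply (right_edge_poly nu (half_node J) c d (M * ker_const) n (fun s => num nu c1 c0 s * ker e s)%C); [lra|exact Hb| |].
  - intros y Hyy. apply Cdiff_num_ker_edge; [exact He|now apply Hy].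
  - intros y Hyy. apply B; [exact He|now apply Hy|lra]. }
destruct (B0 1 (- v1) v1) as [P1 [HP1 E1]]; try lra; [intros; lra|].
destruct (B0 1 v1 V) as [P2 [HP2 E2]]; try lra; [intros; lra|].
destruct (B0 (- (1)) (- V) (- v1)) as [P3 [HP3 E3]]; try lra; [intros; lra|].
exists (fun z => P1 z + P2 z + RtoC (- (1)) * P3 z)%C. split.
- apply is_poly_plus; [now apply is_poly_plus|now apply is_poly_scal].
- intros z Hz. specialize (E1 z Hz). specialize (E2 z Hz). specialize (E3 z Hz). unfold edge.
  match goal with |- Cmod (?a1 + ?a2 - ?a3 - (?p1 + ?p2 + _ * ?p3)) <= _ =>
    replace (a1 + a2 - a3 - (p1 + p2 + RtoC (- (1)) * p3))%C with ((a1 - p1) + (a2 - p2) - (a3 - p3))%C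
      by (rewrite RtoC_opp; ring) end.
  eapply Rle_trans; [apply Cmod_plus3|].
  eapply Rle_trans; [apply Rplus_le_compat; [apply Rplus_le_compat; [exact E1|exact E2]|exact E3]|]. lra.
Qed.

Definition node_y (nu : R) (j : nat) : R := exp (sigma * (sqrt (INR j) - nu) + ln A).

Lemma node_y_pole (N1 j : nat) : pole A sigma N1 j = - node_y (sqrt (INR N1)) j.
Proof.
unfold pole, node_y. rewrite exp_plus, exp_ln by exact HA.
replace (sigma * (sqrt (INR j) - sqrt (INR N1))) with (- sigma * (sqrt (INR N1) - sqrt (INR j))) by ring. ring.
Qed.

Lemma den_node (nu : R) (z : C) (j : nat) :
  den nu z (RtoC (sqrt (INR j))) = (1 + z / RtoC (node_y nu j))%C.
Proof.
unfold den, y_pow, node_y. change (RtoC (sqrt (INR j))) with (pt (sqrt (INR j)) 0). rewrite log_y_pt.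
unfold Cdiv. do 2 f_equal. rewrite <- RtoC_inv by (apply Rgt_not_eq, exp_pos).
rewrite <- exp_Ropp, <- Cexp_RtoC. f_equal. unfold pt, RtoC, Cmult; simpl. f_equal; ring.
Qed.

Lemma node_den_neq_0 (nu : R) (z : C) (j : nat) : sector beta z -> den nu z (RtoC (sqrt (INR j))) <> 0.
Proof.
intros Hz. apply Cmod_gt_0. assert (T := den_ge_gap nu (sqrt (INR j)) 0 z Hz ltac:(tauto)).
assert (G := sector_gap_bounds beta Hbeta). change (pt (sqrt (INR j)) 0) with (RtoC (sqrt (INR j))) in T. lra.
Qed.

(** The terms of index at most [N1] are the simple fractions of the rational function. *)
Lemma qterm_fraction (c1 c0 : R) (z : C) (N1 j : nat) : sector beta z -> (1 <= j)%nat ->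
  qterm (sqrt (INR N1)) c1 c0 z j =
  (num (sqrt (INR N1)) c1 c0 (RtoC (sqrt (INR j))) * RtoC (node_y (sqrt (INR N1)) j) / RtoC (2 * sqrt (INR j))
    / (z - RtoC (pole A sigma N1 j)))%C.
Proof.
intros Hz Hj. unfold qterm, integrand. rewrite node_y_pole, RtoC_opp.
assert (N := node_den_neq_0 (sqrt (INR N1)) z j Hz). rewrite den_node in *.
set (y := node_y (sqrt (INR N1)) j) in *.
assert (Hy : RtoC y <> 0) by (intros E; apply RtoC_inj in E; assert (T : 0 < y) by apply exp_pos; lra).
assert (Hs : RtoC (2 * sqrt (INR j)) <> 0).
{ intros E. apply RtoC_inj in E. assert (T : 0 < sqrt (INR j)) by (apply sqrt_lt_R0; apply (lt_INR 0 j); lia). lra. }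
assert (N2 : (z - - RtoC y)%C <> 0).
{ intros E. apply N. replace (1 + z / RtoC y)%C with ((z - - RtoC y) / RtoC y)%C by (field; exact Hy).
  rewrite E. field. exact Hy. }
set (u := num _ c1 c0 _). set (v := RtoC (2 * sqrt (INR j))) in *.
assert (N3 : (RtoC y + z)%C <> 0) by (intros E; apply N2; rewrite <- E; ring).
field. repeat split; try assumption.
Qed.

Lemma Cmod_sum_n_m_le (f : nat -> C) (B : R) (a b : nat) : 0 <= B ->
  (forall j, (a <= j <= b)%nat -> Cmod (f j) <= B) -> Cmod (sum_n_m f a b) <= INR (S b) * B.
Proof.
intros HB H. induction b as [|b IH].
- destruct a as [|a].
  + rewrite sum_n_n. simpl. rewrite Rmult_1_l. apply H. lia.
  + rewrite sum_n_m_zero by lia. change (Cmod 0 <= INR 1 * B). rewrite Cmod_0. simpl. lra.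
- destruct (Nat.le_gt_cases a (S b)) as [L|L].
  + rewrite sum_n_Sm by exact L. rewrite S_INR, Rmult_plus_distr_r, Rmult_1_l.
    eapply Rle_trans; [apply Cmod_triangle|]. apply Rplus_le_compat; [apply IH; intros; apply H; lia|apply H; lia].
  + rewrite sum_n_m_zero by lia. change (Cmod 0 <= INR (S (S b)) * B). rewrite Cmod_0.
    apply Rmult_le_pos; [apply pos_INR|exact HB].
Qed.

Lemma sum_n_m_Cminus (f g : nat -> C) (a b : nat) :
  (sum_n_m f a b - sum_n_m g a b)%C = sum_n_m (fun j => f j - g j)%C a b.
Proof.
induction b as [|b IH].
- destruct a as [|a].
  + now rewrite !sum_n_n.
  + rewrite !sum_n_m_zero by lia. change ((0 - 0)%C = RtoC 0). ring.
- destruct (Nat.le_gt_cases a (S b)) as [L|L].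
  + rewrite !sum_n_Sm by exact L. rewrite <- IH. change plus with Cplus. ring.
  + rewrite !sum_n_m_zero by lia. change ((0 - 0)%C = RtoC 0). ring.
Qed.

Lemma sum_n_m_split (f : nat -> C) (a m b : nat) : (a <= S m)%nat -> (m <= b)%nat ->
  sum_n_m f a b = (sum_n_m f a m + sum_n_m f (S m) b)%C.
Proof. intros H1 H2. now rewrite (sum_n_m_Chasles f a m b). Qed.

(** For [y_j >= A] the fraction [1 / (1 + z / y_j)] is the function [1 / (1 + z / A)] evaluated
    at a contraction of [z] that stays in the sector. *)
Lemma tail_terms_poly : exists K rho, 0 < K /\ 0 < rho < 1 /\
  forall c1 c0 M (N1 J n : nat), (1 <= N1)%nat ->
    (forall j, (1 <= j <= J)%nat -> Cmod (num (sqrt (INR N1)) c1 c0 (RtoC (sqrt (INR j)))) <= M) -> 0 <= M ->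
    exists P, is_poly n P /\ forall z, sector beta z ->
      Cmod (sum_n_m (qterm (sqrt (INR N1)) c1 c0 z) (S N1) J - P z) <= INR (S J) * (M * K * rho ^ n).
Proof.
destruct (inverse_geometric_approximation beta A Hbeta HA) as [K [rho [HK [Hrho HP]]]].
exists K, rho. split; [exact HK|]. split; [exact Hrho|].
intros c1 c0 M N1 J n HN1 HM HM0. destruct (HP n) as [P [HPn HPz]].
set (nu := sqrt (INR N1)) in *.
set (t := fun j => (A / node_y nu j)).
assert (HA0 : RtoC A <> 0) by (intros E; apply RtoC_inj in E; lra).
assert (Ht : forall j, (S N1 <= j)%nat -> 0 <= t j <= 1).
{ intros j Hj. assert (Hy : A <= node_y nu j).
  { unfold node_y. rewrite exp_plus, exp_ln by exact HA. rewrite <- (Rmult_1_l A) at 1.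
    apply Rmult_le_compat_r; [lra|]. rewrite <- exp_0. apply exp_le.
    assert (nu <= sqrt (INR j)) by (apply sqrt_le_1; try apply pos_INR; apply le_INR; lia). nra. }
  unfold t. split; [apply Rdiv_le_0_compat; lra|]. apply Rle_div_l; lra. }
set (cf := fun j => (num nu c1 c0 (RtoC (sqrt (INR j))) / RtoC (2 * sqrt (INR j)))%C).
exists (fun z => sum_n_m (fun j => cf j * P (RtoC (t j) * z)%C)%C (S N1) J).
split.
{ apply (is_poly_sum_n_m n (S N1) J (fun j z => cf j * P (RtoC (t j) * z))%C). intros j Hj. apply is_poly_scal.
  now apply is_poly_comp_scal. }
intros z Hz. rewrite sum_n_m_Cminus. apply Cmod_sum_n_m_le.
{ apply Rmult_le_pos; [apply Rmult_le_pos; lra|apply pow_le; lra]. }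
intros j Hj.
assert (Hy : 0 < node_y nu j) by apply exp_pos.
assert (Hs : 1 <= sqrt (INR j)).
{ rewrite <- sqrt_1. apply sqrt_le_1; [lra|apply pos_INR|]. apply (le_INR 1). lia. }
assert (Hs0 : RtoC (2 * sqrt (INR j)) <> 0) by (intros E; apply RtoC_inj in E; lra).
assert (Hy0 : RtoC (node_y nu j) <> 0) by (intros E; apply RtoC_inj in E; lra).
assert (N := node_den_neq_0 nu z j Hz).
assert (E : qterm nu c1 c0 z j = (cf j * / (1 + RtoC (t j) * z / RtoC A))%C).
{ unfold qterm, integrand, cf. rewrite den_node in *.
  replace (1 + RtoC (t j) * z / RtoC A)%C with (1 + z / RtoC (node_y nu j))%C.
  2:{ unfold t. rewrite RtoC_div by lra. field. split; assumption. }
  unfold Cdiv. ring. }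
rewrite E.
replace (cf j * / (1 + RtoC (t j) * z / RtoC A) - cf j * P (RtoC (t j) * z)%C)%C
  with (cf j * (/ (1 + RtoC (t j) * z / RtoC A) - P (RtoC (t j) * z)%C))%C by ring.
rewrite Cmod_mult. rewrite (Rmult_assoc M). apply Rmult_le_compat; try apply Cmod_ge_0.
- unfold cf. rewrite Cmod_div by exact Hs0. rewrite Cmod_R, Rabs_pos_eq by lra.
  apply Rle_div_l; [lra|]. specialize (HM j ltac:(lia)). fold nu in HM. nra.
- apply HPz. rewrite Cmult_comm. apply sector_star; [exact Hbeta|exact Hz|apply Ht; lia].
Qed.

Definition fractions (N1 : nat) (a : nat -> C) (z : C) : C :=
  sum_n_m (fun j => Cdiv (a j) (Cminus z (pole A sigma N1 j))) 1 N1.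

Definition num_bound (nu c1 c0 xmax M : R) : Prop :=
  forall x y, half_node 0 <= x <= xmax -> - V <= y <= V -> Cmod (num nu c1 c0 (pt x y)) <= M.

Lemma sqrt_le_half_node (j : nat) : sqrt (INR j) <= half_node j.
Proof. apply sqrt_le_1; assert (T := pos_INR j); lra. Qed.

Lemma half_node_0_le_sqrt (j : nat) : (1 <= j)%nat -> half_node 0 <= sqrt (INR j).
Proof. intros H. apply sqrt_le_1; try apply pos_INR; apply le_INR in H; simpl in *; lra. Qed.

(** The coefficients and the polynomial depend neither on [z] nor on the left edge [i], which has to
    be adapted to [z]: the polynomial stems from the right edge and the terms of index above [N1],
    and a first term that is dropped together with the first node is below the error bound. *)
Lemma quadrature_theorem : exists K rho, 0 < K /\ 0 < rho < 1 /\
  forall c1 c0 W M (N1 J n : nat), (1 <= N1)%nat -> (2 <= J)%nat -> (N1 <= J)%nat ->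
    let nu := sqrt (INR N1) in
    far nu (half_node J) -> wbound nu c1 c0 (half_node J) W -> 0 <= W ->
    num_bound nu c1 c0 (half_node J) M -> 0 <= M ->
    exists a P, is_poly n P /\ forall z, sector beta z ->
      forall i r, (i <= 1)%nat -> separated nu z (half_node i) ->
      residues nu (half_node i) (half_node J) z r ->
      Cmod (fractions N1 a z + P z - hseg (integrand nu c1 c0 z) (half_node i) (half_node J) (- v1))
        <= K * (W + INR (S J) * M * rho ^ n).
Proof.
destruct quadrature_error as [K1 [HK1 HQ]]. destruct tail_terms_poly as [K2 [rho [HK2 [Hrho HT]]]].
destruct heights as [Hv _]. assert (HKq := ker_const_ge_1). assert (HKA := A_pow_pos). assert (Hg := sector_gap_bounds beta Hbeta).
assert (HV := lowest_zero_height_bounds).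
set (K3 := A_pow * exp (8 * PI * v0) / sector_gap beta).
assert (HK3 : 0 < K3).
{ unfold K3. apply Rdiv_lt_0_compat; [|lra]. apply Rmult_lt_0_compat; [lra|apply exp_pos]. }
assert (HK4 : 0 < 2 * V * ker_const) by (apply Rmult_lt_0_compat; lra).
set (rho' := Rmax rho (1 / 2)).
assert (Hr1 : rho <= rho') by apply Rmax_l. assert (Hr2 : 1 / 2 <= rho') by apply Rmax_r.
assert (Hr3 : rho' < 1) by (apply Rmax_lub_lt; lra).
exists (K1 + K2 + K3 + 2 * V * ker_const), rho'. split; [lra|]. split; [lra|].
intros c1 c0 W M N1 J n HN1 HJ HNJ nu Hfar HW HW0 HM HM0.
assert (HMj : forall j, (1 <= j <= J)%nat -> Cmod (num nu c1 c0 (RtoC (sqrt (INR j)))) <= M).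
{ intros j Hj. apply (HM (sqrt (INR j)) 0); [|lra]. split; [apply half_node_0_le_sqrt; lia|].
  eapply Rle_trans; [apply sqrt_le_half_node|apply half_node_le; lia]. }
destruct (HT c1 c0 M N1 J n HN1 HMj HM0) as [P1 [HP1 E1]].
destruct (edge_poly nu c1 c0 M J n Hfar) as [P2 [HP2 E2]].
{ intros y Hy. apply HM; [|exact Hy]. split; [apply half_node_le; lia|lra]. }
set (a := fun j => (num nu c1 c0 (RtoC (sqrt (INR j))) * RtoC (node_y nu j) / RtoC (2 * sqrt (INR j)))%C).
exists a, (fun z => P1 z + P2 z)%C. split; [now apply is_poly_plus|].
intros z Hz i r Hi Hsep Hres.
assert (Hz1 := sector_Cmod_le_1 beta z Hbeta Hz).
specialize (E1 z Hz). specialize (E2 z Hz1).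
assert (Eq := HQ nu c1 c0 W z r i J Hi ltac:(lia) Hz Hsep Hres (fun y => far_den nu (half_node J) y z Hfar Hz1) HW HW0).
assert (EF : fractions N1 a z = sum_n_m (qterm nu c1 c0 z) 1 N1).
{ unfold fractions. apply sum_n_m_ext_loc. intros j Hj. symmetry. apply qterm_fraction; [exact Hz|lia]. }
assert (EH : Cmod (sum_n_m (qterm nu c1 c0 z) 1 i) <= K3 * W).
{ destruct i as [|[|i]]; [| |lia].
  - rewrite sum_n_m_zero by lia. change (Cmod 0 <= K3 * W). rewrite Cmod_0. apply Rmult_le_pos; lra.
  - rewrite sum_n_n. unfold qterm, integrand. change (INR 1) with 1. rewrite sqrt_1.
    assert (B1 : Cmod (num nu c1 c0 (pt 1 0)) <= A_pow * exp (8 * PI * v0) * W).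
    { assert (T1 := half_node_0_le_sqrt 1 (le_n 1)). assert (T2 := sqrt_le_half_node 1).
      change (INR 1) with 1 in *. rewrite sqrt_1 in *.
      eapply Rle_trans; [apply (num_le nu c1 c0 (half_node 1) W); [|lra|lra]|].
      - apply (wbound_le nu c1 c0 (half_node J)); [apply half_node_le; lia|exact HW].
      - apply Rmult_le_compat_r; [exact HW0|]. apply Rmult_le_compat_l; [lra|]. apply exp_le.
        assert (0 <= PI * v0) by (assert (P := PI_RGT_0); apply Rmult_le_pos; lra). lra. }
    assert (B2 := Cmod_div_le _ _ _ _ B1 (proj1 Hg) (den_ge_gap nu 1 0 z Hz ltac:(tauto))).
    change (pt 1 0) with (RtoC 1) in B2.
    assert (H2 : RtoC (2 * 1) <> 0) by (intros E; apply RtoC_inj in E; lra).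
    rewrite Cmod_div by exact H2. rewrite Cmod_R, Rabs_pos_eq by lra.
    assert (T := Cmod_ge_0 (num nu c1 c0 (RtoC 1) / den nu z (RtoC 1))).
    replace (A_pow * exp (8 * PI * v0) * W / sector_gap beta) with (K3 * W) in B2 by (unfold K3; field; lra). lra. }
assert (ES1 := sum_n_m_split (qterm nu c1 c0 z) 1 N1 J ltac:(lia) HNJ).
assert (ES2 := sum_n_m_split (qterm nu c1 c0 z) 1 i J ltac:(lia) ltac:(lia)).
rewrite EF.
set (S1 := sum_n_m (qterm nu c1 c0 z) 1 N1 : C) in *. set (S2 := sum_n_m (qterm nu c1 c0 z) (S N1) J : C) in *.
set (S3 := sum_n_m (qterm nu c1 c0 z) 1 i : C) in *. set (S4 := sum_n_m (qterm nu c1 c0 z) (S i) J : C) in *.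
set (I0 := hseg (integrand nu c1 c0 z) (half_node i) (half_node J) (- v1)) in *.
set (Ed := edge nu c1 c0 z (half_node J)) in *.
assert (ES : (S1 + S2 = S3 + S4)%C) by (rewrite <- ES1; exact ES2).
replace (S1 + (P1 z + P2 z) - I0)%C with (((S4 - I0 + Ed) + S3) - (S2 - P1 z) - (Ed - P2 z))%C.
2:{ replace S4 with (S1 + S2 - S3)%C by (rewrite ES; ring). ring. }
assert (R1 : rho ^ n <= rho' ^ n) by (apply pow_incr; lra).
assert (R2 : (1 / 2) ^ n <= rho' ^ n) by (apply pow_incr; lra).
assert (R0 : 0 <= rho' ^ n) by (apply pow_le; lra).
assert (HSJ : 1 <= INR (S J)) by (apply (le_INR 1); lia).
set (Y := INR (S J) * M * rho' ^ n).
assert (HY : M * rho' ^ n <= Y).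
{ unfold Y. rewrite Rmult_assoc. assert (0 <= M * rho' ^ n) by (apply Rmult_le_pos; assumption). nra. }
assert (HY0 : 0 <= M * rho' ^ n) by (apply Rmult_le_pos; assumption).
assert (F1 : Cmod (S2 - P1 z) <= K2 * Y).
{ eapply Rle_trans; [exact E1|]. unfold Y.
  replace (INR (S J) * (M * K2 * rho ^ n)) with (INR (S J) * M * K2 * rho ^ n) by ring.
  replace (K2 * (INR (S J) * M * rho' ^ n)) with (INR (S J) * M * K2 * rho' ^ n) by ring.
  apply Rmult_le_compat_l; [|exact R1]. apply Rmult_le_pos; [apply Rmult_le_pos; lra|lra]. }
assert (F2 : Cmod (Ed - P2 z) <= 2 * V * ker_const * Y).
{ eapply Rle_trans; [exact E2|]. apply Rle_trans with (2 * V * ker_const * (M * rho' ^ n)).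
  - replace (2 * V * (M * ker_const * (1 / 2) ^ n)) with (2 * V * ker_const * (M * (1 / 2) ^ n)) by ring.
    apply Rmult_le_compat_l; [lra|]. apply Rmult_le_compat_l; assumption.
  - apply Rmult_le_compat_l; lra. }
unfold Cminus at 1. eapply Rle_trans; [apply Cmod_triangle|]. rewrite Cmod_opp.
unfold Cminus at 1. assert (T1 := Cmod_triangle (S4 - I0 + Ed + S3) (- (S2 - P1 z))). rewrite Cmod_opp in T1.
assert (T2 := Cmod_triangle (S4 - I0 + Ed) S3).
assert (HYp : 0 <= Y) by lra.
assert (Z1 : 0 <= K1 * Y) by (apply Rmult_le_pos; lra). assert (Z2 : 0 <= K3 * Y) by (apply Rmult_le_pos; lra).
assert (Z3 : 0 <= K2 * W) by (apply Rmult_le_pos; lra). assert (Z4 : 0 <= 2 * V * ker_const * W) by (apply Rmult_le_pos; lra).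
replace ((K1 + K2 + K3 + 2 * V * ker_const) * (W + Y)) with
  (K1 * W + K3 * W + K2 * Y + 2 * V * ker_const * Y + K1 * Y + K3 * Y + K2 * W + 2 * V * ker_const * W) by ring.
lra.
Qed.

Lemma period_theorem : exists K, 0 < K /\
  forall c1 c0 W M nu (J n : nat), (2 <= J)%nat ->
    far nu (half_node J) -> wbound nu c1 c0 (half_node 1) W -> 0 <= W ->
    num_bound nu c1 c0 (half_node J) M -> 0 <= M ->
    exists P, is_poly n P /\ forall z, sector beta z ->
      forall i r, (i <= 1)%nat -> separated nu z (half_node i) ->
      residues nu (half_node i) (half_node J) z r ->
      let I0 c1 c0 := hseg (integrand nu c1 c0 z) (half_node i) (half_node J) (- v1) in
      let q := Cexp (0, alpha * (2 * PI))%R in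
      Cmod ((1 - q) * I0 c1 c0 - q * (RtoC (2 * PI * c1) * Ci) * I0 0 1 - r 1 (num nu c1 c0) + P z)
        <= K * (W + M * (1 / 2) ^ n).
Proof.
destruct period_error as [K1 [HK1 HQ]]. destruct heights as [Hv _].
exists (K1 + V). split; [lra|].
intros c1 c0 W M nu J n HJ Hfar HW HW0 HM HM0.
destruct (right_edge_poly nu (half_node J) (- v1) (- v1 + V) M n (num nu c1 c0)) as [P [HP EP]].
- lra.
- exact Hfar.
- intros y _. apply Cdiff_num.
- intros y Hy. apply HM; [|lra]. split; [apply half_node_le; lia|lra].
- exists P. split; [exact HP|]. intros z Hz i r Hi Hsep Hres I0 q.
  assert (Hz1 := sector_Cmod_le_1 beta z Hbeta Hz).
  assert (Eq := HQ nu c1 c0 W z r i J Hi ltac:(lia) Hz Hsep Hres (fun y => far_den nu (half_node J) y z Hfar Hz1) HW HW0).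
  specialize (EP z Hz1).
  change (fun s : C => (num nu c1 c0 s / den nu z s)%C) with (integrand nu c1 c0 z) in EP.
  set (X := ((1 - q) * I0 c1 c0 - q * (RtoC (2 * PI * c1) * Ci) * I0 0 1 - r 1 (num nu c1 c0))%C) in *.
  set (E := vseg (integrand nu c1 c0 z) (half_node J) (- v1) (- v1 + V)) in *.
  change (Cmod (X + E) <= K1 * W) in Eq.
  replace (X + P z)%C with ((X + E) - (E - P z))%C by ring.
  unfold Cminus at 1. eapply Rle_trans; [apply Cmod_triangle|]. rewrite Cmod_opp.
  assert (Y0 : 0 <= M * (1 / 2) ^ n) by (apply Rmult_le_pos; [exact HM0|apply pow_le; lra]).
  set (Y := M * (1 / 2) ^ n) in *.
  assert (Z1 : 0 <= K1 * Y) by (apply Rmult_le_pos; lra).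
  assert (Z2 : 0 <= V * W) by (apply Rmult_le_pos; lra). lra.
Qed.

(** * Locating the zeros of the denominator *)

Lemma Clog_Cexp (lam phi : R) : - PI < phi < PI -> Clog (Cexp (lam, phi)) = (lam, phi).
Proof.
intros Hp. unfold Clog. rewrite Cmod_Cexp. simpl. rewrite ln_exp. f_equal.
unfold Carg. rewrite Cmod_Cexp. simpl. assert (He := exp_pos lam).
replace (exp lam * cos phi / exp lam) with (cos phi) by (field; lra).
destruct (Rle_dec 0 (exp lam * sin phi)) as [L|L].
- apply acos_cos. split; [|lra]. apply Rnot_lt_le. intros N.
  assert (sin phi < 0) by (apply sin_lt_0_var; lra). nra.
- rewrite <- cos_neg, acos_cos; [ring|]. split; [|lra]. apply Rnot_lt_le. intros N.
  assert (0 <= sin phi) by (apply sin_ge_0; lra). nra.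
Qed.

Lemma Cexp_ne_0_dec (w : C) : exists H, Ceq_dec (Cexp w) 0 = right H.
Proof.
destruct (Ceq_dec (Cexp w) 0) as [E|H]; [|now exists H]. exfalso. exact (Cexp_neq_0 w E).
Qed.

Lemma zpow_Cexp (lam phi : R) : - PI < phi < PI ->
  zpow alpha (Cexp (lam, phi)) = Cexp (RtoC alpha * (lam, phi)).
Proof.
intros Hp. unfold zpow. destruct (Cexp_ne_0_dec (lam, phi)) as [H ->]. now rewrite Clog_Cexp.
Qed.

(** The residue of the integrand at its upper pole, up to a constant factor, as a function of [z]. *)
Definition Theta (nu c1 c0 : R) (z : C) : C :=
  if Ceq_dec z 0 then RtoC 0 else
  ((RtoC c1 * (Clog z + (0, PI)%R + RtoC (sigma * nu - ln A)) + RtoC c0)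
   * (zpow alpha z * Cexp (0, alpha * PI)%R))%C.

Lemma num_zpole (nu c1 c0 lam phi : R) : - Phi <= phi <= Phi ->
  num nu c1 c0 (zpole nu lam phi 1) = Theta nu c1 c0 (Cexp (lam, phi)).
Proof.
intros Hp. assert (P := Phi_bounds).
unfold Theta. destruct (Cexp_ne_0_dec (lam, phi)) as [H ->].
rewrite zpow_Cexp, Clog_Cexp by lra. rewrite <- Cexp_plus.
unfold num, y_pow. rewrite log_y_zpole. unfold weight. f_equal.
- f_equal. f_equal. unfold zpole, pt, RtoC, Cmult, Cplus; simpl. f_equal; field; lra.
- f_equal. unfold pt, RtoC, Cmult, Cplus; simpl. f_equal; ring.
Qed.

Lemma half_node_gap : half_node 0 + 1 / 2 <= half_node 1.
Proof.
assert (E0 := half_node_sqr 0). assert (E1 := half_node_sqr 1). simpl in E0, E1.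
assert (T0 := half_node_pos 0). assert (T1 := half_node_pos 1). nra.
Qed.

(** Unless the zeros lie well to the right of the first edge, they lie well to the left of the
    second. *)
Lemma ratio_half_node_1 (nu : R) (z : C) : ratio nu z (half_node 0) <= / sep -> ratio nu z (half_node 1) <= sep.
Proof.
intros H. assert (G := half_node_gap).
assert (E : ratio nu z (half_node 1) = ratio nu z (half_node 0) * exp (- (sigma * (half_node 1 - half_node 0)))).
{ unfold ratio. rewrite Rmult_assoc, <- exp_plus. do 2 f_equal. ring. }
rewrite E. apply Rle_trans with (/ sep * exp (- (sigma * (1 / 2)))).
- apply Rmult_le_compat; [|left; apply exp_pos|exact H|].
  + unfold ratio. apply Rmult_le_pos; [apply Cmod_ge_0|left; apply exp_pos].
  + apply exp_le. nra.
- right. unfold sep. rewrite <- exp_Ropp, <- exp_plus. f_equal. field.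
Qed.

Lemma mult_exp_neg_le (a u : R) : 0 < a -> u <= 0 -> - u * exp (a * u) <= / a.
Proof.
intros Ha Hu. set (t := a * - u).
assert (Ht : 0 <= t) by (unfold t; nra).
assert (E : t <= exp t) by (destruct (Req_dec t 0) as [->|N]; [left; apply exp_pos|assert (T := exp_ineq1 t N); lra]).
replace (a * u) with (- t) by (unfold t; ring). replace (- u) with (t * / a) by (unfold t; field; lra).
rewrite exp_Ropp. assert (Hp := exp_pos t).
replace (t * / a * / exp t) with (/ a * (t * / exp t)) by ring.
rewrite <- (Rmult_1_r (/ a)) at 2. apply Rmult_le_compat_l; [left; now apply Rinv_0_lt_compat|].
apply (Rmult_le_reg_r (exp t)); [exact Hp|]. rewrite Rmult_assoc, Rinv_l; lra.
Qed.

(** When all zeros lie to the left, [z] is so small that [Theta] itself is negligible. *)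
Lemma Theta_small : exists K, 0 < K /\ forall nu c1 c0 lam phi a, - Phi <= phi <= Phi -> a <= 2 ->
  ratio nu (Cexp (lam, phi)) a < 1 ->
  Cmod (Theta nu c1 c0 (Cexp (lam, phi))) <= K * (Rabs c1 + Rabs c0) * exp (- (sigma * alpha * nu)).
Proof.
assert (P := Phi_bounds). assert (HKA := A_pow_pos).
set (Ku := (2 * sigma + 2 * PI) * exp (alpha * (2 * sigma)) + / alpha + 2 * PI + exp (alpha * (2 * sigma))).
assert (He := exp_pos (alpha * (2 * sigma))). assert (Hia : 0 < / alpha) by now apply Rinv_0_lt_compat.
assert (HKu0 : 0 <= (2 * sigma + 2 * PI) * exp (alpha * (2 * sigma))) by (apply Rmult_le_pos; lra).
assert (HKu : 0 < Ku) by (unfold Ku; lra).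
exists (A_pow * Ku). split; [now apply Rmult_lt_0_compat|].
intros nu c1 c0 lam phi a Hp Ha Hr.
unfold Theta. destruct (Cexp_ne_0_dec (lam, phi)) as [H ->].
rewrite zpow_Cexp, Clog_Cexp by lra. rewrite !Cmod_mult, !Cmod_Cexp.
replace (Re (0, alpha * PI)) with 0 by reflexivity. rewrite exp_0, Rmult_1_r.
set (u := lam + (sigma * nu - ln A)).
assert (Hu : u <= 2 * sigma).
{ unfold ratio in Hr. rewrite Cmod_Cexp in Hr. simpl in Hr. rewrite <- exp_plus, <- exp_0 in Hr.
  apply exp_lt_inv in Hr. unfold u. nra. }
replace (Re (RtoC alpha * (lam, phi))) with (alpha * ln A + alpha * u + - (sigma * alpha * nu)) by (simpl; unfold u; ring).
rewrite !exp_plus. fold A_pow.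
assert (B1 : Cmod ((lam, phi) + (0, PI)%R + RtoC (sigma * nu - ln A)) <= Rabs u + 2 * PI).
{ eapply Rle_trans; [apply Cmod_le_Re_Im|]. simpl. replace (lam + 0 + (sigma * nu - ln A)) with u by (unfold u; ring).
  apply Rplus_le_compat_l. apply Rabs_le. lra. }
assert (Heu := exp_pos (alpha * u)).
assert (Heu2 : exp (alpha * u) <= exp (alpha * (2 * sigma))) by (apply exp_le; nra).
assert (B2 : (Rabs u + 2 * PI) * exp (alpha * u) <= Ku).
{ unfold Ku. destruct (Rle_dec 0 u) as [L|L].
  - rewrite Rabs_pos_eq by exact L.
    apply Rle_trans with ((2 * sigma + 2 * PI) * exp (alpha * (2 * sigma))); [|lra].
    apply Rmult_le_compat; lra.
  - rewrite Rabs_left by lra. assert (T := mult_exp_neg_le alpha u Halpha ltac:(lra)).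
    assert (T2 : exp (alpha * u) <= 1) by (rewrite <- exp_0; apply exp_le; nra).
    assert (T3 : 2 * PI * exp (alpha * u) <= 2 * PI) by nra. lra. }
assert (B3 : exp (alpha * u) <= Ku) by (unfold Ku; lra).
assert (B4 : Cmod (RtoC c1 * ((lam, phi) + (0, PI)%R + RtoC (sigma * nu - ln A)) + RtoC c0) * exp (alpha * u)
  <= Ku * (Rabs c1 + Rabs c0)).
{ apply Rle_trans with ((Rabs c1 * (Rabs u + 2 * PI) + Rabs c0) * exp (alpha * u)).
  - apply Rmult_le_compat_r; [lra|]. eapply Rle_trans; [apply Cmod_triangle|].
    rewrite Cmod_mult, !Cmod_R. apply Rplus_le_compat_r. apply Rmult_le_compat_l; [apply Rabs_pos|exact B1].
  - assert (T1 := Rabs_pos c1). assert (T2 := Rabs_pos c0).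
    rewrite Rmult_plus_distr_r, Rmult_assoc.
    assert (Rabs c1 * ((Rabs u + 2 * PI) * exp (alpha * u)) <= Rabs c1 * Ku) by (apply Rmult_le_compat_l; assumption).
    assert (Rabs c0 * exp (alpha * u) <= Rabs c0 * Ku) by (apply Rmult_le_compat_l; assumption). lra. }
set (X := Cmod (RtoC c1 * _ + _)) in *. set (E := exp (- (sigma * alpha * nu))).
assert (HE : 0 < E) by apply exp_pos.
replace (X * (A_pow * exp (alpha * u) * E)) with (A_pow * E * (X * exp (alpha * u))) by ring.
replace (A_pow * Ku * (Rabs c1 + Rabs c0) * E) with (A_pow * E * (Ku * (Rabs c1 + Rabs c0))) by ring.
apply Rmult_le_compat_l; [apply Rmult_le_pos; lra|exact B4].
Qed.

(** Three cases: all zeros lie well to the left of the first edge, well to the right of it, or near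
    it and hence well to the left of the second edge. *)
Lemma location : exists K, 0 < K /\ forall nu J z, (2 <= J)%nat -> far nu (half_node J) -> sector beta z ->
  exists i r, (i <= 1)%nat /\ separated nu z (half_node i) /\
    residues nu (half_node i) (half_node J) z r /\
    forall c1 c0, Cmod (r 1 (num nu c1 c0) - Ci * RtoC (2 * PI) / RtoC sigma * Theta nu c1 c0 z)
       <= K * (Rabs c1 + Rabs c0) * exp (- (sigma * alpha * nu)).
Proof.
destruct Theta_small as [K [HK HS]]. assert (P := Phi_bounds). assert (Hth := sep_bounds).
assert (H2pi : 0 < 2 * PI / sigma) by (apply Rdiv_lt_0_compat; lra).
exists (2 * PI / sigma * K). split; [now apply Rmult_lt_0_compat|].
intros nu J z HJ Hfar Hz.
assert (Hz1 := sector_Cmod_le_1 beta z Hbeta Hz).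
assert (Hz2 : z = 0 \/ exists lam phi, z = Cexp (lam, phi) /\ - Phi <= phi <= Phi).
{ destruct (sector_polar beta z Hbeta Hz) as [x [phi [Hx [Hp ->]]]].
  destruct (Req_dec x 0) as [->|N]; [left; ring|]. right. exists (ln x), phi. split; [|exact Hp].
  unfold Cexp; simpl. rewrite exp_ln, exp_0 by lra. unfold RtoC, Cmult; simpl. f_equal; ring. }
assert (Hr0 : forall a, 0 <= K * (Rabs a)).
{ intros a. apply Rmult_le_pos; [lra|apply Rabs_pos]. }
assert (Hsmall : forall i, (i <= 1)%nat -> ratio nu z (half_node i) <= sep ->
  exists i r, (i <= 1)%nat /\ separated nu z (half_node i) /\
    residues nu (half_node i) (half_node J) z r /\
    forall c1 c0, Cmod (r 1 (num nu c1 c0) - Ci * RtoC (2 * PI) / RtoC sigma * Theta nu c1 c0 z)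
       <= 2 * PI / sigma * K * (Rabs c1 + Rabs c0) * exp (- (sigma * alpha * nu))).
{ intros i Hi Hr. exists i, (fun _ _ => RtoC 0). split; [exact Hi|]. split; [now left|]. split.
  - left. split; [lra|reflexivity].
  - intros c1 c0. unfold Cminus. rewrite Cplus_0_l, Cmod_opp, Cmod_mult.
    rewrite Cmod_div by apply sigma_neq_0. rewrite Cmod_mult, Cmod_Ci, !Cmod_R, !Rabs_pos_eq, Rmult_1_l by lra.
    rewrite !(Rmult_assoc (2 * PI / sigma)). apply Rmult_le_compat_l; [lra|].
    destruct Hz2 as [->|[lam [phi [-> Hp]]]].
    + unfold Theta. destruct (Ceq_dec 0 0) as [_|N]; [|now destruct N]. rewrite Cmod_0.
      apply Rmult_le_pos; [|left; apply exp_pos]. apply Rmult_le_pos; [lra|].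
      assert (T1 := Rabs_pos c1). assert (T2 := Rabs_pos c0). lra.
    + apply (HS nu c1 c0 lam phi (half_node i) Hp); [|lra].
      eapply Rle_trans; [apply half_node_le; exact Hi|apply half_node_1_le_2]. }
destruct (Rle_dec (ratio nu z (half_node 0)) sep) as [L|L]; [apply (Hsmall 0%nat); [lia|exact L]|].
destruct (Rle_dec (/ sep) (ratio nu z (half_node 0))) as [L2|L2].
- destruct Hz2 as [->|[lam [phi [-> Hp]]]].
  { exfalso. apply L. unfold ratio. rewrite Cmod_0. lra. }
  exists 0%nat, (fun e g => Ci * RtoC (2 * PI) * (g (zpole nu lam phi e) / RtoC sigma))%C.
  split; [lia|]. split; [now right|]. split.
  + right. exists lam, phi. split; [reflexivity|]. split; [exact Hp|]. split; [|reflexivity].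
    assert (H1 : 1 < / sep) by (rewrite <- Rinv_1; apply Rinv_lt_contravar; lra).
    assert (R1 : 1 < ratio nu (Cexp (lam, phi)) (half_node 0)) by lra.
    assert (R2 := far_ratio nu (half_node J) _ Hfar Hz1).
    assert (R3 : ratio nu (Cexp (lam, phi)) (half_node J) < 1) by lra.
    unfold ratio in R1, R3. rewrite Cmod_Cexp in R1, R3. simpl in R1, R3. rewrite <- exp_plus, <- exp_0 in R1, R3.
    apply exp_lt_inv in R1. apply exp_lt_inv in R3.
    split; apply (Rmult_lt_reg_l sigma); try exact Hsigma.
    * replace (sigma * (nu + (lam - ln A) / sigma)) with (sigma * nu + lam - ln A) by (field; lra). lra.
    * replace (sigma * (nu + (lam - ln A) / sigma)) with (sigma * nu + lam - ln A) by (field; lra). lra.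
  + intros c1 c0. rewrite num_zpole by exact Hp.
    replace (Ci * RtoC (2 * PI) * (Theta nu c1 c0 (Cexp (lam, phi)) / RtoC sigma) -
      Ci * RtoC (2 * PI) / RtoC sigma * Theta nu c1 c0 (Cexp (lam, phi)))%C with (RtoC 0) by (unfold Cdiv; ring).
    rewrite Cmod_0. apply Rmult_le_pos; [|left; apply exp_pos].
    apply Rmult_le_pos; [apply Rmult_le_pos; lra|]. assert (T1 := Rabs_pos c1). assert (T2 := Rabs_pos c0). lra.
- apply (Hsmall 1%nat); [lia|]. apply ratio_half_node_1. lra.
Qed.

(** * Rates *)

Let D0 := sigma * alpha - 4 * PI * v0.
Definition rate_exponent : R := Rmin (sigma * alpha) (4 * PI * v0).
(** Chosen so that [y >= 2] at distance [margin - 1] beyond [sqrt N1]. *)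
Definition margin : R := Rmax 2 ((ln 2 - ln A) / sigma) + 1.
Definition rate (nu : R) : R := exp (- (rate_exponent * nu)).
Definition log_rate (nu : R) : R :=
  if Rle_dec (sigma * alpha) (4 * PI * v0) then (1 + nu) * rate nu else rate nu.

Lemma margin_ge_3 : 3 <= margin.
Proof. unfold margin. assert (T := Rmax_l 2 ((ln 2 - ln A) / sigma)). lra. Qed.

Lemma rate_exponent_pos : 0 < rate_exponent.
Proof.
assert (HV := lowest_zero_height_bounds). destruct heights as [Hv _]. assert (P := PI_RGT_0).
unfold rate_exponent. apply Rmin_glb_lt; [now apply Rmult_lt_0_compat|]. apply Rmult_lt_0_compat; lra.
Qed.

Lemma rate_pos (nu : R) : 0 < rate nu.
Proof. apply exp_pos. Qed.

Lemma rate_le_log_rate (nu : R) : 0 <= nu -> rate nu <= log_rate nu.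
Proof. intros H. unfold log_rate. assert (T := rate_pos nu). destruct (Rle_dec _ _); nra. Qed.

Lemma cutoff_exists (N1 : nat) : exists J, (2 <= J)%nat /\ (N1 <= J)%nat /\
  far (sqrt (INR N1)) (half_node J) /\ half_node J <= sqrt (INR N1) + margin.
Proof.
set (nu := sqrt (INR N1)). assert (Hnu : 0 <= nu) by apply sqrt_pos.
assert (Hnu2 : nu * nu = INR N1) by apply node_sqr.
set (c := Rmax 2 ((ln 2 - ln A) / sigma)).
assert (Hc : 2 <= c) by apply Rmax_l. assert (Hc2 : (ln 2 - ln A) / sigma <= c) by apply Rmax_r.
destruct (nfloor_ex ((nu + c) * (nu + c))) as [J0 [H1 H2]]; [nra|].
exists (S J0).
assert (E := half_node_sqr (S J0)). assert (T := half_node_pos (S J0)). rewrite S_INR in E.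
assert (L : nu + c <= half_node (S J0)).
{ apply Rnot_lt_le. intros L. nra. }
repeat split.
- assert (2 * 2 <= (nu + c) * (nu + c)) by (apply Rmult_le_compat; lra).
  apply INR_le. rewrite (S_INR J0). change (INR 2) with (1 + 1). lra.
- assert (nu * nu <= (nu + c) * (nu + c)) by (apply Rmult_le_compat; lra).
  apply INR_le. rewrite S_INR. lra.
- unfold far. rewrite <- (exp_ln 2) at 1 by lra. apply exp_le.
  apply (Rmult_le_compat_l sigma) in Hc2; [|lra].
  replace (sigma * ((ln 2 - ln A) / sigma)) with (ln 2 - ln A) in Hc2 by (field; lra). nra.
- unfold margin. fold c. apply Rnot_lt_le. intros L2. nra.
Qed.

(** The exponent is affine in [x] and is therefore maximal at an end of the interval. *)
Lemma decay_le (nu x : R) : 0 <= nu -> 0 <= x <= nu + margin -> decay nu x <= exp (Rabs D0 * margin) * rate nu.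
Proof.
intros Hnu Hx. unfold decay, rate. rewrite <- exp_plus. apply exp_le. fold D0.
assert (M1 : rate_exponent <= sigma * alpha) by apply Rmin_l. assert (M2 : rate_exponent <= 4 * PI * v0) by apply Rmin_r.
assert (Hc := margin_ge_3). destruct (Rle_dec 0 D0) as [L|L].
- rewrite Rabs_pos_eq by exact L.
  assert (T : D0 * x <= D0 * (nu + margin)) by (apply Rmult_le_compat_l; lra).
  assert (T2 : rate_exponent * nu <= 4 * PI * v0 * nu) by (apply Rmult_le_compat_r; lra).
  assert (E : D0 * nu = sigma * alpha * nu - 4 * PI * v0 * nu) by (unfold D0; ring). lra.
- rewrite Rabs_left by lra.
  assert (T : D0 * x <= 0) by nra.
  assert (T2 : rate_exponent * nu <= sigma * alpha * nu) by (apply Rmult_le_compat_r; lra).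
  assert (T3 : 0 <= - D0 * margin) by nra. lra.
Qed.

(** If the exponential increases with [x], its distance to the right end absorbs the linear factor;
    otherwise this factor is of order [nu]. *)
Lemma decay_linear_le : exists K, 0 < K /\ forall nu x, 0 <= nu -> 0 <= x <= nu + margin ->
  Rabs (x - nu) * decay nu x <= K * log_rate nu.
Proof.
assert (Hc := margin_ge_3). assert (He := exp_pos (Rabs D0 * margin)).
unfold log_rate. destruct (Rle_dec (sigma * alpha) (4 * PI * v0)) as [L|L].
- exists (exp (Rabs D0 * margin) * (1 + margin)). split; [apply Rmult_lt_0_compat; lra|].
  intros nu x Hnu Hx. assert (T := decay_le nu x Hnu Hx). assert (HR := rate_pos nu).
  assert (T2 : Rabs (x - nu) <= (1 + margin) * (1 + nu)) by (apply Rabs_le; nra).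
  assert (T3 : 0 < decay nu x) by apply exp_pos.
  apply Rle_trans with ((1 + margin) * (1 + nu) * (exp (Rabs D0 * margin) * rate nu)); [|right; ring].
  apply Rmult_le_compat; [apply Rabs_pos|lra|exact T2|exact T].
- assert (HD : 0 < D0) by (unfold D0; lra).
  assert (Hmu : rate_exponent = 4 * PI * v0) by (unfold rate_exponent; rewrite Rmin_right; lra).
  exists (exp (D0 * margin) * (/ D0 + margin)). assert (Hi : 0 < / D0) by now apply Rinv_0_lt_compat.
  assert (He2 := exp_pos (D0 * margin)). split; [apply Rmult_lt_0_compat; lra|].
  intros nu x Hnu Hx. set (u := x - nu - margin). assert (Hu : u <= 0) by (unfold u; lra).
  assert (E : decay nu x = exp (D0 * u) * exp (D0 * margin) * rate nu).
  { unfold decay, rate. rewrite <- !exp_plus. f_equal. rewrite Hmu. unfold u, D0. ring. }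
  rewrite E. assert (T := mult_exp_neg_le D0 u HD Hu).
  assert (T2 : exp (D0 * u) <= 1) by (rewrite <- exp_0; apply exp_le; nra).
  assert (T3 := exp_pos (D0 * u)). assert (HR := rate_pos nu).
  assert (T4 : Rabs (x - nu) <= - u + margin) by (apply Rabs_le; unfold u; lra).
  replace (Rabs (x - nu) * (exp (D0 * u) * exp (D0 * margin) * rate nu)) with (exp (D0 * margin) * (Rabs (x - nu) * exp (D0 * u)) * rate nu) by ring.
  apply Rmult_le_compat_r; [lra|]. apply Rmult_le_compat_l; [lra|].
  apply Rle_trans with ((- u + margin) * exp (D0 * u)); [apply Rmult_le_compat_r; lra|].
  rewrite Rmult_plus_distr_r. apply Rplus_le_compat; [exact T|]. nra.
Qed.

(** Degrees proportional to [nu] make [rho^n] smaller than any fixed exponential in [nu], with room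
    for polynomial factors, as [1 + nu <= exp nu]. *)
Lemma geometric_small (rho : R) : 0 < rho < 1 -> exists D, 0 < D /\
  forall nu n, 0 <= nu -> D * nu <= INR n -> (1 + nu) ^ 3 * rho ^ n <= rate nu.
Proof.
intros Hr. assert (Hl : ln rho < 0) by (rewrite <- ln_1; apply ln_increasing; lra). assert (Hm := rate_exponent_pos).
(* the summand [3] pays for the factor [(1 + nu)^3] *)
exists ((rate_exponent + 3) / - ln rho). split; [apply Rdiv_lt_0_compat; lra|].
intros nu n Hnu Hn.
assert (E1 : rho ^ n = exp (INR n * ln rho)) by (rewrite <- Rpower_pow by lra; reflexivity).
assert (E2 : INR n * ln rho <= - ((rate_exponent + 3) * nu)).
{ apply (Rmult_le_compat_l (- ln rho)) in Hn; [|lra].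
  replace (- ln rho * ((rate_exponent + 3) / - ln rho * nu)) with ((rate_exponent + 3) * nu) in Hn by (field; lra). lra. }
assert (E3 : (1 + nu) ^ 3 <= exp (3 * nu)).
{ replace (3 * nu) with (nu + nu + nu) by ring. rewrite !exp_plus.
  assert (T : 1 + nu <= exp nu) by (destruct (Req_dec nu 0) as [->|N]; [rewrite exp_0; lra|left; apply exp_ineq1; lra]).
  replace ((1 + nu) ^ 3) with ((1 + nu) * (1 + nu) * (1 + nu)) by ring.
  repeat apply Rmult_le_compat; nra. }
rewrite E1. apply Rle_trans with (exp (3 * nu) * exp (- ((rate_exponent + 3) * nu))).
- apply Rmult_le_compat; [apply pow_le; lra|left; apply exp_pos|exact E3|now apply exp_le].
- right. unfold rate. rewrite <- exp_plus. f_equal. ring.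
Qed.

Definition weight_linear (k nu c1 c0 : R) : Prop :=
  forall x y, 0 <= x <= nu + margin -> - V <= y <= V -> Cmod (weight c1 c0 (pt x y)) <= k * (1 + nu).

Lemma weight_linear_num_bound (k nu c1 c0 : R) (J : nat) : 0 <= k -> 0 <= nu -> half_node J <= nu + margin ->
  weight_linear k nu c1 c0 ->
  num_bound nu c1 c0 (half_node J) (k * (A_pow * exp (alpha * sigma * margin)) * (1 + nu)).
Proof.
intros Hk Hnu HJ Ho x y Hx Hy. assert (T := half_node_pos 0). unfold num. rewrite Cmod_mult, Cmod_y_pow.
replace (k * (A_pow * exp (alpha * sigma * margin)) * (1 + nu)) with (k * (1 + nu) * (A_pow * exp (alpha * sigma * margin))) by ring.
apply Rmult_le_compat; [apply Cmod_ge_0|left; apply exp_pos|apply Ho; [lra|exact Hy]|].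
unfold A_pow. rewrite <- exp_plus. apply exp_le.
assert (alpha * sigma * (x - nu) <= alpha * sigma * margin) by (apply Rmult_le_compat_l; [nra|lra]). lra.
Qed.

Lemma cutoff_count (nu : R) (J : nat) : 0 <= nu -> half_node J <= nu + margin -> INR (S J) <= (margin + 1) ^ 2 * (1 + nu) ^ 2.
Proof.
intros Hnu HJ. assert (E := half_node_sqr J). assert (T := half_node_pos J). assert (Hc := margin_ge_3). rewrite S_INR.
assert (T2 : half_node J * half_node J <= (nu + margin) * (nu + margin)) by (apply Rmult_le_compat; lra).
assert (T3 : (nu + margin) * (nu + margin) + 1 <= ((margin + 1) * (1 + nu)) * ((margin + 1) * (1 + nu))) by nra.
replace ((margin + 1) ^ 2 * (1 + nu) ^ 2) with (((margin + 1) * (1 + nu)) * ((margin + 1) * (1 + nu))) by ring. lra.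
Qed.

Lemma quadrature_approx (k : R) : 0 <= k -> exists K D, 0 < K /\ 0 < D /\
  forall c1 c0 W (N1 J n : nat), (1 <= N1)%nat -> (2 <= J)%nat -> (N1 <= J)%nat ->
    let nu := sqrt (INR N1) in
    far nu (half_node J) -> half_node J <= nu + margin -> D * nu <= INR n ->
    weight_linear k nu c1 c0 -> wbound nu c1 c0 (half_node J) W -> rate nu <= W ->
    exists a P, is_poly n P /\ forall z, sector beta z ->
      forall i r, (i <= 1)%nat -> separated nu z (half_node i) ->
      residues nu (half_node i) (half_node J) z r ->
      Cmod (fractions N1 a z + P z - hseg (integrand nu c1 c0 z) (half_node i) (half_node J) (- v1)) <= K * W.
Proof.
intros Hk. destruct quadrature_theorem as [K1 [rho [HK1 [Hrho HQ]]]].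
destruct (geometric_small rho Hrho) as [D [HD HG]].
set (k2 := k * (A_pow * exp (alpha * sigma * margin))).
assert (Hk2 : 0 <= k2).
{ unfold k2. apply Rmult_le_pos; [exact Hk|]. apply Rmult_le_pos; [left; apply A_pow_pos|left; apply exp_pos]. }
assert (Hc := margin_ge_3). assert (Hc2 : 0 <= (margin + 1) ^ 2 * k2) by (apply Rmult_le_pos; [apply pow_le; lra|exact Hk2]).
exists (K1 * (1 + (margin + 1) ^ 2 * k2)), D. split; [apply Rmult_lt_0_compat; lra|]. split; [exact HD|].
intros c1 c0 W N1 J n HN1 HJ HNJ nu Hfar HJc Hn Ho HW HWr.
assert (Hnu : 0 <= nu) by apply sqrt_pos. assert (HR := rate_pos nu).
destruct (HQ c1 c0 W (k2 * (1 + nu)) N1 J n HN1 HJ HNJ Hfar HW ltac:(fold nu; lra)) as [a [P [HP HE]]].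
- now apply weight_linear_num_bound.
- apply Rmult_le_pos; lra.
- exists a, P. split; [exact HP|]. intros z Hz i r Hi Hsep Hres.
  eapply Rle_trans; [apply (HE z Hz i r Hi Hsep Hres)|]. rewrite (Rmult_assoc K1). apply Rmult_le_compat_l; [lra|].
  specialize (HG nu n Hnu Hn). assert (HJn := cutoff_count nu J Hnu HJc).
  assert (R0 : 0 <= rho ^ n) by (apply pow_le; lra).
  assert (B : INR (S J) * (k2 * (1 + nu)) * rho ^ n <= (margin + 1) ^ 2 * k2 * W).
  { apply Rle_trans with ((margin + 1) ^ 2 * (1 + nu) ^ 2 * (k2 * (1 + nu)) * rho ^ n).
    - apply Rmult_le_compat_r; [exact R0|]. apply Rmult_le_compat_r; [apply Rmult_le_pos; lra|exact HJn].
    - replace ((margin + 1) ^ 2 * (1 + nu) ^ 2 * (k2 * (1 + nu)) * rho ^ n) with ((margin + 1) ^ 2 * k2 * ((1 + nu) ^ 3 * rho ^ n)) by ring.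
      apply Rmult_le_compat_l; lra. }
  lra.
Qed.

Lemma period_approx (k : R) : 0 <= k -> exists K D, 0 < K /\ 0 < D /\
  forall c1 c0 W nu (J n : nat), 0 <= nu -> (2 <= J)%nat ->
    far nu (half_node J) -> half_node J <= nu + margin -> D * nu <= INR n ->
    weight_linear k nu c1 c0 -> wbound nu c1 c0 (half_node 1) W -> rate nu <= W ->
    exists P, is_poly n P /\ forall z, sector beta z ->
      forall i r, (i <= 1)%nat -> separated nu z (half_node i) ->
      residues nu (half_node i) (half_node J) z r ->
      let I0 c1 c0 := hseg (integrand nu c1 c0 z) (half_node i) (half_node J) (- v1) in
      let q := Cexp (0, alpha * (2 * PI))%R in
      Cmod ((1 - q) * I0 c1 c0 - q * (RtoC (2 * PI * c1) * Ci) * I0 0 1 - r 1 (num nu c1 c0) + P z) <= K * W.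
Proof.
intros Hk. destruct period_theorem as [K1 [HK1 HQ]].
destruct (geometric_small (1 / 2) ltac:(lra)) as [D [HD HG]].
set (k2 := k * (A_pow * exp (alpha * sigma * margin))).
assert (Hk2 : 0 <= k2).
{ unfold k2. apply Rmult_le_pos; [exact Hk|]. apply Rmult_le_pos; [left; apply A_pow_pos|left; apply exp_pos]. }
exists (K1 * (1 + k2)), D. split; [apply Rmult_lt_0_compat; lra|]. split; [exact HD|].
intros c1 c0 W nu J n Hnu HJ Hfar HJc Hn Ho HW HWr.
assert (HR := rate_pos nu).
destruct (HQ c1 c0 W (k2 * (1 + nu)) nu J n HJ Hfar HW ltac:(lra)) as [P [HP HE]].
- now apply weight_linear_num_bound.
- apply Rmult_le_pos; lra.
- exists P. split; [exact HP|]. intros z Hz i r Hi Hsep Hres I0 q.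
  eapply Rle_trans; [apply (HE z Hz i r Hi Hsep Hres)|]. rewrite (Rmult_assoc K1). apply Rmult_le_compat_l; [lra|].
  specialize (HG nu n Hnu Hn).
  assert (R0 : 0 <= (1 / 2) ^ n) by (apply pow_le; lra).
  set (h := (1 / 2) ^ n) in *.
  assert (B : k2 * (1 + nu) * h <= k2 * W).
  { rewrite Rmult_assoc. apply Rmult_le_compat_l; [exact Hk2|].
    apply Rle_trans with ((1 + nu) ^ 3 * h); [|lra]. apply Rmult_le_compat_r; [exact R0|]. nra. }
  lra.
Qed.

Lemma weight_0_1 (x y : R) : weight 0 1 (pt x y) = 1.
Proof. unfold weight. ring. Qed.

Lemma weight_log (nu x y : R) : weight 1 (ln A - sigma * nu) (pt x y) = pt (sigma * (x - nu) + ln A) (sigma * y).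
Proof. unfold weight, pt, RtoC, Cmult, Cplus; simpl. f_equal; ring. Qed.

Lemma weight_1_0 (x y : R) : weight 1 0 (pt x y) = pt (sigma * x) (sigma * y).
Proof. unfold weight, pt, RtoC, Cmult, Cplus; simpl. f_equal; ring. Qed.

Lemma Rabs_sigma_y (y : R) : - V <= y <= V -> Rabs (sigma * y) <= 2 * PI.
Proof. intros H. assert (E := sigma_period). apply Rabs_le. nra. Qed.

Definition weight_const : R := sigma * (1 + margin) + Rabs (ln A) + 2 * PI + 1.

Lemma weight_const_pos : 0 < weight_const.
Proof. unfold weight_const. assert (T := Rabs_pos (ln A)). assert (P := PI_RGT_0). assert (Hc := margin_ge_3). nra. Qed.

Lemma weight_linear_cases (nu : R) : 0 <= nu ->
  weight_linear weight_const nu 0 1 /\ weight_linear weight_const nu 1 (ln A - sigma * nu) /\ weight_linear weight_const nu 1 0.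
Proof.
intros Hnu. assert (T := Rabs_pos (ln A)). assert (P := PI_RGT_0). assert (Hc := margin_ge_3).
assert (Hs : 0 <= sigma * margin) by nra. assert (Hs2 : 0 <= sigma * nu) by nra.
assert (B0 : sigma * (nu + margin) <= sigma * (1 + margin) * (1 + nu)).
{ rewrite Rmult_assoc. apply Rmult_le_compat_l; nra. }
assert (B : sigma * (nu + margin) + Rabs (ln A) + 2 * PI + 1 <= weight_const * (1 + nu)).
{ unfold weight_const. assert (0 <= Rabs (ln A) * nu) by nra. assert (0 <= PI * nu) by nra. lra. }
repeat split; intros x y Hx Hy; assert (Ty := Rabs_sigma_y y Hy).
- rewrite weight_0_1, Cmod_1. nra.
- rewrite weight_log. eapply Rle_trans; [apply Cmod_le_Re_Im|]. simpl.
  assert (T1 := Rabs_triang (sigma * (x - nu)) (ln A)).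
  assert (T2 : Rabs (sigma * (x - nu)) <= sigma * (nu + margin)) by (apply Rabs_le; nra). lra.
- rewrite weight_1_0. eapply Rle_trans; [apply Cmod_le_Re_Im|]. simpl.
  assert (T2 : Rabs (sigma * x) <= sigma * (nu + margin)) by (apply Rabs_le; nra). lra.
Qed.

Lemma wbound_cases : exists K, 1 <= K /\ forall nu (J : nat), 0 <= nu -> half_node J <= nu + margin ->
  wbound nu 0 1 (half_node J) (K * rate nu) /\ wbound nu 0 1 (half_node 1) (K * rate nu) /\
  wbound nu 1 (ln A - sigma * nu) (half_node J) (K * log_rate nu) /\
  wbound nu 1 (ln A - sigma * nu) (half_node 1) (K * log_rate nu) /\
  wbound nu 1 0 (half_node 1) (K * rate nu).
Proof.
destruct decay_linear_le as [K1 [HK1 HL]]. assert (P := PI_RGT_0). assert (TA := Rabs_pos (ln A)).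
assert (Hc := margin_ge_3). assert (Hh := half_node_pos 0). assert (Hh1 := half_node_1_le_2).
set (E := exp (Rabs D0 * margin)). assert (HE : 0 < E) by apply exp_pos.
set (k := 1 + (1 + 2 * sigma + Rabs (ln A) + 2 * PI) * E + sigma * K1).
assert (Hk1 : 0 <= sigma * K1) by nra.
assert (Hk2 : E <= (1 + 2 * sigma + Rabs (ln A) + 2 * PI) * E) by nra.
exists k. split; [unfold k; lra|].
intros nu J Hnu HJ.
assert (HA1 : forall xm, xm <= nu + margin -> wbound nu 0 1 xm (k * rate nu)).
{ intros xm Hxm x y Hx Hy. rewrite weight_0_1, Cmod_1, Rmult_1_l.
  eapply Rle_trans; [apply decay_le; [exact Hnu|lra]|]. apply Rmult_le_compat_r; [left; apply rate_pos|].
  fold E. unfold k. lra. }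
assert (HB1 : forall xm, xm <= nu + margin -> wbound nu 1 (ln A - sigma * nu) xm (k * log_rate nu)).
{ intros xm Hxm x y Hx Hy. rewrite weight_log.
  assert (T := decay_le nu x Hnu ltac:(lra)). assert (T2 := HL nu x Hnu ltac:(lra)). fold E in T.
  assert (TL : 0 < decay nu x) by apply exp_pos. assert (TR := rate_le_log_rate nu Hnu). assert (TR0 := rate_pos nu).
  apply Rle_trans with ((sigma * Rabs (x - nu) + (Rabs (ln A) + 2 * PI)) * decay nu x).
  - apply Rmult_le_compat_r; [lra|]. eapply Rle_trans; [apply Cmod_le_Re_Im|]. simpl.
    assert (T1 := Rabs_triang (sigma * (x - nu)) (ln A)). rewrite Rabs_mult, (Rabs_pos_eq sigma) in T1 by lra.
    assert (Ty := Rabs_sigma_y y Hy). lra.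
  - rewrite Rmult_plus_distr_r, Rmult_assoc.
    assert (U1 : sigma * (Rabs (x - nu) * decay nu x) <= sigma * (K1 * log_rate nu)) by (apply Rmult_le_compat_l; lra).
    assert (U2 : (Rabs (ln A) + 2 * PI) * decay nu x <= (Rabs (ln A) + 2 * PI) * (E * log_rate nu)).
    { apply Rmult_le_compat_l; [lra|]. eapply Rle_trans; [exact T|]. apply Rmult_le_compat_l; lra. }
    assert (U3 : 0 <= E * log_rate nu) by (apply Rmult_le_pos; lra).
    assert (U4 : 0 <= sigma * (E * log_rate nu)) by (apply Rmult_le_pos; lra).
    assert (U5 : k * log_rate nu = log_rate nu + E * log_rate nu + 2 * (sigma * (E * log_rate nu)) +
      (Rabs (ln A) + 2 * PI) * (E * log_rate nu) + sigma * (K1 * log_rate nu)) by (unfold k; ring).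
    lra. }
split; [now apply HA1|]. split; [apply HA1; lra|]. split; [now apply HB1|]. split; [apply HB1; lra|].
intros x y Hx Hy. rewrite weight_1_0.
assert (T := decay_le nu x Hnu ltac:(lra)). fold E in T.
assert (TL : 0 < decay nu x) by apply exp_pos. assert (TR0 := rate_pos nu).
apply Rle_trans with ((2 * sigma + 2 * PI) * (E * rate nu)).
- apply Rmult_le_compat; [apply Cmod_ge_0|lra| |exact T].
  eapply Rle_trans; [apply Cmod_le_Re_Im|]. simpl. assert (Ty := Rabs_sigma_y y Hy).
  rewrite Rabs_pos_eq by nra. nra.
- assert (U3 : 0 < E * rate nu) by (apply Rmult_lt_0_compat; lra).
  assert (U5 : k * rate nu = rate nu + E * rate nu + (2 * sigma + 2 * PI) * (E * rate nu) +
      Rabs (ln A) * (E * rate nu) + (sigma * K1) * rate nu) by (unfold k; ring).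
  assert (0 <= Rabs (ln A) * (E * rate nu)) by (apply Rmult_le_pos; lra).
  assert (0 <= sigma * K1 * rate nu) by (apply Rmult_le_pos; lra). lra.
Qed.

Lemma exp_sigma_alpha_le (nu : R) : 0 <= nu -> exp (- (sigma * alpha * nu)) <= rate nu.
Proof.
intros Hnu. apply exp_le. assert (M1 : rate_exponent <= sigma * alpha) by apply Rmin_l.
assert (rate_exponent * nu <= sigma * alpha * nu) by (apply Rmult_le_compat_r; lra). lra.
Qed.

Lemma location_rates : exists K, 0 < K /\ forall nu J z, 0 <= nu -> (2 <= J)%nat -> far nu (half_node J) -> sector beta z ->
  exists i r, (i <= 1)%nat /\ separated nu z (half_node i) /\
    residues nu (half_node i) (half_node J) z r /\
    let err c1 c0 := Cmod (r 1 (num nu c1 c0) - Ci * RtoC (2 * PI) / RtoC sigma * Theta nu c1 c0 z) in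
    err 0 1 <= K * rate nu /\ err 1 (ln A - sigma * nu) <= K * log_rate nu /\ err 1 0 <= K * rate nu.
Proof.
destruct location as [K [HK HL]]. destruct decay_linear_le as [K1 [HK1 HLam]]. assert (TA := Rabs_pos (ln A)).
exists (K * (1 + Rabs (ln A) + sigma * K1)). split; [apply Rmult_lt_0_compat; [lra|nra]|].
intros nu J z Hnu HJ Hfar Hz. destruct (HL nu J z HJ Hfar Hz) as [i [r [Hi [Hs [Hr HE]]]]].
exists i, r. repeat (split; [assumption|]). intros err.
assert (E0 := exp_sigma_alpha_le nu Hnu). assert (R0 := rate_pos nu). assert (RL := rate_le_log_rate nu Hnu).
set (X := exp (- (sigma * alpha * nu))) in *. assert (HX : 0 < X) by apply exp_pos.
assert (Hs1 : 0 <= sigma * K1) by nra.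
assert (U : rate nu <= (1 + Rabs (ln A) + sigma * K1) * rate nu).
{ assert (0 <= (Rabs (ln A) + sigma * K1) * rate nu) by (apply Rmult_le_pos; lra). lra. }
assert (Hgen : forall c1 c0, Rabs c1 + Rabs c0 = 1 -> err c1 c0 <= K * (1 + Rabs (ln A) + sigma * K1) * rate nu).
{ intros c1 c0 Hc. eapply Rle_trans; [apply HE|]. rewrite Hc, Rmult_1_r. rewrite Rmult_assoc.
  apply Rmult_le_compat_l; [lra|]. fold X. lra. }
split; [apply Hgen; rewrite Rabs_R0, Rabs_R1; ring|]. split; [|apply Hgen; rewrite Rabs_R0, Rabs_R1; ring].
eapply Rle_trans; [apply HE|]. rewrite !(Rmult_assoc K). apply Rmult_le_compat_l; [lra|]. rewrite Rabs_R1. fold X.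
assert (T1 : Rabs (ln A - sigma * nu) <= Rabs (ln A) + sigma * nu).
{ unfold Rminus. eapply Rle_trans; [apply Rabs_triang|]. rewrite Rabs_Ropp, (Rabs_pos_eq (sigma * nu)) by nra. lra. }
assert (Hc := margin_ge_3). assert (T2 := HLam nu 0 Hnu ltac:(lra)).
replace (decay nu 0) with X in T2 by (unfold decay, X; f_equal; ring).
rewrite Rminus_0_l, Rabs_Ropp, (Rabs_pos_eq nu) in T2 by lra.
assert (T3 : (1 + Rabs (ln A)) * X <= (1 + Rabs (ln A)) * log_rate nu) by (apply Rmult_le_compat_l; lra).
assert (T4 : sigma * (nu * X) <= sigma * (K1 * log_rate nu)) by (apply Rmult_le_compat_l; lra).
assert (T5 : (1 + Rabs (ln A - sigma * nu)) * X <= (1 + (Rabs (ln A) + sigma * nu)) * X) by (apply Rmult_le_compat_r; lra).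
lra.
Qed.

Let q := Cexp (0, alpha * (2 * PI))%R.
Let kap := (Ci * RtoC (2 * PI) / RtoC sigma)%C.

(** [IA], [IB] and [IC] are the line integrals with the weights [1], [log y] and [sigma s].  The
    third weight differs from the second by a constant of order [sqrt N1]; it is bounded on
    the left edge, and it enters through its period identity alone. *)
Lemma assembled : exists K D, 0 < K /\ 0 < D /\
  forall N1 n : nat, (1 <= N1)%nat -> let nu := sqrt (INR N1) in D * nu <= INR n ->
  exists aA PA aB PB QA QB QC,
    is_poly n PA /\ is_poly n PB /\ is_poly n QA /\ is_poly n QB /\ is_poly n QC /\
    forall z, sector beta z -> exists IA IB IC : C,
      Cmod (fractions N1 aA z + PA z - IA) <= K * rate nu /\
      Cmod (fractions N1 aB z + PB z - IB) <= K * log_rate nu /\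
      Cmod ((1 - q) * IA - kap * Theta nu 0 1 z + QA z) <= K * rate nu /\
      Cmod ((1 - q) * IB - q * (RtoC (2 * PI) * Ci) * IA - kap * Theta nu 1 (ln A - sigma * nu) z + QB z) <= K * log_rate nu /\
      Cmod ((1 - q) * IC - q * (RtoC (2 * PI) * Ci) * IA - kap * Theta nu 1 0 z + QC z) <= K * rate nu.
Proof.
assert (Hk := weight_const_pos).
destruct (quadrature_approx weight_const (Rlt_le _ _ Hk)) as [K1 [D1 [HK1 [HD1 HQ]]]].
destruct (period_approx weight_const (Rlt_le _ _ Hk)) as [K2 [D2 [HK2 [HD2 HP]]]].
destruct wbound_cases as [Kw [HKw HW]]. destruct location_rates as [K3 [HK3 HL]].
set (K := (K1 + K2) * Kw + K3).
assert (HKp : 0 < (K1 + K2) * Kw) by (apply Rmult_lt_0_compat; lra).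
assert (X1 : K1 * Kw <= (K1 + K2) * Kw) by nra. assert (X2 : K2 * Kw <= (K1 + K2) * Kw) by nra.
exists K, (Rmax D1 D2). split; [unfold K; lra|]. split; [eapply Rlt_le_trans; [exact HD1|apply Rmax_l]|].
intros N1 n HN1 nu Hn. assert (Hnu : 0 <= nu) by apply sqrt_pos.
assert (Hn1 : D1 * nu <= INR n) by (eapply Rle_trans; [apply Rmult_le_compat_r; [exact Hnu|apply Rmax_l]|exact Hn]).
assert (Hn2 : D2 * nu <= INR n) by (eapply Rle_trans; [apply Rmult_le_compat_r; [exact Hnu|apply Rmax_r]|exact Hn]).
destruct (cutoff_exists N1) as [J [HJ [HNJ [Hfar HJc]]]]. fold nu in Hfar, HJc.
destruct (weight_linear_cases nu Hnu) as [OA [OB OC]].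
destruct (HW nu J Hnu HJc) as [WA [WA1 [WB [WB1 WC1]]]].
assert (R0 := rate_pos nu). assert (RL := rate_le_log_rate nu Hnu).
assert (RW : rate nu <= Kw * rate nu) by nra. assert (RWL : rate nu <= Kw * log_rate nu) by nra.
destruct (HQ 0 1 _ N1 J n HN1 HJ HNJ Hfar HJc Hn1 OA WA RW) as [aA [PA [HPA EA]]].
destruct (HQ 1 (ln A - sigma * nu) _ N1 J n HN1 HJ HNJ Hfar HJc Hn1 OB WB RWL) as [aB [PB [HPB EB]]].
destruct (HP 0 1 _ nu J n Hnu HJ Hfar HJc Hn2 OA WA1 RW) as [QA [HQA FA]].
destruct (HP 1 (ln A - sigma * nu) _ nu J n Hnu HJ Hfar HJc Hn2 OB WB1 RWL) as [QB [HQB FB]].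
destruct (HP 1 0 _ nu J n Hnu HJ Hfar HJc Hn2 OC WC1 RW) as [QC [HQC FC]].
exists aA, PA, aB, PB, QA, QB, QC. repeat (split; [assumption|]).
intros z Hz. destruct (HL nu J z Hnu HJ Hfar Hz) as [i [r [Hi [Hs [Hr [LA [LB LC]]]]]]].
set (I0 := fun c1 c0 => hseg (integrand nu c1 c0 z) (half_node i) (half_node J) (- v1)).
exists (I0 0 1), (I0 1 (ln A - sigma * nu)), (I0 1 0).
specialize (EA z Hz i r Hi Hs Hr). specialize (EB z Hz i r Hi Hs Hr).
specialize (FA z Hz i r Hi Hs Hr). specialize (FB z Hz i r Hi Hs Hr). specialize (FC z Hz i r Hi Hs Hr).
cbv zeta in FA, FB, FC. fold q kap in FA, FB, FC, LA, LB, LC. cbv zeta in LA, LB, LC.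
assert (B1 : forall t R1, 0 <= R1 -> t <= K1 * (Kw * R1) -> t <= K * R1).
{ intros t R1 HR1 Ht. eapply Rle_trans; [exact Ht|]. rewrite <- Rmult_assoc. apply Rmult_le_compat_r; [exact HR1|]. unfold K. lra. }
assert (B2 : forall t1 t2 R1, 0 <= R1 -> t1 <= K3 * R1 -> t2 <= K2 * (Kw * R1) -> t1 + t2 <= K * R1).
{ intros t1 t2 R1 HR1 Ht1 Ht2. rewrite <- Rmult_assoc in Ht2.
  assert (K2 * Kw * R1 <= (K1 + K2) * Kw * R1) by (apply Rmult_le_compat_r; assumption).
  unfold K. rewrite Rmult_plus_distr_r. lra. }
split; [apply B1; [lra|exact EA]|]. split; [apply B1; [lra|exact EB]|].
split; [|split].
- eapply Rle_trans; [|refine (B2 _ _ (rate nu) _ LA FA); lra].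
  match goal with |- Cmod ?x <= Cmod ?u + Cmod ?v => replace x with (u + v)%C; [apply Cmod_triangle|] end.
  rewrite Rmult_0_r. unfold I0. ring.
- eapply Rle_trans; [|refine (B2 _ _ (log_rate nu) _ LB FB); lra].
  match goal with |- Cmod ?x <= Cmod ?u + Cmod ?v => replace x with (u + v)%C; [apply Cmod_triangle|] end.
  rewrite Rmult_1_r. unfold I0. ring.
- eapply Rle_trans; [|refine (B2 _ _ (rate nu) _ LC FC); lra].
  match goal with |- Cmod ?x <= Cmod ?u + Cmod ?v => replace x with (u + v)%C; [apply Cmod_triangle|] end.
  rewrite Rmult_1_r. unfold I0. ring.
Qed.

(** * Approximation by rational functions with the given poles *)

Definition approximable (T : C -> C) (rt : R -> R) : Prop :=
  exists K D, 0 < K /\ 0 < D /\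
  forall N1 n : nat, (1 <= N1)%nat -> D * sqrt (INR N1) <= INR n ->
  exists a P, is_poly n P /\ forall z, sector beta z ->
    Cmod (fractions N1 a z + P z - T z) <= K * rt (sqrt (INR N1)).

Lemma sum_n_m_lin (k1 k2 : C) (f g : nat -> C) (a b : nat) :
  sum_n_m (fun j => k1 * f j + k2 * g j)%C a b = (k1 * sum_n_m f a b + k2 * sum_n_m g a b)%C.
Proof.
induction b as [|b IH].
- destruct a as [|a].
  + now rewrite !sum_n_n.
  + rewrite !sum_n_m_zero by lia. change (@eq C 0 (k1 * 0 + k2 * 0)%C). ring.
- destruct (Nat.le_gt_cases a (S b)) as [L|L].
  + rewrite !sum_n_Sm by exact L. rewrite IH. change plus with Cplus.
    match goal with |- ?l = ?r => change (@eq C l r) end. ring.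
  + rewrite !sum_n_m_zero by lia. change (@eq C 0 (k1 * 0 + k2 * 0)%C). ring.
Qed.

Lemma fractions_lin (k1 k2 : C) (a b : nat -> C) (N1 : nat) (z : C) :
  fractions N1 (fun j => k1 * a j + k2 * b j)%C z = (k1 * fractions N1 a z + k2 * fractions N1 b z)%C.
Proof.
unfold fractions. rewrite <- sum_n_m_lin. apply sum_n_m_ext. intros j. unfold Cdiv.
match goal with |- ?l = ?r => change (@eq C l r) end. ring.
Qed.

Lemma kap_neq_0 : kap <> 0.
Proof.
apply Cmod_gt_0. unfold kap. rewrite Cmod_div by apply sigma_neq_0.
assert (P := PI_RGT_0).
rewrite Cmod_mult, Cmod_Ci, !Cmod_R, !Rabs_pos_eq, Rmult_1_l by lra. apply Rdiv_lt_0_compat; lra.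
Qed.

Let ph := Cexp (0, alpha * PI)%R.

Lemma ph_neq_0 : ph <> 0.
Proof. apply Cexp_neq_0. Qed.

Lemma zpow_0 : zpow alpha 0 = 0.
Proof. unfold zpow. destruct (Ceq_dec 0 0) as [_|N]; [reflexivity|now destruct N]. Qed.

Lemma zpow_log_eq (z : C) : zpow_log alpha z = (zpow alpha z * Clog z)%C.
Proof.
unfold zpow_log. destruct (Ceq_dec z 0) as [->|_]; [|reflexivity]. rewrite zpow_0. ring.
Qed.

Lemma Theta_power (nu : R) (z : C) : Theta nu 0 1 z = (zpow alpha z * ph)%C.
Proof.
unfold Theta. destruct (Ceq_dec z 0) as [->|N].
- rewrite zpow_0. ring.
- fold ph. ring.
Qed.

Lemma Theta_1 (nu c0 : R) (z : C) :
  Theta nu 1 c0 z = ((zpow_log alpha z + ((0, PI)%R + RtoC (sigma * nu - ln A + c0)) * zpow alpha z) * ph)%C.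
Proof.
rewrite zpow_log_eq. unfold Theta. destruct (Ceq_dec z 0) as [->|N].
- rewrite zpow_0. ring.
- fold ph. rewrite (RtoC_plus (sigma * nu - ln A) c0). ring.
Qed.

Lemma Cmod_lin3 (k1 k2 k3 u v w : C) (b1 b2 b3 : R) : Cmod u <= b1 -> Cmod v <= b2 -> Cmod w <= b3 ->
  Cmod (k1 * u + k2 * v + k3 * w) <= Cmod k1 * b1 + Cmod k2 * b2 + Cmod k3 * b3.
Proof.
intros H1 H2 H3. eapply Rle_trans; [apply Cmod_triangle|]. rewrite Cmod_mult.
apply Rplus_le_compat; [|apply Rmult_le_compat_l; [apply Cmod_ge_0|exact H3]].
eapply Rle_trans; [apply Cmod_triangle|]. rewrite !Cmod_mult.
apply Rplus_le_compat; apply Rmult_le_compat_l; try apply Cmod_ge_0; assumption.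
Qed.

(** Dividing the period identity by the residue factor and replacing the integral by the quadrature
    sum. *)
Lemma power_approximable : approximable (zpow alpha) rate.
Proof.
destruct assembled as [K [D [HK [HD H]]]].
set (m := (/ (kap * ph))%C).
assert (Hkp : (kap * ph)%C <> 0) by (apply Cmult_neq_0; [apply kap_neq_0|apply ph_neq_0]).
exists ((Cmod (m * (1 - q)) + Cmod m + 1) * K), D.
assert (T1 := Cmod_ge_0 (m * (1 - q))). assert (T2 := Cmod_ge_0 m).
split; [apply Rmult_lt_0_compat; lra|]. split; [exact HD|].
intros N1 n HN1 Hn. destruct (H N1 n HN1 Hn) as [aA [PA [aB [PB [QA [QB [QC [HPA [_ [HQA [_ [_ HE]]]]]]]]]]]].
set (nu := sqrt (INR N1)) in *.
exists (fun j => (m * (1 - q)) * aA j + 0 * 0)%C, (fun z => (m * (1 - q)) * PA z + m * QA z)%C.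
split; [apply is_poly_plus; now apply is_poly_scal|].
intros z Hz. destruct (HE z Hz) as [IA [_ [_ [E1 [_ [E2 _]]]]]].
rewrite (fractions_lin (m * (1 - q)) 0 aA (fun _ => 0)). rewrite Theta_power in E2.
assert (B := Cmod_lin3 (m * (1 - q)) m 0 _ _ 0 _ _ 0 E1 E2 (Req_le _ _ Cmod_0)).
assert (R0 := rate_pos nu).
match goal with |- Cmod ?x <= _ => match type of B with Cmod ?y <= _ => replace x with y end end.
- eapply Rle_trans; [exact B|]. rewrite Cmod_0. nra.
- set (F := fractions N1 aA z). set (F0 := fractions N1 (fun _ => 0) z).
  unfold m. generalize (PA z), (QA z), (zpow alpha z). intros. clear - Hkp.
  assert (H1 : kap <> 0) by (intros E; apply Hkp; rewrite E; ring).
  assert (H2 : ph <> 0) by (intros E; apply Hkp; rewrite E; ring).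
  field. split; assumption.
Qed.

(** With the weight [log y] the residue is that of [z^alpha (log z + i PI)], so the approximation of
    [z^alpha] is used once more. *)
Lemma log_power_approximable : approximable (zpow_log alpha) log_rate.
Proof.
destruct power_approximable as [K0 [D1 [HK0 [HD1 H0]]]].
destruct assembled as [K [D [HK [HD H]]]].
set (m := (/ (kap * ph))%C).
assert (Hkp : (kap * ph)%C <> 0) by (apply Cmult_neq_0; [apply kap_neq_0|apply ph_neq_0]).
set (k1 := (m * (1 - q))%C). set (k2 := (- (m * (q * (RtoC (2 * PI) * Ci))))%C). set (k3 := (- ((0, PI)%R : C))%C).
assert (T1 := Cmod_ge_0 k1). assert (T2 := Cmod_ge_0 k2). assert (T3 := Cmod_ge_0 k3). assert (T4 := Cmod_ge_0 m).
exists ((Cmod k1 + Cmod k2 + Cmod m) * K + Cmod k3 * K0 + 1), (Rmax D D1).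
split.
{ assert (0 <= (Cmod k1 + Cmod k2 + Cmod m) * K) by (apply Rmult_le_pos; lra).
  assert (0 <= Cmod k3 * K0) by (apply Rmult_le_pos; lra). lra. }
split; [eapply Rlt_le_trans; [exact HD|apply Rmax_l]|].
intros N1 n HN1 Hn. set (nu := sqrt (INR N1)) in *. assert (Hnu : 0 <= nu) by apply sqrt_pos.
assert (Hn1 : D * nu <= INR n) by (eapply Rle_trans; [apply Rmult_le_compat_r; [exact Hnu|apply Rmax_l]|exact Hn]).
assert (Hn2 : D1 * nu <= INR n) by (eapply Rle_trans; [apply Rmult_le_compat_r; [exact Hnu|apply Rmax_r]|exact Hn]).
destruct (H N1 n HN1 Hn1) as [aA [PA [aB [PB [QA [QB [QC [HPA [HPB [_ [HQB [_ HE]]]]]]]]]]]].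
destruct (H0 N1 n HN1 Hn2) as [a0 [P0 [HP0 E0]]].
exists (fun j => 1 * (k1 * aB j + k2 * aA j) + k3 * a0 j)%C,
  (fun z => k1 * PB z + k2 * PA z + m * QB z + k3 * P0 z)%C.
split; [repeat apply is_poly_plus; now apply is_poly_scal|].
intros z Hz. destruct (HE z Hz) as [IA [IB [_ [E1 [E2 [_ [E3 _]]]]]]]. specialize (E0 z Hz).
rewrite (fractions_lin 1 k3 (fun j => k1 * aB j + k2 * aA j)%C a0), (fractions_lin k1 k2 aB aA).
rewrite Theta_1 in E3. fold nu in E0, E1, E2, E3.
replace (sigma * nu - ln A + (ln A - sigma * nu)) with 0 in E3 by ring. rewrite Cplus_0_r in E3.
assert (R0 := rate_pos nu). assert (RL := rate_le_log_rate nu Hnu).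
assert (E1' : Cmod (fractions N1 aA z + PA z - IA) <= K * log_rate nu) by nra.
assert (E0' : Cmod (fractions N1 a0 z + P0 z - zpow alpha z) <= K0 * log_rate nu) by nra.
assert (B := Cmod_lin3 k1 k2 m _ _ _ _ _ _ E2 E1' E3).
match type of B with Cmod ?y <= _ => set (Y := y) in * end.
match type of E0' with Cmod ?y <= _ => set (Y0 := y) in * end.
match goal with |- Cmod ?x <= _ => replace x with (Y + k3 * Y0)%C end.
- eapply Rle_trans; [apply Cmod_triangle|]. rewrite Cmod_mult.
  assert (B0 : Cmod k3 * Cmod Y0 <= Cmod k3 * (K0 * log_rate nu)) by (apply Rmult_le_compat_l; assumption). lra.
- unfold Y, Y0. generalize (fractions N1 aB z), (fractions N1 aA z), (fractions N1 a0 z).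
  generalize (PA z), (PB z), (QB z), (P0 z), (zpow alpha z), (zpow_log alpha z). intros.
  unfold k1, k2, k3, m.
  assert (H1 : kap <> 0) by apply kap_neq_0. assert (H2 : ph <> 0) by apply ph_neq_0. clear - H1 H2.
  generalize ((0, PI)%R : C). generalize dependent kap. generalize dependent ph. generalize q. generalize (RtoC (2 * PI)).
  intros. field. split; assumption.
Qed.

Lemma zpow_integer (p : nat) (z : C) : sector beta z -> (1 <= p)%nat -> alpha = INR p -> zpow alpha z = Cpow z p.
Proof.
intros Hz Hp ->. unfold zpow. destruct (Ceq_dec z 0) as [->|N].
- destruct p as [|p]; [lia|]. simpl. ring.
- assert (P := Phi_bounds). destruct (sector_polar beta z Hbeta Hz) as [x [phi [Hx [Hph ->]]]].
  assert (E : (RtoC x * Cexp (0, phi)%R)%C = Cexp (ln x, phi)).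
  { destruct (Req_dec x 0) as [->|Nx]; [now destruct N; ring|].
    unfold Cexp; simpl. rewrite exp_ln, exp_0 by lra. unfold RtoC, Cmult; simpl. f_equal; ring. }
  rewrite E. fold Phi in Hph. rewrite Clog_Cexp by lra. clear.
  induction p as [|p IH].
  + simpl INR. replace (0 * (ln x, phi))%C with (RtoC 0) by ring. rewrite Cexp_0. reflexivity.
  + rewrite S_INR, RtoC_plus, Cpow_S.
    replace ((RtoC (INR p) + 1) * (ln x, phi))%C with ((ln x, phi) + RtoC (INR p) * (ln x, phi))%C by ring.
    now rewrite Cexp_plus, IH.
Qed.

(** For an integral exponent [q = 1], so the weighted integral drops out of the period identity
    and with it the logarithmic loss. *)
Lemma log_integer_approximable (p : nat) : (1 <= p)%nat -> alpha = INR p -> approximable (zpow_log alpha) rate.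
Proof.
intros Hp Ha.
assert (Hq : q = 1).
{ unfold q, Cexp; simpl. rewrite exp_0, Ha.
  replace (INR p * (2 * PI)) with (0 + 2 * INR p * PI) by ring. rewrite cos_period, sin_period, cos_0, sin_0.
  unfold RtoC. f_equal; ring. }
destruct assembled as [K [D [HK [HD H]]]].
set (m := (/ (kap * ph))%C).
assert (Hkp : (kap * ph)%C <> 0) by (apply Cmult_neq_0; [apply kap_neq_0|apply ph_neq_0]).
set (k2 := (- (m * (RtoC (2 * PI) * Ci)))%C).
assert (T2 := Cmod_ge_0 k2). assert (T4 := Cmod_ge_0 m).
exists ((Cmod k2 + Cmod m + 1) * K), (Rmax D (INR p)).
split; [apply Rmult_lt_0_compat; lra|].
split; [eapply Rlt_le_trans; [exact HD|apply Rmax_l]|].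
intros N1 n HN1 Hn. set (nu := sqrt (INR N1)) in *.
assert (Hnu : 1 <= nu).
{ unfold nu. rewrite <- sqrt_1. apply sqrt_le_1; [lra|apply pos_INR|]. now apply (le_INR 1). }
assert (Hn1 : D * nu <= INR n) by (eapply Rle_trans; [apply Rmult_le_compat_r; [lra|apply Rmax_l]|exact Hn]).
assert (Hn2 : (p <= n)%nat).
{ apply INR_le. apply Rle_trans with (INR p * nu); [assert (T := pos_INR p); nra|].
  eapply Rle_trans; [apply Rmult_le_compat_r; [lra|apply Rmax_r]|exact Hn]. }
destruct (H N1 n HN1 Hn1) as [aA [PA [aB [PB [QA [QB [QC [HPA [_ [_ [_ [HQC HE]]]]]]]]]]]].
set (w := ((0, PI)%R + RtoC (sigma * nu - ln A + 0))%C) in *.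
exists (fun j => k2 * aA j + 0 * 0)%C, (fun z => k2 * PA z + m * QC z + (- w) * Cpow z p)%C.
split.
{ repeat apply is_poly_plus; apply is_poly_scal; try assumption. now apply is_poly_pow. }
intros z Hz. destruct (HE z Hz) as [IA [_ [IC [E1 [_ [_ [_ E3]]]]]]].
rewrite (fractions_lin k2 0 aA (fun _ => 0)).
rewrite Theta_1 in E3. fold nu in E1, E3. fold w in E3. rewrite Hq in E3.
rewrite <- (zpow_integer p z Hz Hp Ha).
assert (R0 := rate_pos nu).
assert (B := Cmod_lin3 k2 m 0 _ _ 0 _ _ 0 E1 E3 (Req_le _ _ Cmod_0)).
match goal with |- Cmod ?x <= _ => match type of B with Cmod ?y <= _ => replace x with y end end.
- eapply Rle_trans; [exact B|]. rewrite Cmod_0. nra.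
- generalize (fractions N1 aA z), (fractions N1 (fun _ => 0) z).
  generalize (PA z), (QC z), (zpow alpha z), (zpow_log alpha z). intros.
  unfold k2, m.
  assert (H1 : kap <> 0) by apply kap_neq_0. assert (H2 : ph <> 0) by apply ph_neq_0. clear - H1 H2.
  generalize dependent kap. generalize dependent ph. generalize w. generalize (RtoC (2 * PI)).
  intros. field. split; assumption.
Qed.
End Integrand.

(** * Multiplication by an analytic function *)

Lemma sector_polar_log (beta : R) (z : C) : 0 <= beta < 2 -> sector beta z ->
  z = 0 \/ exists lam phi, z = Cexp (lam, phi) /\ lam <= 0 /\ - PI < phi < PI.
Proof.
intros Hb Hz. assert (P := Phi_bounds beta Hb).
destruct (sector_polar beta z Hb Hz) as [x [phi [Hx [Hp ->]]]].
destruct (Req_dec x 0) as [->|N]; [left; ring|]. right. exists (ln x), phi.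
split; [|split; [|lra]].
- unfold Cexp; simpl. rewrite exp_ln, exp_0 by lra. unfold RtoC, Cmult; simpl. f_equal; ring.
- rewrite <- ln_1. destruct (Req_dec x 1) as [->|N1]; [lra|]. left. apply ln_increasing; lra.
Qed.

Lemma zpow_bound (alpha beta : R) (z : C) : 0 < alpha -> 0 <= beta < 2 -> sector beta z ->
  Cmod (zpow alpha z) <= 1.
Proof.
intros Ha Hb Hz. destruct (sector_polar_log beta z Hb Hz) as [->|[lam [phi [-> [Hl Hp]]]]].
- rewrite zpow_0, Cmod_0. lra.
- rewrite zpow_Cexp by exact Hp. rewrite Cmod_Cexp. rewrite <- exp_0. apply exp_le. simpl. nra.
Qed.

Lemma zpow_log_bound (alpha beta : R) (z : C) : 0 < alpha -> 0 <= beta < 2 -> sector beta z ->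
  Cmod (zpow_log alpha z) <= / alpha + PI.
Proof.
intros Ha Hb Hz. assert (P := PI_RGT_0). assert (Hi : 0 < / alpha) by now apply Rinv_0_lt_compat.
destruct (sector_polar_log beta z Hb Hz) as [->|[lam [phi [-> [Hl Hp]]]]].
- rewrite zpow_log_eq, zpow_0, Cmult_0_l, Cmod_0. lra.
- rewrite zpow_log_eq, zpow_Cexp, Clog_Cexp by exact Hp. rewrite Cmod_mult, Cmod_Cexp.
  replace (Re (RtoC alpha * (lam, phi))) with (alpha * lam) by (simpl; ring).
  assert (T := mult_exp_neg_le alpha lam Ha Hl). assert (E := exp_pos (alpha * lam)).
  assert (E1 : exp (alpha * lam) <= 1) by (rewrite <- exp_0; apply exp_le; nra).
  apply Rle_trans with (exp (alpha * lam) * (- lam + PI)); [|nra].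
  apply Rmult_le_compat_l; [lra|]. eapply Rle_trans; [apply Cmod_le_Re_Im|]. simpl.
  rewrite (Rabs_left1 lam) by lra. apply Rplus_le_compat_l. apply Rabs_le. lra.
Qed.

Lemma pole_off_sector (sigma A beta : R) (z : C) (N1 j : nat) : 0 < A -> 0 <= beta < 2 -> sector beta z ->
  (z - RtoC (pole A sigma N1 j))%C <> 0.
Proof.
intros HA Hb Hz E.
assert (G := gap_sector beta (node_y sigma A (sqrt (INR N1)) j) z Hb).
assert (Hy : 0 < node_y sigma A (sqrt (INR N1)) j) by apply exp_pos.
specialize (G (Rlt_le _ _ Hy) Hz). assert (Hg := sector_gap_bounds beta Hb).
rewrite node_y_pole in E by exact HA. rewrite RtoC_opp in E.
replace (RtoC (node_y sigma A (sqrt (INR N1)) j) + z)%C with (z - - RtoC (node_y sigma A (sqrt (INR N1)) j))%C in G by ring.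
rewrite E, Cmod_0 in G. assert (T := Cmod_ge_0 z). nra.
Qed.

Lemma sum_n_m_Cmult_l (k : C) (f : nat -> C) (a b : nat) :
  (k * sum_n_m f a b)%C = sum_n_m (fun j => k * f j)%C a b.
Proof. symmetry. apply (sum_n_m_mult_l (K := C_Ring)). Qed.

(** A polynomial times a sum of simple fractions is a sum of fractions with the same poles plus a
    polynomial. *)
Lemma poly_mult_fractions (sigma A beta : R) (N1 n1 : nat) (a : nat -> C) (G : C -> C) :
  0 < A -> 0 <= beta < 2 -> is_poly n1 G ->
  exists b Q, is_poly n1 Q /\ forall z, sector beta z ->
    (G z * fractions sigma A N1 a z)%C = (fractions sigma A N1 b z + Q z)%C.
Proof.
intros HA Hb HG.
assert (HQ : forall j, exists Q, is_poly n1 Q /\ forall z,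
   (G z - G (RtoC (pole A sigma N1 j)) = Q z * (z - RtoC (pole A sigma N1 j)))%C).
{ intros j. apply is_poly_diff_quotient. now apply is_poly_S. }
set (Q := fun j => proj1_sig (constructive_indefinite_description _ (HQ j))).
assert (HQ1 : forall j, is_poly n1 (Q j) /\ forall z,
   (G z - G (RtoC (pole A sigma N1 j)) = Q j z * (z - RtoC (pole A sigma N1 j)))%C).
{ intros j. unfold Q. destruct (constructive_indefinite_description _ _) as [Q0 H0]. exact H0. }
exists (fun j => G (RtoC (pole A sigma N1 j)) * a j)%C, (fun z => sum_n_m (fun j => a j * Q j z)%C 1 N1).
split.
- apply (is_poly_sum_n_m n1 1 N1 (fun j z => a j * Q j z)%C). intros j _. apply is_poly_scal. apply HQ1.
- intros z Hz. unfold fractions.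
  replace (sum_n_m (fun j => G (RtoC (pole A sigma N1 j)) * a j / (z - RtoC (pole A sigma N1 j)))%C 1 N1
     + sum_n_m (fun j => a j * Q j z)%C 1 N1)%C
    with (sum_n_m (fun j => G (RtoC (pole A sigma N1 j)) * a j / (z - RtoC (pole A sigma N1 j)) + a j * Q j z)%C 1 N1)
    by (apply (sum_n_m_plus (G := C_AbelianMonoid))).
  rewrite sum_n_m_Cmult_l. apply sum_n_m_ext. intros j.
  assert (N := pole_off_sector sigma A beta z N1 j HA Hb Hz). destruct (HQ1 j) as [_ E]. specialize (E z).
  set (p := RtoC (pole A sigma N1 j)) in *.
  match goal with |- ?l = ?r => change (@eq C l r) end.
  replace (G z) with (G p + Q j z * (z - p))%C by (rewrite <- E; ring). field. exact N.
Qed.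

Lemma nat_between (x : R) : 0 <= x -> exists n : nat, x <= INR n <= x + 1.
Proof. intros Hx. destruct (nfloor_ex x Hx) as [n [H1 H2]]. exists (S n). rewrite S_INR. lra. Qed.

(** The degree is shared between the approximation of [g] and the polynomial part for [T]; since
    [nu >= 1], rounding up the first share costs at most one more multiple of [nu]. *)
Lemma approximable_mult (alpha sigma A beta B : R) (g T : C -> C) (rt : R -> R) :
  0 < alpha -> 0 < sigma -> 0 < A -> 0 <= beta < 2 -> analytic_in_nbhd (sector beta) g ->
  (forall z, sector beta z -> Cmod (T z) <= B) ->
  (forall nu, 0 <= nu -> rate alpha sigma beta nu <= rt nu) ->
  approximable sigma A beta T rt -> approximable sigma A beta (fun z => g z * T z)%C rt.
Proof.
intros Ha Hs HA Hb Hg HT Hrt [K [D [HK [HD H]]]].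
destruct (analytic_geometric_approximation beta g Hb Hg) as [Kg [rho [HKg [Hrho HP]]]].
destruct (analytic_uniform_nbhd beta g Hb Hg) as [d [Hd Hbd]].
destruct (geometric_small alpha sigma beta Hs Hb Ha rho Hrho) as [Dg [HDg Hgeo]].
assert (Hid : 0 < / d) by now apply Rinv_0_lt_compat.
assert (HB : 0 <= B) by (eapply Rle_trans; [apply Cmod_ge_0|apply (HT 0), sector_0, Hb]).
exists ((/ d + Kg) * K + Kg * B), (Dg + 1 + D).
split; [assert (0 < (/ d + Kg) * K) by (apply Rmult_lt_0_compat; lra); assert (0 <= Kg * B) by nra; lra|].
split; [lra|].
intros N1 n HN1 Hn. set (nu := sqrt (INR N1)) in *.
assert (Hnu : 1 <= nu).
{ unfold nu. rewrite <- sqrt_1. apply sqrt_le_1; [lra|apply pos_INR|]. now apply (le_INR 1). }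
destruct (nat_between (Dg * nu)) as [n1 [Hn1 Hn1']]; [nra|].
assert (Hle : (n1 <= n)%nat) by (apply INR_le; nra).
assert (Hn2 : D * nu <= INR (n - n1)) by (rewrite minus_INR by exact Hle; nra).
destruct (H N1 (n - n1)%nat HN1 Hn2) as [a [P [HPn HE]]].
destruct (HP n1) as [G [HG EG]].
destruct (poly_mult_fractions sigma A beta N1 n1 a G HA Hb HG) as [b [Q [HQ EQ]]].
exists b, (fun z => Q z + G z * P z)%C. split.
{ apply is_poly_plus; [now apply (is_poly_le n1)|]. replace n with (n1 + (n - n1))%nat by lia. now apply is_poly_mult. }
intros z Hz. specialize (HE z Hz). specialize (EG z Hz). specialize (HT z Hz).
assert (Hgz : Cmod (g z) <= / d).
{ apply (Hbd z Hz z). replace (z - z)%C with (RtoC 0) by ring. rewrite Cmod_0. exact Hd. }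
assert (Hr1 : rho ^ n1 <= rt nu).
{ eapply Rle_trans; [|apply (Hrt nu); lra]. specialize (Hgeo nu n1 ltac:(lra) Hn1).
  assert (0 <= rho ^ n1) by (apply pow_le; lra).
  assert (1 <= (1 + nu) ^ 3) by (rewrite <- (pow1 3); apply pow_incr; lra). nra. }
assert (Hr2 : rho ^ n1 <= 1) by (rewrite <- (pow1 n1); apply pow_incr; lra).
assert (Hr0 : 0 <= rho ^ n1) by (apply pow_le; lra).
fold nu in HE.
replace (fractions sigma A N1 b z + (Q z + G z * P z) - g z * T z)%C
  with (G z * (fractions sigma A N1 a z + P z - T z) - (g z - G z) * T z)%C.
2:{ transitivity (G z * fractions sigma A N1 a z + G z * P z - g z * T z)%C; [ring|]. rewrite (EQ z Hz). ring. }
unfold Cminus at 1. eapply Rle_trans; [apply Cmod_triangle|]. rewrite Cmod_opp, !Cmod_mult.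
assert (HGz : Cmod (G z) <= / d + Kg).
{ assert (T1 := Cmod_minus_rev (G z) (g z)). rewrite Cmod_minus_sym in T1. nra. }
assert (B1 : Cmod (G z) * Cmod (fractions sigma A N1 a z + P z - T z) <= (/ d + Kg) * (K * rt nu)).
{ apply Rmult_le_compat; try apply Cmod_ge_0; assumption. }
assert (B2 : Cmod (g z - G z) * Cmod (T z) <= Kg * rt nu * B).
{ apply Rmult_le_compat; try apply Cmod_ge_0; [|exact HT]. eapply Rle_trans; [exact EG|].
  apply Rmult_le_compat_l; lra. }
lra.
Qed.

(** * Conclusion *)

Lemma sup_norm_le (S : C -> Prop) (f : C -> C) (M : R) : (exists z, S z) ->
  (forall z, S z -> Cmod (f z) <= M) -> Rbar_le (Rbar_abs (sup_norm S f)) M.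
Proof.
intros [z0 Hz0] H. unfold sup_norm.
destruct (Lub_Rbar_correct (fun y => exists z, S z /\ y = Cmod (f z))) as [H1 H2].
set (l := Lub_Rbar _) in *.
assert (L1 : Rbar_le l M).
{ apply H2. intros y [z [Hz ->]]. exact (H z Hz). }
assert (L2 : Rbar_le (Cmod (f z0)) l) by (apply H1; now exists z0).
destruct l as [l| |]; simpl in *; try contradiction.
rewrite Rabs_pos_eq; [exact L1|]. eapply Rle_trans; [apply Cmod_ge_0|exact L2].
Qed.

(** A multiple of [z^N2] below the rate makes the degree exact; choice then collects the coefficients
    for all [N1]. *)
Lemma approximable_coefficients (alpha sigma A beta : R) (T : C -> C) (rt : R -> R) :
  (forall nu, 0 <= nu -> rate alpha sigma beta nu <= rt nu) -> 0 <= beta < 2 ->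
  approximable sigma A beta T rt -> exists D, 0 < D /\
  forall N2 : nat -> nat, (forall N1, D * sqrt (INR N1) <= INR (N2 N1)) ->
  exists (K : R) (a c : nat -> nat -> C), 0 < K /\ (forall N1, c N1 (N2 N1) <> RtoC 0) /\
    forall N1, (1 <= N1)%nat ->
      Rbar_le (Rbar_abs (sup_norm (sector beta)
        (fun z => Cminus (ratfun (pole A sigma N1) N1 (a N1) (N2 N1) (c N1) z) (T z))))
        (K * rt (sqrt (INR N1))).
Proof.
intros Hrt Hb [K [D [HK [HD H]]]]. exists D. split; [exact HD|]. intros N2 HN2.
assert (HX : forall N1, exists ac : (nat -> C) * (nat -> C), snd ac (N2 N1) <> RtoC 0 /\
  ((1 <= N1)%nat -> forall z, sector beta z ->
     Cmod (ratfun (pole A sigma N1) N1 (fst ac) (N2 N1) (snd ac) z - T z) <= (K + 1) * rt (sqrt (INR N1)))).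
{ intros N1. destruct (Nat.le_gt_cases 1 N1) as [L|L].
  2:{ exists (fun _ => RtoC 0, fun _ => RtoC 1). split; [|lia]. simpl. intros E. apply RtoC_inj in E. lra. }
  destruct (H N1 (N2 N1) L (HN2 N1)) as [a [P [HP HE]]].
  destruct (is_poly_exact_degree (N2 N1) P (rate alpha sigma beta (sqrt (INR N1))) HP (rate_pos _ _ _ _)) as [c [k [Hc [Hk Ec]]]].
  exists (a, c). split; [exact Hc|]. intros _ z Hz. simpl. specialize (HE z Hz).
  replace (ratfun (pole A sigma N1) N1 a (N2 N1) c z - T z)%C
    with ((fractions sigma A N1 a z + P z - T z) + k * Cpow z (N2 N1))%C.
  2:{ change (ratfun (pole A sigma N1) N1 a (N2 N1) c z) with (fractions sigma A N1 a z + poly_sum c (N2 N1) z)%C.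
      rewrite Ec. ring. }
  eapply Rle_trans; [apply Cmod_triangle|]. rewrite Cmod_mult, Cmod_pow.
  assert (Hz1 := sector_Cmod_le_1 beta z Hb Hz).
  assert (B1 : Cmod z ^ N2 N1 <= 1) by (rewrite <- (pow1 (N2 N1)); apply pow_incr; split; [apply Cmod_ge_0|exact Hz1]).
  assert (B2 : 0 <= Cmod z ^ N2 N1) by apply pow_le, Cmod_ge_0.
  assert (B3 := Hrt (sqrt (INR N1)) (sqrt_pos _)). assert (B4 := Cmod_ge_0 k). nra. }
set (ac := fun N1 => proj1_sig (constructive_indefinite_description _ (HX N1))).
exists (K + 1), (fun N1 => fst (ac N1)), (fun N1 => snd (ac N1)). split; [lra|].
assert (Hac : forall N1, snd (ac N1) (N2 N1) <> RtoC 0 /\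
  ((1 <= N1)%nat -> forall z, sector beta z ->
     Cmod (ratfun (pole A sigma N1) N1 (fst (ac N1)) (N2 N1) (snd (ac N1)) z - T z) <= (K + 1) * rt (sqrt (INR N1)))).
{ intros N1. unfold ac. destruct (constructive_indefinite_description _ _) as [x Hx]. exact Hx. }
split; [intros N1; apply Hac|]. intros N1 HN1. apply sup_norm_le.
- exists (RtoC 0). now apply sector_0.
- now apply Hac.
Qed.

Lemma bigO_intro (u : nat -> Rbar) (v w : nat -> R) (K K' : R) :
  (forall n, (1 <= n)%nat -> Rbar_le (Rbar_abs (u n)) (K * w n)) -> 0 <= K ->
  (forall n, (1 <= n)%nat -> w n <= K' * v n) -> 0 <= K' -> (forall n, 0 <= v n) -> bigO u v.
Proof.
intros H HK Hw HK' Hv. exists (K * K'), 1%nat. intros n Hn.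
eapply Rbar_le_trans; [apply H; exact Hn|]. simpl.
rewrite Rabs_pos_eq by apply Hv. rewrite Rmult_assoc. apply Rmult_le_compat_l; [exact HK|now apply Hw].
Qed.

Lemma lowest_pole_rate (sigma beta : R) : 0 < sigma ->
  4 * PI * ((PI - beta * PI / 2) / sigma) = PI * PI * (2 * (2 - beta)) / sigma.
Proof. intros Hs. field. lra. Qed.

(** At [sigma = sigma_opt] the growth of [|y|^alpha] and the decay of the kernel balance. *)
Lemma sigma_opt_spec (alpha sigma beta : R) : 0 < alpha -> 0 < sigma -> 0 <= beta < 2 ->
  (sigma <= sigma_opt alpha beta <-> sigma * alpha <= 4 * PI * ((PI - beta * PI / 2) / sigma)).
Proof.
intros Ha Hs Hb. rewrite lowest_pole_rate by exact Hs. unfold sigma_opt. assert (P := PI_RGT_0).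
set (s := sqrt (2 * (2 - beta))). set (t := sqrt alpha).
assert (Es : s * s = 2 * (2 - beta)) by (apply sqrt_sqrt; lra).
assert (Et : t * t = alpha) by (apply sqrt_sqrt; lra).
assert (Hs0 : 0 < s) by (apply sqrt_lt_R0; lra). assert (Ht0 : 0 < t) by (apply sqrt_lt_R0; lra).
rewrite <- Es. split; intros H.
- apply (proj1 (Rle_div_r (sigma * alpha) _ sigma Hs)). apply (proj2 (Rle_div_r sigma _ t Ht0)) in H.
  rewrite <- Et. replace (sigma * (t * t) * sigma) with ((sigma * t) * (sigma * t)) by ring.
  replace (PI * PI * (s * s)) with ((PI * s) * (PI * s)) by ring.
  assert (0 < sigma * t) by now apply Rmult_lt_0_compat. apply Rmult_le_compat; lra.
- apply (proj2 (Rle_div_r (sigma * alpha) _ sigma Hs)) in H. apply (proj1 (Rle_div_r sigma _ t Ht0)).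
  apply Rnot_lt_le. intros N. rewrite <- Et in H.
  assert (0 < PI * s) by now apply Rmult_lt_0_compat.
  assert ((PI * s) * (PI * s) < (sigma * t) * (sigma * t)) by (apply Rmult_gt_0_lt_compat; lra). nra.
Qed.

Lemma slow_rate (alpha sigma beta N : R) : 0 < alpha -> 0 < sigma -> 0 <= beta < 2 -> 0 <= N ->
  PI * (sigma_opt alpha beta / sigma) * sqrt (2 * (2 - beta) * N * alpha) =
  4 * PI * ((PI - beta * PI / 2) / sigma) * sqrt N.
Proof.
intros Ha Hs Hb HN. rewrite lowest_pole_rate by exact Hs. unfold sigma_opt.
rewrite (sqrt_mult (2 * (2 - beta) * N)), (sqrt_mult (2 * (2 - beta))); try lra.
2:{ apply Rmult_le_pos; lra. }
assert (Ht0 : 0 < sqrt alpha) by now apply sqrt_lt_R0.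
set (s := sqrt (2 * (2 - beta))).
assert (Es : s * s = 2 * (2 - beta)) by (apply sqrt_sqrt; lra).
rewrite <- Es. field. lra.
Qed.

Lemma exp_shift_le (m u v k : R) : 0 <= m -> v <= u + k -> exp (- (m * u)) <= exp (m * k) * exp (- (m * v)).
Proof. intros Hm H. rewrite <- exp_plus. apply exp_le. nra. Qed.

Theorem theorem4p1 (alpha sigma A beta : R) (g : C -> C)
    (halpha : 0 < alpha) (hsigma : 0 < sigma) (hA : 0 < A)
    (hbeta : 0 <= beta < 2)
    (hg : analytic_in_nbhd (sector beta) g) :
  let sopt := sigma_opt alpha beta in
  let eta := sopt / sigma in
  exists (N2 : nat -> nat) (a at' c ct : nat -> nat -> C),
    let N := fun N1 : nat => INR (N1 + N2 N1) in
    let r := fun N1 : nat =>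
      ratfun (pole A sigma N1) N1 (a N1) (N2 N1) (c N1) in
    let rt := fun N1 : nat =>
      ratfun (pole A sigma N1) N1 (at' N1) (N2 N1) (ct N1) in
    let err := fun N1 : nat =>
      sup_norm (sector beta)
        (fun z => Cminus (r N1 z) (Cmult (g z) (zpow alpha z))) in
    let errt := fun N1 : nat =>
      sup_norm (sector beta)
        (fun z => Cminus (rt N1 z) (Cmult (g z) (zpow_log alpha z))) in
    let slow := fun N1 : nat =>
      exp (- (PI * eta * sqrt (2 * (2 - beta) * N N1 * alpha))) in
    (* the polynomials have degree N2 *)
    (forall N1 : nat, c N1 (N2 N1) <> RtoC 0 /\ ct N1 (N2 N1) <> RtoC 0) /\
    bigO (fun N1 => INR (N2 N1)) (fun N1 => sqrt (INR N1)) /\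
    bigO (fun N1 => INR (N2 N1)) (fun N1 => sqrt (N N1)) /\
    (sigma <= sopt ->
       bigO err (fun N1 => exp (- sigma * alpha * sqrt (N N1)))) /\
    (sopt < sigma -> bigO err slow) /\
    (sigma <= sopt ->
       bigO errt
         (fun N1 => sqrt (N N1) * exp (- sigma * alpha * sqrt (N N1)))) /\
    (sopt < sigma -> bigO errt slow) /\
    ((exists m : nat, (0 < m)%nat /\ alpha = INR m) ->
       (sigma <= sopt ->
          bigO errt (fun N1 => exp (- sigma * alpha * sqrt (N N1)))) /\
       (sopt < sigma -> bigO errt slow)).
Proof.
intros sopt eta.
(* the better of the two rates for the logarithmic function *)
assert (Hlog : exists rl, approximable sigma A beta (zpow_log alpha) rl /\
  (forall nu, 0 <= nu -> rate alpha sigma beta nu <= rl nu <= log_rate alpha sigma beta nu) /\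
  ((exists m : nat, (0 < m)%nat /\ alpha = INR m) -> forall nu, rl nu = rate alpha sigma beta nu)).
{ destruct (excluded_middle_informative (exists m : nat, (0 < m)%nat /\ alpha = INR m)) as [[m [Hm Em]]|Nm].
  - exists (rate alpha sigma beta). split; [apply (log_integer_approximable alpha sigma A beta hsigma hA hbeta halpha m); [lia|exact Em]|].
    split; [|reflexivity]. intros nu Hnu. split; [lra|now apply rate_le_log_rate].
  - exists (log_rate alpha sigma beta). split; [now apply log_power_approximable|].
    split; [|contradiction]. intros nu Hnu. split; [now apply rate_le_log_rate|lra]. }
destruct Hlog as [rl [Hrl [Hrl1 Hrl2]]].
assert (Hr : approximable sigma A beta (zpow alpha) (rate alpha sigma beta)) by now apply power_approximable.
apply (approximable_mult alpha sigma A beta 1 g) in Hr; try assumption; [|now intros; apply (zpow_bound alpha beta)|intros; lra].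
apply (approximable_mult alpha sigma A beta (/ alpha + PI) g) in Hrl; try assumption;
  [|now intros; apply (zpow_log_bound alpha beta)|intros nu Hnu; apply (Hrl1 nu Hnu)].
destruct (approximable_coefficients alpha sigma A beta _ _ (fun nu _ => Rle_refl _) hbeta Hr) as [D1 [HD1 H1]].
destruct (approximable_coefficients alpha sigma A beta _ _ (fun nu Hnu => proj1 (Hrl1 nu Hnu)) hbeta Hrl) as [D2 [HD2 H2]].
set (D := Rmax D1 D2). assert (HDl : D1 <= D) by apply Rmax_l. assert (HDr : D2 <= D) by apply Rmax_r.
assert (HN2 : forall N1, exists n : nat, D * sqrt (INR N1) <= INR n <= D * sqrt (INR N1) + 1).
{ intros N1. apply nat_between. apply Rmult_le_pos; [lra|apply sqrt_pos]. }
set (N2 := fun N1 => proj1_sig (constructive_indefinite_description _ (HN2 N1))).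
assert (HN : forall N1, D * sqrt (INR N1) <= INR (N2 N1) <= D * sqrt (INR N1) + 1).
{ intros N1. unfold N2. destruct (constructive_indefinite_description _ _) as [n Hn]. exact Hn. }
clearbody N2.
destruct (H1 N2) as [K1 [a [c [HK1 [Hc E1]]]]].
{ intros N1. eapply Rle_trans; [|apply HN]. apply Rmult_le_compat_r; [apply sqrt_pos|exact HDl]. }
destruct (H2 N2) as [K2 [at' [ct [HK2 [Hct E2]]]]].
{ intros N1. eapply Rle_trans; [|apply HN]. apply Rmult_le_compat_r; [apply sqrt_pos|exact HDr]. }
exists N2, a, at', c, ct. intros N r rt err errt slow.
(* [N1 + N2 <= nu^2 + (D + 1) nu <= (nu + k)^2] for [nu = sqrt N1 >= 1] *)
set (k := (D + 1) / 2).
assert (Hnu1 : forall n, (1 <= n)%nat -> 1 <= sqrt (INR n)).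
{ intros n Hn. rewrite <- sqrt_1. apply sqrt_le_1; [lra|apply pos_INR|]. now apply (le_INR 1). }
assert (HN2l : forall n, (1 <= n)%nat -> INR (N2 n) <= (D + 1) * sqrt (INR n)).
{ intros n Hn. specialize (Hnu1 n Hn). destruct (HN n) as [_ T]. lra. }
assert (HNle : forall n, sqrt (INR n) <= sqrt (N n)).
{ intros n. apply sqrt_le_1; [apply pos_INR|apply pos_INR|]. apply le_INR. lia. }
assert (HNge : forall n, (1 <= n)%nat -> sqrt (N n) <= sqrt (INR n) + k).
{ intros n Hn. specialize (HN2l n Hn). assert (T := Hnu1 n Hn). assert (T2 := node_sqr n).
  assert (Hk : 0 < k) by (unfold k; lra).
  rewrite <- (sqrt_Rsqr (sqrt (INR n) + k)) by lra. apply sqrt_le_1; [apply pos_INR|apply Rle_0_sqr|].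
  unfold N, Rsqr. rewrite plus_INR.
  assert (Ek : 2 * k = D + 1) by (unfold k; field). nra. }
assert (Hspec := sigma_opt_spec alpha sigma beta halpha hsigma hbeta).
set (m := 4 * PI * ((PI - beta * PI / 2) / sigma)) in *.
assert (Hm : 0 < m).
{ unfold m. rewrite lowest_pole_rate by exact hsigma. assert (P := PI_RGT_0).
  apply Rdiv_lt_0_compat; [|exact hsigma]. apply Rmult_lt_0_compat; [apply Rmult_lt_0_compat; exact P|lra]. }
assert (Hslow : forall n, slow n = exp (- (m * sqrt (N n)))).
{ intros n. unfold slow, eta, sopt. rewrite slow_rate; try assumption; [reflexivity|apply pos_INR]. }
assert (Hfast : sigma <= sopt -> forall n, (1 <= n)%nat ->
   rate alpha sigma beta (sqrt (INR n)) <= exp (sigma * alpha * k) * exp (- sigma * alpha * sqrt (N n))).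
{ intros Hs n Hn. apply Hspec in Hs. unfold rate, rate_exponent. fold m. rewrite Rmin_left by exact Hs.
  replace (- sigma * alpha * sqrt (N n)) with (- (sigma * alpha * sqrt (N n))) by ring.
  apply exp_shift_le; [nra|now apply HNge]. }
assert (Hslow2 : sopt < sigma -> forall n, (1 <= n)%nat -> rate alpha sigma beta (sqrt (INR n)) <= exp (m * k) * slow n).
{ intros Hs n Hn. rewrite Hslow. unfold rate, rate_exponent. fold m. rewrite Rmin_right.
  - apply exp_shift_le; [lra|now apply HNge].
  - apply Rnot_lt_le. intros L. apply Rlt_le in L. apply Hspec in L. unfold sopt in Hs. lra. }
assert (Hslow3 : sopt < sigma -> forall n, (1 <= n)%nat -> rl (sqrt (INR n)) <= exp (m * k) * slow n).
{ intros Hs n Hn. eapply Rle_trans; [apply Hrl1, sqrt_pos|]. unfold log_rate. fold m.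
  destruct (Rle_dec (sigma * alpha) m) as [L|L]; [|now apply Hslow2].
  apply Hspec in L. unfold sopt in Hs. lra. }
assert (P1 : 0 <= exp (sigma * alpha * k)) by (left; apply exp_pos).
assert (P2 : 0 <= exp (m * k)) by (left; apply exp_pos).
assert (Pslow : forall n, 0 <= slow n) by (intros n; left; apply exp_pos).
assert (Hbig : sopt < sigma -> bigO errt slow).
{ intros Hs. apply (bigO_intro _ _ (fun n => rl (sqrt (INR n))) K2 (exp (m * k))); try assumption; [lra|now apply Hslow3]. }
split; [intros N1; split; [apply Hc|apply Hct]|].
split.
{ exists (D + 1), 1%nat. intros n Hn. simpl. rewrite !Rabs_pos_eq by (apply pos_INR || apply sqrt_pos). now apply HN2l. }
split.
{ exists (D + 1), 1%nat. intros n Hn. simpl. rewrite !Rabs_pos_eq by (apply pos_INR || apply sqrt_pos).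
  eapply Rle_trans; [now apply HN2l|]. apply Rmult_le_compat_l; [lra|apply HNle]. }
split.
{ intros Hs. apply (bigO_intro _ _ (fun n => rate alpha sigma beta (sqrt (INR n))) K1 (exp (sigma * alpha * k))); try assumption; [lra|now apply Hfast|].
  intros n. left. apply exp_pos. }
split.
{ intros Hs. apply (bigO_intro _ _ (fun n => rate alpha sigma beta (sqrt (INR n))) K1 (exp (m * k))); try assumption; [lra|now apply Hslow2]. }
split.
{ intros Hs. apply (bigO_intro _ _ (fun n => rl (sqrt (INR n))) K2 (2 * exp (sigma * alpha * k))); try assumption; [lra| |lra|].
  - intros n Hn. eapply Rle_trans; [apply Hrl1, sqrt_pos|]. specialize (Hfast Hs n Hn). specialize (Hnu1 n Hn).
    assert (R0 := rate_pos alpha sigma beta (sqrt (INR n))). specialize (HNle n).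
    apply Rle_trans with (2 * sqrt (N n) * rate alpha sigma beta (sqrt (INR n))).
    + unfold log_rate. destruct (Rle_dec _ _); nra.
    + replace (2 * exp (sigma * alpha * k) * (sqrt (N n) * exp (- sigma * alpha * sqrt (N n))))
        with (2 * sqrt (N n) * (exp (sigma * alpha * k) * exp (- sigma * alpha * sqrt (N n)))) by ring.
      apply Rmult_le_compat_l; [lra|exact Hfast].
  - intros n. apply Rmult_le_pos; [apply sqrt_pos|left; apply exp_pos]. }
split; [exact Hbig|].
intros Hint. split; [|exact Hbig]. intros Hs.
apply (bigO_intro _ _ (fun n => rl (sqrt (INR n))) K2 (exp (sigma * alpha * k))); try assumption; [lra| |].
- intros n Hn. rewrite Hrl2 by exact Hint. now apply Hfast.
- intros n. left. apply exp_pos.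
Qed.
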